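(* For every fixed finite alphabet $\Sigma$, the following decision problem is in P (solvable in deterministic polynomial time). Given: a regular commutative grammar $G$ over $\Sigma$ and a vector $v\in\mathbb{Z}^\Sigma$ whose coordinates are written in binary. Decide: whether $v\in\Psi(G)$.
   Context: For a finite set $X$ and $v\in\mathbb{R}^X$ let $|v|=\sum_{x\in X}|v_x|$. Elements of $\mathbb{N}^X$ are viewed as multisets over $X$; $[x]\in\mathbb{N}^X$ denotes the singleton multiset of $x$; $x\in s$ for a multiset $s$ means $s_x>0$. A commutative grammar is a tuple $G=(\Sigma,Q,q_I,\delta)$ where $\Sigma$ is a finite alphabet of terminal symbols, $Q$ is a finite set of non-terminal symbols, $q_I\in Q$ is the initial non-terminal, and $\delta\subseteq Q\times\mathbb{Z}^\Sigma\times\mathbb{N}^Q$ is a finite set of transitions. (Terminals may be produced in negative quantities.) For a transition $d=(q,a,t)$ write $\mathrm{source}(d)=q$, $\Psi(d)=a$, $\mathrm{target}(d)=t$. $G$ is regular iff every transition $(q,a,t)\in\delta$ satisfies $|t|\le 1$ and $|a|\le 1$. For $R\in\mathbb{N}^\delta$ let $\mathrm{source}(R)=\sum_{d}R_d[\mathrm{source}(d)]$, $\Psi(R)=\sum_d R_d\Psi(d)$, $\mathrm{target}(R)=\sum_d R_d\,\mathrm{target}(d)$. Write $p\to_R q$ iff some $d\in\delta$ with $R_d>0$ has $\mathrm{source}(d)=p$ and $\mathrm{target}(d)(q)>0$; $\to_R^*$ is the reflexive transitive closure. A run from $p\in Q$ is an $R\in\mathbb{N}^\delta$ such that $\mathrm{source}(R)-[p]=\mathrm{target}(R)$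 and $p\to_R^*q$ for every $q\in\mathrm{source}(R)$. The language of $G$ is $\Psi(G)=\{\Psi(R): R \text{ is a run from } q_I\}\subseteq\mathbb{Z}^\Sigma$. The grammar is given as input by explicitly listing its non-terminals and transitions. *)

(* Defs.v *)
From Corelib Require Import BinNums.
From HB Require Import structures.
From mathcomp Require Import all_boot all_order all_algebra finmap.

Set Implicit Arguments.
Unset Strict Implicit.
Unset Printing Implicit Defensive.

Import GRing.Theory.
Local Open Scope ring_scope.

Definition transition (Sigma Q : finType) : choiceType :=
  (Q * {ffun Sigma -> int} * {ffun Q -> nat})%type.

Section Transition.
Context {Sigma Q : finType}.
Implicit Type d : transition Sigma Q.
Definition source d : Q := d.1.1.
Definition effect d : {ffun Sigma -> int} := d.1.2.
Definition target d : {ffun Q -> nat} := d.2.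
End Transition.

Record cgrammar (Sigma : finType) := CGrammar {
  nonterm : finType;
  initial : nonterm;
  delta : {fset transition Sigma nonterm}
}.
Arguments CGrammar {Sigma nonterm}.

Definition msingle (X : finType) (x : X) : {ffun X -> nat} :=
  [ffun y => nat_of_bool (y == x)].

Section Grammar.
Context {Sigma : finType}.
Variable G : cgrammar Sigma.
Implicit Type R : {ffun delta G -> nat}.

Definition regular : Prop :=
  forall d, d \in delta G ->
    (\sum_q target d q <= 1)%N /\ (\sum_x `|effect d x| <= 1)%N.

Definition sourceR R : {ffun nonterm G -> nat} :=
  \sum_(d : delta G) msingle (source (val d)) *+ R d.
Definition effectR R : {ffun Sigma -> int} :=
  \sum_(d : delta G) effect (val d) *+ R d.
Definition targetR R : {ffun nonterm G -> nat} :=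
  \sum_(d : delta G) target (val d) *+ R d.

Definition reach1 R : rel (nonterm G) := fun p q =>
  [exists d : delta G,
    [&& (0 < R d)%N, source (val d) == p & (0 < target (val d) q)%N]].

Definition is_run (p : nonterm G) R : Prop :=
  (forall q, (sourceR R q)%:Z - (msingle p q)%:Z = (targetR R q)%:Z) /\
  (forall q, (0 < sourceR R q)%N -> connect (reach1 R) p q).

Definition language (v : {ffun Sigma -> int}) : Prop :=
  exists R, is_run (initial G) R /\ effectR R = v.

End Grammar.

Inductive move := MoveLeft | Stay | MoveRight.

(* A two-way infinite tape: the cells left of the head (nearest first), the
   scanned cell, the cells right of the head.  [None] is the blank, and all
   cells beyond the two lists are blank. *)
Record tape (T : Type) := Tape {
  tleft : seq (option T);
  thead : option T;
  tright : seq (option T)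
}.

Definition tape_of_word (T : Type) (w : seq T) : tape T :=
  Tape [::] (ohead w) (map Some (behead w)).

Definition write_move (T : Type) (tp : tape T) (c : option T) (m : move) :=
  let: Tape l _ r := tp in
  match m with
  | MoveLeft => Tape (behead l) (head None l) (c :: r)
  | Stay => Tape l c r
  | MoveRight => Tape (c :: l) (head None r) (behead r)
  end.

(* The tape alphabet is the input alphabet [A] extended by work symbols and the
   blank.  A state [q] with [verdict q = Some b] is halting, with answer [b]. *)
Record tm (A : finType) := TM {
  work : finType;
  ntapes : nat;
  state : finType;
  start : state;
  verdict : state -> option bool;
  next : state -> {ffun 'I_ntapes.+1 -> option (A + work)} ->
         state * {ffun 'I_ntapes.+1 -> option (A + work) * move}
}.

Section Machine.
Context {A : finType}.
Variable M : tm A.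

Definition config : Type :=
  (state M * ('I_(ntapes M).+1 -> tape (A + work M)))%type.

Definition step (c : config) : config :=
  let: (q, tps) := c in
  if verdict q is Some _ then c else
  let: (q', act) := next q [ffun i => thead (tps i)] in
  (q', fun i => write_move (tps i) (act i).1 (act i).2).

Definition init_config (w : seq A) : config :=
  (start M, fun i => tape_of_word (if i == ord0 then map inl w else [::])).

Definition decides_in_time (time : nat -> nat) (L : seq A -> Prop) : Prop :=
  forall w, exists b : bool,
    verdict (iter (time (size w)) step (init_config w)).1 = Some b /\
    (b <-> L w).

End Machine.

Definition inP (A : finType) (L : seq A -> Prop) : Prop :=
  exists (M : tm A) (p : {poly nat}), decides_in_time M (fun n => p.[n]) L.

(* Words over [{0, 1, #}], with [None] as the terminator [#]. *)
Definition letter : finType := option bool.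

(* Least significant bit first; zero is the empty word. *)
Fixpoint bits_of_pos (p : positive) : seq bool :=
  match p with
  | xH => [:: true]
  | xO p' => false :: bits_of_pos p'
  | xI p' => true :: bits_of_pos p'
  end.

Definition bits (n : nat) : seq bool :=
  if bin_of_nat n is Npos p then bits_of_pos p else [::].

Definition enc_unary (n : nat) : seq letter := nseq n (Some true) ++ [:: None].
Definition enc_nat (n : nat) : seq letter := map Some (bits n) ++ [:: None].
Definition enc_int (z : int) : seq letter := Some (z < 0) :: enc_nat `|z|%N.

Definition enc_vector (X : finType) (T : Type) (enc : T -> seq letter)
    (v : {ffun X -> T}) : seq letter :=
  flatten [seq enc (v x) | x <- enum X].

(* Since the [n] non-terminals are listed explicitly, an input has size at least
   [n]; writing their indices in unary is therefore only a polynomial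
   overhead.  All entries of vectors are written in binary. *)
Definition enc_transition (Sigma : finType) (n : nat)
    (d : transition Sigma 'I_n) : seq letter :=
  enc_unary (source d) ++ enc_vector enc_int (effect d)
  ++ enc_vector enc_nat (target d).

Definition enc_instance (Sigma : finType) (n : nat) (q0 : 'I_n)
    (ds : seq (transition Sigma 'I_n)) (v : {ffun Sigma -> int}) : seq letter :=
  enc_unary n ++ enc_unary q0
  ++ enc_unary (size ds) ++ flatten (map (@enc_transition Sigma n) ds)
  ++ enc_vector enc_int v.

(* The list [ds] may enumerate the set of transitions in any order and with
   repetitions.  Words that encode no instance are not in the language. *)
Definition regular_membership (Sigma : finType) (w : seq letter) : Prop :=
  exists (n : nat) (q0 : 'I_n) (ds : seq (transition Sigma 'I_n))
         (v : {ffun Sigma -> int}),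
    let G := CGrammar q0 [fset d in ds]%fset in
    [/\ w = enc_instance q0 ds v, regular G & language G v].

(* Main.v *)
Require Import Defs.
From Stdlib Require Import FunctionalExtensionality.
From HB Require Import structures.
From mathcomp Require Import all_boot all_order all_algebra finmap.
From mathcomp Require Import zify.

(* A run of a regular grammar is, up to reordering, a walk from the initial
   non-terminal to a transition without target. Such a walk splits into a walk
   [W] and short closed walks through states of [W]. Closed walks with the same
   effect are interchangeable, and among more than |Sigma| effects there is a
   small integer relation; hence all but |Sigma| effects may be assumed to occur
   few times, and their closed walks can be inserted into [W]. So v is produced
   iff v = eff(W) + sum_x lam_x eff(C_x) where W has polynomial length, there is
   one short cycle C_x through a state of W for each terminal x, and the lam_x
   are natural numbers.

   This is recognized by a nondeterministic machine with a fixed number of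
   counters that are polynomially bounded in the input: it guesses W, remembering
   one state for each terminal, and then the binary digits of the lam_x starting
   with the lowest, together with the C_x (again at each digit). The effects
   accumulated minus the corresponding digits of v, halved, are the carry to the
   next digit, which stays small. Such a machine has polynomially many
   configurations, and a Turing machine computes the reachable ones by saturation. *)

Set Implicit Arguments.
Unset Strict Implicit.
Unset Printing Implicit Defensive.

(** * Tape programs *)

(** Since [v] is written in binary, the multiplicities [lam_x] may be exponential, so a run cannot
    be followed transition by transition. Fixing [Sigma] is what keeps everything else polynomial:
    closed walks of length at most [n.+1] have at most [(2 * n.+1).+1 ^ #|Sigma|] effects, the
    integer relations among these effects have coefficients polynomial in [n], and the machine has
    [11 + 5 * #|Sigma|] counters. The cycles may differ from digit to digit because any closed walk
    through a visited state can be inserted into [W] any number of times. Whatever is guessed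
    therefore still describes a run, so no cycle has to be stored, only one visited state per
    terminal. The carry stays small because halving outweighs what one digit contributes: if it is
    at most [B] and one level, bit included, adds at most [B], it is again at most [B] after
    halving. The number of digits is not limited by the machine, since reachability among finitely
    many configurations does not depend on the length of the path. *)

Section TapePrograms.
Context {A W J Mem : finType}.
Local Notation cell := (option (A + W)).
Local Notation tape_name := (option J).

Inductive cmd :=
  | Mv of tape_name & move
  | Put of tape_name & (Mem -> (tape_name -> cell) -> cell)
  | Set_ of (Mem -> (tape_name -> cell) -> Mem)
  | Seq of cmd & cmd
  | If of (Mem -> (tape_name -> cell) -> bool) & cmd & cmd
  | While of (Mem -> (tape_name -> cell) -> bool) & cmd.

(* Tapes are one-way infinite here: position 0 is to the left of the initial
   head position 1, and no program moves left of it. *)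
Record st := St {
  store : Mem;
  con : tape_name -> nat -> cell;
  pos : tape_name -> nat
}.

Definition scan (s : st) : tape_name -> cell := fun i => con s i (pos s i).

Definition upd (X : eqType) Y (f : X -> Y) (a : X) (b : Y) : X -> Y :=
  fun x => if x == a then b else f x.

Definition setpos s i p := St (store s) (con s) (upd (pos s) i p).
Definition setcon s i f := St (store s) (upd (con s) i f) (pos s).
Definition setmem s m := St m (con s) (pos s).
Definition put s i c := setcon s i (upd (con s i) (pos s i) c).

Inductive exec : cmd -> nat -> st -> st -> Prop :=
  | ExR i s : exec (Mv i MoveRight) 1 s (setpos s i (pos s i).+1)
  | ExS i s : exec (Mv i Stay) 1 s s
  | ExL i s : 0 < pos s i -> exec (Mv i MoveLeft) 1 s (setpos s i (pos s i).-1)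
  | ExPut i f s : exec (Put i f) 1 s (put s i (f (store s) (scan s)))
  | ExSet f s : exec (Set_ f) 1 s (setmem s (f (store s) (scan s)))
  | ExSeq c1 c2 n1 n2 s1 s2 s3 :
      exec c1 n1 s1 s2 -> exec c2 n2 s2 s3 -> exec (Seq c1 c2) (n1 + n2) s1 s3
  | ExIfT (b : Mem -> _ -> bool) c1 c2 n s1 s2 :
      b (store s1) (scan s1) -> exec c1 n s1 s2 -> exec (If b c1 c2) n.+1 s1 s2
  | ExIfF (b : Mem -> _ -> bool) c1 c2 n s1 s2 :
      ~~ b (store s1) (scan s1) -> exec c2 n s1 s2 -> exec (If b c1 c2) n.+1 s1 s2
  | ExWT (b : Mem -> _ -> bool) c n1 n2 s1 s2 s3 :
      b (store s1) (scan s1) -> exec c n1 s1 s2 -> exec (While b c) n2 s2 s3 ->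
      exec (While b c) (n1 + n2).+1 s1 s3
  | ExWF (b : Mem -> _ -> bool) c s : ~~ b (store s) (scan s) -> exec (While b c) 1 s s.

(** The control points of the compiled program. The additional [None] of [If] and [While] is the
    point where the test is evaluated, which costs one step. *)
Fixpoint point (c : cmd) : finType :=
  match c with
  | Mv _ _ | Put _ _ | Set_ _ => unit
  | Seq a b => (point a + point b)%type
  | If _ a b => option (point a + point b)%type
  | While _ a => option (point a)
  end.

Fixpoint entry (c : cmd) : point c :=
  match c with
  | Mv _ _ | Put _ _ | Set_ _ => tt
  | Seq a b => inl (entry a)
  | If _ a b => None
  | While _ a => None
  end.

Definition idle (r : tape_name -> cell) : tape_name -> cell * move :=
  fun i => (r i, Stay).

Definition action := (Mem * (tape_name -> cell * move))%type.

(** A first component [None] means that this step completes the command. In [Seq] it is replaced at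
    once by the entry of the second command, so that passing on control takes no time. *)
Fixpoint cstep (c : cmd) :
    point c -> Mem -> (tape_name -> cell) -> option (point c) * action :=
  match c with
  | Mv i d => fun _ m r => (None, (m, upd (idle r) i (r i, d)))
  | Put i f => fun _ m r => (None, (m, upd (idle r) i (f m r, Stay)))
  | Set_ f => fun _ m r => (None, (f m r, idle r))
  | Seq a b => fun x m r =>
      match x with
      | inl y => let: (z, act) := cstep y m r in
          (Some (if z is Some z' then inl z' else inr (entry b)), act)
      | inr y => let: (z, act) := cstep y m r in (omap inr z, act)
      end
  | If t a b => fun x m r =>
      match x with
      | None => (Some (Some (if t m r then inl (entry a) else inr (entry b))),
                 (m, idle r))
      | Some (inl y) => let: (z, act) := cstep y m r in
          (omap (fun z => Some (inl z)) z, act)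
      | Some (inr y) => let: (z, act) := cstep y m r in
          (omap (fun z => Some (inr z)) z, act)
      end
  | While t a => fun x m r =>
      match x with
      | None => ((if t m r then Some (Some (entry a)) else None), (m, idle r))
      | Some y => let: (z, act) := cstep y m r in (Some z, act)
      end
  end.

Definition move_ok (p : nat) (d : move) := if d is MoveLeft then 0 < p else true.

Definition move_pos (p : nat) (d : move) :=
  match d with MoveLeft => p.-1 | Stay => p | MoveRight => p.+1 end.

Definition act_on (a : action) (s : st) : st :=
  St a.1 (fun i => upd (con s i) (pos s i) (a.2 i).1)
         (fun i => move_pos (pos s i) (a.2 i).2).

Definition action_ok (a : action) (s : st) :=
  forall i, move_ok (pos s i) (a.2 i).2.

Inductive psteps (c : cmd) : nat -> point c -> st -> option (point c) -> st -> Prop :=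
  | PS1 x s : action_ok (cstep x (store s) (scan s)).2 s ->
      psteps 1 x s (cstep x (store s) (scan s)).1 (act_on (cstep x (store s) (scan s)).2 s)
  | PSn n x s y z s' :
      action_ok (cstep x (store s) (scan s)).2 s ->
      (cstep x (store s) (scan s)).1 = Some y ->
      psteps n y (act_on (cstep x (store s) (scan s)).2 s) z s' ->
      psteps n.+1 x s z s'.

Lemma updx (X : eqType) Y (f : X -> Y) a b : upd f a b a = b.
Proof. by rewrite /upd eqxx. Qed.

Lemma updN (X : eqType) Y (f : X -> Y) a b x : x != a -> upd f a b x = f x.
Proof. by rewrite /upd => /negPf ->. Qed.

Lemma upd_id (X : eqType) Y (f : X -> Y) a : upd f a (f a) = f.
Proof. by apply: functional_extensionality => x; rewrite /upd; case: eqP => // ->. Qed.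

Lemma act_on_idle m s : act_on (m, idle (scan s)) s = setmem s m.
Proof.
by congr St => /=; apply: functional_extensionality => i; rewrite upd_id.
Qed.

Lemma psteps_trans c n1 n2 (x : point c) s y s' z s'' :
  psteps n1 x s (Some y) s' -> psteps n2 y s' z s'' -> psteps (n1 + n2) x s z s''.
Proof.
move E : (Some y) => oy H; elim: H y E => {n1 x s oy s'}.
  by move=> x s ok y E H2; apply: PSn H2.
by move=> n x s y z' s' ok E _ IH y' E' H2; rewrite addSn; apply: PSn E _ => //; apply: IH H2.
Qed.

(** One argument for all compound commands: [e] places the control points of a part inside the
    whole, and [k] says where control goes when the part exits. *)
Lemma psteps_embed c c' (e : point c -> point c') (k : option (point c) -> option (point c')) :
  (forall x m r, cstep (e x) m r = (k (cstep x m r).1, (cstep x m r).2)) ->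
  (forall y, k (Some y) = Some (e y)) ->
  forall n x s z s', psteps n x s z s' -> psteps n (e x) s (k z) s'.
Proof.
move=> He Hk n x s z s'; elim=> {n x s z s'}.
  move=> x s ok; have := PS1 (c := c') (x := e x) (s := s).
  by rewrite He /= => H; apply: H.
move=> n x s y z s' ok E _ IH; apply: (@PSn _ _ _ _ (e y)); rewrite He /= ?E ?Hk //.
Qed.

(** The costs in [exec] are exactly the numbers of control steps, so bounds proved for programs are
    bounds on machine steps. *)
Lemma exec_psteps c n s s' : exec c n s s' -> psteps n (entry c) s None s'.
Proof.
elim=> {c n s s'}.
- move=> i s; have := PS1 (c := Mv i MoveRight) (x := tt) (s := s).
  have -> : act_on (cstep (c := Mv i MoveRight) tt (store s) (scan s)).2 s
    = setpos s i (pos s i).+1.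
    congr St; apply: functional_extensionality => j; rewrite /= /upd.
      apply: functional_extensionality => q.
      by case: eqP => // ->; case: eqP => // ->.
    by case: eqP => // ->.
  by apply=> j /=; rewrite /upd; case: eqP.
- move=> i s; have := PS1 (c := Mv i Stay) (x := tt) (s := s).
  have -> : act_on (cstep (c := Mv i Stay) tt (store s) (scan s)).2 s = s.
    case: s => m f p; congr St; apply: functional_extensionality => j; rewrite /= /upd.
      apply: functional_extensionality => q.
      by case: eqP => // ->; case: eqP => // ->.
    by case: eqP => // ->.
  by apply=> j /=; rewrite /upd; case: eqP.
- move=> i s p_gt0; have := PS1 (c := Mv i MoveLeft) (x := tt) (s := s).
  have -> : act_on (cstep (c := Mv i MoveLeft) tt (store s) (scan s)).2 s
    = setpos s i (pos s i).-1.
    congr St; apply: functional_extensionality => j; rewrite /= /upd.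
      apply: functional_extensionality => q.
      by case: eqP => // ->; case: eqP => // ->.
    by case: eqP => // ->.
  by apply=> j /=; rewrite /upd; case: eqP => // ->.
- move=> i f s; have := PS1 (c := Put i f) (x := tt) (s := s).
  have -> : act_on (cstep (c := Put i f) tt (store s) (scan s)).2 s
    = put s i (f (store s) (scan s)).
    congr St; apply: functional_extensionality => j; rewrite /= /upd.
      case: (j =P i) => [-> //|_]; apply: functional_extensionality => q.
      by case: eqP => // ->.
    by case: eqP.
  by apply=> j /=; rewrite /upd; case: eqP.
- move=> f s; have := PS1 (c := Set_ f) (x := tt) (s := s).
  by rewrite act_on_idle /=; apply.
- move=> c1 c2 n1 n2 s1 s2 s3 _ IH1 _ IH2.
  have := @psteps_embed c1 (Seq c1 c2) inl
    (fun z => Some (if z is Some z' then inl z' else inr (entry c2))) _ _ _ _ _ _ _ IH1.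
  move=> /(_ _ _)/psteps_trans; apply => //=; first by move=> x m r; case: (cstep x m r).
  apply: (@psteps_embed c2 (Seq c1 c2) inr (omap inr)) IH2 => //.
  by move=> x m r /=; case: (cstep x m r).
- move=> b c1 c2 n s1 s2 Hb _ IH.
  apply: (@PSn (If b c1 c2) _ None s1 (Some (inl (entry c1)))); rewrite /= ?Hb //.
  rewrite act_on_idle; case: {Hb} s1 IH => m f p IH.
  apply: (@psteps_embed c1 (If b c1 c2) (fun x => Some (inl x)) (omap _)) IH => //.
  by move=> x m' r /=; case: (cstep x m' r).
- move=> b c1 c2 n s1 s2 /negPf Hb _ IH.
  apply: (@PSn (If b c1 c2) _ None s1 (Some (inr (entry c2)))); rewrite /= ?Hb //.
  rewrite act_on_idle; case: {Hb} s1 IH => m f p IH.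
  apply: (@psteps_embed c2 (If b c1 c2) (fun x => Some (inr x)) (omap _)) IH => //.
  by move=> x m' r /=; case: (cstep x m' r).
- move=> b c n1 n2 s1 s2 s3 Hb _ IH1 _ IH2.
  apply: (@PSn (While b c) _ None s1 (Some (entry c))); rewrite /= ?Hb //.
  rewrite act_on_idle; case: {Hb} s1 IH1 => m f p IH1.
  apply: psteps_trans IH2.
  apply: (@psteps_embed c (While b c) Some (fun z => Some z)) IH1 => //.
  by move=> x m' r /=; case: (cstep x m' r).
- move=> b c s /negPf Hb; have := PS1 (c := While b c) (x := None) (s := s).
  rewrite /= Hb act_on_idle; case: {Hb} s => m f p; exact.
Qed.

(** [None] names the input tape, which [init_config] puts at index 0. *)
Definition tape_index (i : tape_name) : 'I_#|J|.+1 :=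
  if i is Some j then lift ord0 (enum_rank j) else ord0.

Definition tape_of_index (k : 'I_#|J|.+1) : tape_name :=
  omap enum_val (unlift ord0 k).

Lemma tape_indexK : cancel tape_index tape_of_index.
Proof.
by case=> [j|]; rewrite /tape_of_index /= ?liftK ?unlift_none //= enum_rankK.
Qed.

Variables (c : cmd) (m0 : Mem) (acc : Mem -> bool).

Definition compile : tm A :=
  @TM A W #|J| (option (point c) * Mem)%type (Some (entry c), m0)
    (fun q => if q.1 is Some _ then None else Some (acc q.2))
    (fun q r =>
      if q.1 is Some x then
        let: (z, act) := cstep x q.2 (fun i => r (tape_index i)) in
        ((z, act.1), [ffun k => act.2 (tape_of_index k)])
      else (q, [ffun k => (r k, Stay)])).

(** The left list is constrained only down to position 0; the cells beyond it are never visited. *)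
Definition tape_rep (tp : tape (A + W)) (f : nat -> cell) (p : nat) :=
  [/\ Defs.thead tp = f p,
      forall j, nth None (tright tp) j = f (p + j.+1) &
      forall j, j < p -> nth None (tleft tp) j = f (p - j.+1)].

Definition reps (tps : 'I_#|J|.+1 -> tape (A + W)) (s : st) :=
  forall i, tape_rep (tps (tape_index i)) (con s i) (pos s i).

Lemma tape_rep_move tp f p x d : tape_rep tp f p -> move_ok p d ->
  tape_rep (write_move tp x d) (upd f p x) (move_pos p d).
Proof.
case: tp => l h r [/= _ Hr Hl]; case: d => /= ok.
- split=> /=.
  + rewrite -nth0 Hl // updN; last by lia.
    by rewrite subn1.
  + case=> [|j] /=; first by rewrite addn1 prednK // updx.
    rewrite Hr updN; last by lia.
    by congr f; lia.
  + move=> j lj; rewrite nth_behead Hl; last by lia.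
    rewrite updN; last by lia.
    by congr f; lia.
- split=> [|j|j lj] /=; first by rewrite updx.
  + by rewrite Hr updN //; lia.
  + by rewrite Hl // updN //; lia.
- split=> [|j|[|j] lj] /=.
  + by rewrite -nth0 Hr addn1 updN //; lia.
  + by rewrite nth_behead Hr updN ?addSnnS //; lia.
  + by rewrite subn1 updx.
  + rewrite Hl; last by lia.
    by rewrite updN //; lia.
Qed.

Lemma compile_step x s tps : action_ok (cstep x (store s) (scan s)).2 s -> reps tps s ->
  exists2 tps', reps tps' (act_on (cstep x (store s) (scan s)).2 s) &
    step (M := compile) ((Some x, store s), tps) =
      (((cstep x (store s) (scan s)).1, (cstep x (store s) (scan s)).2.1), tps').
Proof.
move=> ok Hs.
have E : (fun i => [ffun k => Defs.thead (tps k)] (tape_index i)) = scan s.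
  by apply: functional_extensionality => i; rewrite ffunE; case: (Hs i).
exists (fun k => write_move (tps k) ((cstep x (store s) (scan s)).2.2 (tape_of_index k)).1
                          ((cstep x (store s) (scan s)).2.2 (tape_of_index k)).2).
  by move=> i; rewrite tape_indexK; apply: tape_rep_move (Hs i) (ok i).
rewrite /= E; case: (cstep x _ _) => [z act] /=; congr pair.
by apply: functional_extensionality => k; rewrite ffunE.
Qed.

Lemma compile_psteps n x s z s' tps : psteps n x s z s' -> reps tps s ->
  exists tps', reps tps' s' /\
    iter n (step (M := compile)) ((Some x, store s), tps) = ((z, store s'), tps').
Proof.
move=> H; elim: H tps => {n x s z s'}.
  by move=> x s ok tps Hs; have [tps' ? ?] := compile_step ok Hs; exists tps'.
move=> n x s y z s' ok E _ IH tps Hs.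
have [tps' Hs' Hstep] := compile_step ok Hs.
by have [tps'' [H1 H2]] := IH _ Hs'; exists tps''; rewrite iterSr Hstep E.
Qed.

(** The word starts at position 1. Cell 0 stays blank on every tape and serves as the left end
    marker for [rew]. *)
Definition init_st (w : seq A) : st :=
  St m0 (fun i q => if i is None then
                      if q is q'.+1 then omap inl (onth w q') else None
                    else None) (fun=> 1).

Lemma reps_init w : reps (init_config compile w).2 (init_st w).
Proof.
move=> i; rewrite /init_config /=.
case: i => [j|]; split=> //=.
- by move=> k; rewrite nth_nil.
- by move=> k _; rewrite nth_nil.
- by case: w => //= a w; rewrite /onth.
- move=> k; case: w => [|a w] /=; first by rewrite nth_nil.
  by rewrite -onthE onth_map.
- by case.
Qed.

Lemma exec_decides (L : seq A -> Prop) (time : nat -> nat) :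
  (forall w, exists n s, [/\ exec c n (init_st w) s, n <= time (size w) &
     (acc (store s) <-> L w)]) ->
  decides_in_time compile time L.
Proof.
move=> H w; have [n [s [Hx le_n HL]]] := H w.
have [tps' [_ E]] := compile_psteps (exec_psteps Hx) (reps_init w).
exists (acc (store s)); split=> //.
(* A halted machine idles, so finishing before the allotted time is enough. *)
have halted k cf : verdict (t := compile) cf.1 = Some (acc (store s)) ->
    iter k (step (M := compile)) cf = cf.
  by move=> Hv; elim: k => //= k ->; case: cf Hv => q t /= ->.
rewrite -(subnK le_n) iterD /init_config /=.
by rewrite E halted.
Qed.

End TapePrograms.

(** * Loops and output on tapes *)

Section TapeMacros.
Context {A W J Mem : finType}.
Local Notation cell := (option (A + W)).
Local Notation tape_name := (option J).
Local Notation st := (@st A W J Mem).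
Local Notation cmd := (@cmd A W J Mem).
Implicit Types (s : st) (X Y : tape_name).

Definition ex c n s s' := exists2 m, m <= n & exec c m s s'.

Lemma ex_leq c n n' s s' : n <= n' -> ex c n s s' -> ex c n' s s'.
Proof. by move=> le_n [m le_m ?]; exists m => //; apply: leq_trans le_n. Qed.

Lemma ex_seq c1 c2 n1 n2 s1 s2 s3 :
  ex c1 n1 s1 s2 -> ex c2 n2 s2 s3 -> ex (Seq c1 c2) (n1 + n2) s1 s3.
Proof.
by move=> [m1 ? H1] [m2 ? H2]; exists (m1 + m2); [lia | apply: ExSeq H1 H2].
Qed.

Lemma ex_right X s : ex (Mv X MoveRight) 1 s (setpos s X (pos s X).+1).
Proof. by exists 1 => //; constructor. Qed.

Lemma ex_left X s : 0 < pos s X -> ex (Mv X MoveLeft) 1 s (setpos s X (pos s X).-1).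
Proof. by exists 1 => //; constructor. Qed.

Lemma ex_put X f s : ex (Put X f) 1 s (put s X (f (store s) (scan s))).
Proof. by exists 1 => //; constructor. Qed.

Lemma ex_set f s : ex (Set_ f) 1 s (setmem s (f (store s) (scan s))).
Proof. by exists 1 => //; constructor. Qed.

Lemma ex_if (b : Mem -> _ -> bool) c1 c2 n s s' :
  ex (if b (store s) (scan s) then c1 else c2) n s s' -> ex (If b c1 c2) n.+1 s s'.
Proof.
move=> [m le_m]; case E: (b _ _) => H; exists m.+1 => //; first exact: ExIfT.
by apply: ExIfF => //; rewrite E.
Qed.

Lemma ex_while (b : Mem -> _ -> bool) c n1 n2 s1 s2 s3 :
  b (store s1) (scan s1) -> ex c n1 s1 s2 -> ex (While b c) n2 s2 s3 ->
  ex (While b c) (n1 + n2).+1 s1 s3.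
Proof.
move=> Hb [m1 ? H1] [m2 ? H2]; exists (m1 + m2).+1; [lia | exact: ExWT H1 H2].
Qed.

Lemma ex_while_end (b : Mem -> _ -> bool) c s :
  ~~ b (store s) (scan s) -> ex (While b c) 1 s s.
Proof. by move=> Hb; exists 1 => //; apply: ExWF. Qed.

Lemma st_eq s s' : store s = store s' -> (forall X, con s X =1 con s' X) ->
  pos s =1 pos s' -> s = s'.
Proof.
case: s s' => [m f p] [m' f' p'] /= -> Ef Ep; congr St.
  by apply: functional_extensionality => i; apply: functional_extensionality => q; apply: Ef.
exact: functional_extensionality.
Qed.

Lemma setpos_setpos s X p q : setpos (setpos s X p) X q = setpos s X q.
Proof. by apply: st_eq => // Y; rewrite /= /upd; case: eqP. Qed.

Lemma setposC s X Y p q : X != Y ->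
  setpos (setpos s X p) Y q = setpos (setpos s Y q) X p.
Proof.
move=> /eqP neq; apply: st_eq => // Z; rewrite /= /upd.
by case: (Z =P X) => [->|//]; case: eqP.
Qed.

Lemma setpos_id s X : setpos s X (pos s X) = s.
Proof. by apply: st_eq => // Y; rewrite /= upd_id. Qed.

Definition scans_nonblank X : Mem -> (tape_name -> cell) -> bool := fun _ r => r X.

(** The head may stand on the blank cell just after the contents, where the loop would stop
    immediately; hence the move to the left in front. The loop ends at the blank cell 0. *)
Definition rew X : cmd :=
  Seq (Mv X MoveLeft)
      (Seq (While (scans_nonblank X) (Mv X MoveLeft)) (Mv X MoveRight)).

Definition for_ X (body : cmd) : cmd :=
  Seq (While (scans_nonblank X) (Seq body (Mv X MoveRight))) (rew X).

Definition filled len (f : nat -> cell) := forall q, f q = (0 < q <= len) :> bool.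

Lemma ex_rew s X len : filled len (con s X) -> 0 < pos s X <= len.+1 ->
  ex (rew X) (2 * len + 3) s (setpos s X 1).
Proof.
move=> Hf /andP[p_gt0 p_le].
have back p : p <= len ->
    ex (While (scans_nonblank X) (Mv X MoveLeft)) (2 * p + 1) (setpos s X p) (setpos s X 0).
  elim: p => [|p IH] le_p.
    by apply: ex_while_end; rewrite /scans_nonblank /scan /= updx Hf.
  have -> : 2 * p.+1 + 1 = (1 + (2 * p + 1)).+1 by lia.
  apply: ex_while (IH _); last by lia.
  - by rewrite /scans_nonblank /scan /= updx Hf.
  - have := @ex_left X (setpos s X p.+1).
    by rewrite /= updx setpos_setpos /=; apply.
have -> : 2 * len + 3 = 1 + ((2 * len + 1) + 1) by lia.
apply: ex_seq; first exact: ex_left.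
apply: ex_seq; first by apply: ex_leq (back _ _); lia.
have := @ex_right X (setpos s X 0).
by rewrite /= updx setpos_setpos /=; apply.
Qed.

(** The tape [X] is a unary clock. The invariant [g] is stated with the head of [X] back at 1, so
    that successive and nested loops compose; during the iteration the head is at [j.+1]. *)
Lemma ex_for X body len c (g : nat -> st) :
  (forall j, j <= len -> filled len (con (g j) X) /\ pos (g j) X = 1) ->
  (forall j, j < len -> ex body c (setpos (g j) X j.+1) (setpos (g j.+1) X j.+1)) ->
  ex (for_ X body) (len * (c + 4) + 4) (g 0) (g len).
Proof.
move=> Hg Hbody.
have loop k : k <= len ->
    ex (While (scans_nonblank X) (Seq body (Mv X MoveRight))) (k * (c + 2) + 1)
       (setpos (g (len - k)) X (len - k).+1) (setpos (g len) X len.+1).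
  elim: k => [|k IH] le_k.
    rewrite subn0; apply: ex_while_end; rewrite /scans_nonblank /scan /= updx.
    by case: (Hg len) => // -> _; lia.
  apply: (@ex_leq _ ((c + 1) + (k * (c + 2) + 1)).+1); first by nia.
  have E : len - k = (len - k.+1).+1 by lia.
  apply: ex_while (IH _); last by lia.
    rewrite /scans_nonblank /scan /= updx.
    by case: (Hg (len - k.+1)) => [|-> _]; lia.
  apply: ex_seq; first by apply: Hbody; lia.
  have := @ex_right X (setpos (g (len - k.+1).+1) X (len - k.+1).+1).
  by rewrite /= updx setpos_setpos -E.
apply: (@ex_leq _ ((len * (c + 2) + 1) + (2 * len + 3))); first by nia.
apply: ex_seq.
  have := loop len (leqnn _); rewrite subnn.
  have -> : setpos (g 0) X 1 = g 0; last exact.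
  by have [_ <-] := Hg 0 (leq0n _); rewrite setpos_id.
have [Hl Hp] := Hg len (leqnn _).
have := @ex_rew (setpos (g len) X len.+1) X len Hl.
have -> : g len = setpos (g len) X 1 by rewrite -Hp setpos_id.
by rewrite /= updx !setpos_setpos leqnn; apply.
Qed.

Definition wtape (f : nat -> A + W) len : nat -> cell :=
  fun q => if 0 < q <= len then Some (f q.-1) else None.

Lemma filled_wtape f len : filled len (wtape f len).
Proof. by move=> q; rewrite /wtape; case: ifP. Qed.

(* [s] with the first [l] symbols of [f] written on tape [Y], the head of [Y]
   standing just after them. *)
Definition written s Y f l := setpos (setcon s Y (wtape f l)) Y l.+1.

Lemma setpos_written s Y f l X p : X != Y ->
  setpos (written s Y f l) X p = written (setpos s X p) Y f l.
Proof. by move=> neq; rewrite /written setposC // eq_sym. Qed.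

Definition emit Y g : cmd := Seq (Put Y g) (Mv Y MoveRight).

Lemma ex_emit s Y g f l :
  g (store s) (scan (written s Y f l)) = Some (f l) ->
  ex (emit Y g) 2 (written s Y f l) (written s Y f l.+1).
Proof.
move=> Hg; apply: (@ex_leq _ (1 + 1)) => //.
apply: ex_seq; first exact: ex_put.
have -> : written s Y f l.+1 = setpos (put (written s Y f l) Y (Some (f l))) Y l.+2.
  apply: st_eq => [//|X q|X] /=; rewrite /upd; case: (X =P Y) => // _; rewrite eqxx /wtape.
    case: (q =P l.+1) => [->|neq]; first by rewrite leqnn.
    by have -> : (q <= l.+1) = (q <= l) by lia.
have := @ex_right Y (put (written s Y f l) Y (Some (f l))).
by rewrite /= updx Hg.
Qed.

(** Each iteration appends [a] symbols to the [b] already present, so nested loops produce tapes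
    whose length is a product. *)
Lemma ex_for_written X Y body s f len a b c : X != Y ->
  filled len (con s X) -> pos s X = 1 ->
  (forall j, j < len -> ex body c (written (setpos s X j.+1) Y f (j * a + b))
                                  (written (setpos s X j.+1) Y f (j.+1 * a + b))) ->
  ex (for_ X body) (len * (c + 4) + 4) (written s Y f b) (written s Y f (len * a + b)).
Proof.
move=> neq Hf Hp Hbody.
apply: (@ex_for _ _ _ _ (fun j => written s Y f (j * a + b))).
  by move=> j _; rewrite /= !updN.
by move=> j lt_j; rewrite !setpos_written //; apply: Hbody.
Qed.

Lemma ex_rew_written s Y f l :
  ex (rew Y) (2 * l + 3) (written s Y f l) (setpos (setcon s Y (wtape f l)) Y 1).
Proof.
have -> : setpos (setcon s Y (wtape f l)) Y 1 = setpos (written s Y f l) Y 1.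
  by rewrite /written setpos_setpos.
by apply: ex_rew; rewrite /= updx; [exact: filled_wtape | exact: leqnn].
Qed.

Lemma written0 s Y f : con s Y = (fun=> None) -> pos s Y = 1 -> written s Y f 0 = s.
Proof.
move=> Hc Hp; apply: st_eq => // [X q|X] /=; rewrite /upd; case: eqP => // ->.
  by rewrite Hc /wtape; case: q.
by rewrite Hp.
Qed.

End TapeMacros.

(** * Reachability for counter machines *)

(** Every instruction is a test or a unit step, and may block. [Read v o] tests the input letter at
    the position held by [v], with [None] past the end; counters thus also serve as two-way input
    heads. *)
Inductive instr (Var A : Type) :=
  | Nop
  | Inc of Var
  | Dec of Var
  | Zero of Var
  | Read of Var & option A.
Arguments Nop {Var A}.
Arguments Inc {Var A}.
Arguments Dec {Var A}.
Arguments Zero {Var A}.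

Definition istep (Var : eqType) A (w : seq A) K (i : instr Var A) (r r' : Var -> nat) : Prop :=
  match i with
  | Nop => r' = r
  | Inc v => (r v).+1 < K /\ r' = upd r v (r v).+1
  | Dec v => 0 < r v /\ r' = upd r v (r v).-1
  | Zero v => r v = 0 /\ r' = r
  | Read v o => onth w (r v) = o /\ r' = r
  end.

(* The valuations of the counters are the digits of [x] in base [K]. *)
Section Digits.
Variables (Var : finType) (K : nat).
Hypothesis K_gt0 : 0 < K.

Definition digit (x : nat) (v : Var) : nat := (x %/ K ^ enum_rank v) %% K.

Lemma digit0 : digit 0 = fun=> 0.
Proof. by apply: functional_extensionality => v; rewrite /digit div0n mod0n. Qed.

(** The digit at [r] is not the largest one, so the addition produces no carry. *)
Lemma divn_add_digit x r u : r < u -> (x %/ K ^ r) %% K < K.-1 ->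
  (x + K ^ r) %/ K ^ u = x %/ K ^ u.
Proof.
move=> lt_ru lt_dig.
have Kr_gt0 : 0 < K ^ r by rewrite expn_gt0 K_gt0.
have E : u = r + 1 + (u - r.+1) by lia.
rewrite E !expnD expn1 !divnMA divnDr // divnn Kr_gt0; congr (_ %/ _).
move: (_ %/ _) lt_dig => y lt_dig.
rewrite {1}(divn_eq y K) -addnA divnMDl // (@divn_small (_ + _)) ?addn0 //; lia.
Qed.

Lemma digit_add x v : (digit x v).+1 < K ->
  digit (x + K ^ enum_rank v) = upd (digit x) v (digit x v).+1.
Proof.
move=> lt_dig; apply: functional_extensionality => u; rewrite /upd.
have Kr_gt0 n : 0 < K ^ n by rewrite expn_gt0 K_gt0.
case: (u =P v) => [->|neq].
  rewrite /digit divnDr // divnn Kr_gt0.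
  by rewrite -modnDml modn_small ?addn1.
have {}neq : enum_rank u <> enum_rank v :> nat.
  by move=> E; apply: neq; apply: enum_rank_inj; apply: val_inj.
have [lt_uv|le_vu] := ltnP (enum_rank u) (enum_rank v); last first.
  rewrite /digit divn_add_digit //; first by lia.
  by move: lt_dig; rewrite /digit; lia.
have -> : K ^ enum_rank v = (K ^ (enum_rank v - (enum_rank u).+1)) * K * K ^ enum_rank u.
  by rewrite -expnSr -expnD; congr (_ ^ _); lia.
by rewrite /digit addnC divnMDl // modnMDl.
Qed.

Lemma add_digit_lt x v : x < K ^ #|Var| -> (digit x v).+1 < K ->
  x + K ^ enum_rank v < K ^ #|Var|.
Proof.
move=> lt_x lt_dig.
have K_gt : 0 < K ^ #|Var| by rewrite expn_gt0 K_gt0.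
have E : (x + K ^ enum_rank v) %/ K ^ #|Var| = x %/ K ^ #|Var|.
  by apply: divn_add_digit => //; move: lt_dig; rewrite /digit; lia.
by rewrite ltnNge -divn_gt0 // E divn_small.
Qed.

Lemma digit_sub x v : 0 < digit x v ->
  K ^ enum_rank v <= x /\
  digit (x - K ^ enum_rank v) = upd (digit x) v (digit x v).-1.
Proof.
move=> dig_gt0.
have Kr_gt0 n : 0 < K ^ n by rewrite expn_gt0 K_gt0.
have le_x : K ^ enum_rank v <= x.
  rewrite -divn_gt0 //; move: dig_gt0; rewrite /digit; case: (_ %/ _) => //.
  by rewrite mod0n.
split=> //; set y := x - _.
have Ex : x = y + K ^ enum_rank v by rewrite subnK.
have Edig : digit x v = (digit y v).+1 %% K.
  by rewrite Ex /digit divnDr // divnn Kr_gt0 -addn1 modnDml.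
(* If the digit of [y] were [K - 1], the carry would make the digit of [x] equal to 0. Hence [x]
   arises from [y] by an addition without carry, and [digit_add] applies. *)
have lt_dig : (digit y v).+1 < K.
  have : digit y v < K by rewrite ltn_mod.
  rewrite leq_eqVlt => /orP[/eqP EK|//].
  by rewrite Edig EK modnn in dig_gt0.
rewrite Ex (digit_add lt_dig); apply: functional_extensionality => u.
by rewrite /upd; case: eqP => [->|//]; rewrite eqxx.
Qed.

End Digits.

(** * Saturation on tapes *)

Section Simulation.
Variables (A Var S : finType) (edge : S -> instr Var A -> S -> bool).
Variables (s0 sf : S) (d : nat).
Hypothesis d_gt0 : 0 < d.

Local Notation h := #|Var|.

Inductive nreach (w : seq A) K : S -> (Var -> nat) -> Prop :=
  | NR0 : nreach w K s0 (fun=> 0)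
  | NRS s r i s' r' : nreach w K s r -> edge s i s' -> istep w K i r r' ->
      nreach w K s' r'.

Definition label : finType := (bool * bool * option A)%type.
Definition wsym : finType := (unit + label + {set S})%type.
(* Cells [1, 2, ..] of the tape [Tt] hold, for each code [x] of a valuation, the
   set of states found to be reachable with it; in step with [Tt], the tape
   [Lt v] tells whether the digit [v] of [x] is 0, whether it is [K - 1], and the
   input letter at this position. These labels are read off the tape [Pt], which
   lists them for the possible digits. The tapes [Et b j] measure powers of
   [N + 2]: the head of [Tt] moves by [K ^ enum_rank v] to change the digit [v]. *)
Definition tname : finType := (Var + bool * 'I_(d * h).+1 + bool)%type.
(** A flag for a change of the table in the current sweep, a flag for having met [sf], and a set of
    states on its way to a cell of [Tt]. *)
Definition memory : finType := (bool * bool * {set S})%type.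

Local Notation cell := (option (A + wsym)).
Local Notation st := (@st A wsym tname memory).
Local Notation cmd := (@cmd A wsym tname memory).
Implicit Types (s : st).

Definition In : option tname := None.
Definition Lt (v : Var) : option tname := Some (inl (inl v)).
Definition Et b (j : nat) : option tname := Some (inl (inr (b, inord j))).
Definition Pt : option tname := Some (inr false).
Definition Tt : option tname := Some (inr true).
(* A tape of length [N + 2], where [N] is the size of the input. *)
Definition Bt : option tname := Et true (d * h).

Definition mark : A + wsym := inr (inl (inl tt)).
Definition lab (l : label) : A + wsym := inr (inl (inr l)).
Definition label_of (c : cell) : label :=
  if c is Some (inr (inl (inr l))) then l else (false, false, None).
(** A blank cell counts as the empty set, so the table [Tt] needs no initialization apart from its
    first cell. *)
Definition set_of (c : cell) : {set S} :=
  if c is Some (inr (inr X)) then X else set0.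
Definition letter_of (c : cell) : option A := if c is Some (inl a) then Some a else None.

Lemma Et_eq b b' j j' : j <= d * h -> j' <= d * h ->
  (Et b j == Et b' j') = (b == b') && (j == j').
Proof.
move=> le_j le_j'; apply/eqP/andP => [[-> /(congr1 (@nat_of_ord _))]|[/eqP-> /eqP->]] //.
by rewrite !inordK // => ->.
Qed.

Variable w : seq A.
Local Notation N := (size w).
Local Notation K := ((N + 2) ^ d).

Lemma K_gt0 : 0 < K. Proof. by rewrite expn_gt0 addn2. Qed.

Definition plabel (y : nat) : label := (y == 0, y.+1 == K, onth w y).

Definition tape_length (i : option tname) : nat :=
  match i with
  | None => N
  | Some (inl (inl v)) => K ^ h
  | Some (inl (inr (b, j))) => if b && (j == d * h :> nat) then N + 2 else (N + 2) ^ j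
  | Some (inr b) => if b then 0 else K
  end.

Definition tape_symbol (i : option tname) : nat -> A + wsym :=
  match i with
  | None => fun q => odflt mark (omap inl (onth w q))
  | Some (inl (inl v)) => fun x => lab (plabel (digit K x v))
  | Some (inl (inr (b, j))) => fun=> mark
  | Some (inr b) => fun y => lab (plabel y)
  end.

Definition contents (i : option tname) := wtape (tape_symbol i) (tape_length i).

(* All tapes in [l] hold their final contents. *)
Definition built m (l : seq (option tname)) : st :=
  St m (fun i => if i \in l then contents i else fun=> None) (fun=> 1).

Lemma built_cons m l Y : Y \notin l ->
  setpos (setcon (built m l) Y (contents Y)) Y 1 = built m (Y :: l).
Proof.
move=> Yl; apply: st_eq => // [X q|X]; rewrite /= /upd. rewrite ?inE.
  by case: eqP => [->|].
by case: eqP.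
Qed.

Definition builds (b : cmd) t m l l' := ex b t (built m l) (built m l').

Lemma builds_written (b : cmd) t m l Y : Y \notin l ->
  ex b t (written (built m l) Y (tape_symbol Y) 0)
         (written (built m l) Y (tape_symbol Y) (tape_length Y)) ->
  builds (Seq b (rew Y)) (t + (2 * tape_length Y + 3)) m l (Y :: l).
Proof.
move=> Yl; rewrite written0 //= ?(negPf Yl) // => Hb.
apply: ex_seq Hb _; rewrite -built_cons //; exact: ex_rew_written.
Qed.

Lemma ex_emit_mark s Y l :
  ex (emit Y (fun _ _ => Some mark)) 2 (written s Y (fun=> mark) l)
     (written s Y (fun=> mark) l.+1).
Proof. exact: ex_emit. Qed.

Lemma filled_built m l X : X \in l -> filled (tape_length X) (con (built m l) X).
Proof. by move=> Xl /=; rewrite Xl; apply: filled_wtape. Qed.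

(** * Writing the clocks and the labels *)

Definition build_base : cmd :=
  Seq (Seq (for_ In (emit Bt (fun _ _ => Some mark)))
      (Seq (emit Bt (fun _ _ => Some mark)) (emit Bt (fun _ _ => Some mark)))) (rew Bt).

Lemma build_baseP m l : In \in l -> Bt \notin l ->
  builds build_base (N * 6 + 4 + 4 + (2 * (N + 2) + 3)) m l (Bt :: l).
Proof.
move=> Il Bl; have lenB : tape_length Bt = N + 2 by rewrite /= inordK ?eqxx.
rewrite /build_base -lenB; apply: builds_written => //.
rewrite lenB; apply: ex_seq; last first.
  by rewrite addn2; apply: (ex_seq (n1 := 2) (n2 := 2)); apply: ex_emit_mark.
have := @ex_for_written _ _ _ _ In Bt (emit Bt (fun _ _ => Some mark))
  (built m l) (fun=> mark) N 1 0 2.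
rewrite !muln1 !addn0; apply=> //; first exact: filled_built.
by move=> j _; rewrite !muln1 !addn0; apply: ex_emit_mark.
Qed.

(** Two copies of the powers are needed: [build_label] nests a loop of length [K ^ r] inside one of
    length [K ^ (h.-1 - r)], and these lengths may coincide, whereas one tape can be the clock of
    only one of two nested loops. The outer exponents are below [d * h], which leaves the name
    [Et true (d * h)] free for [Bt]. *)
Definition build_power b (j : nat) : cmd :=
  if j is j'.+1 then
    Seq (for_ Bt (for_ (Et b j') (emit (Et b j) (fun _ _ => Some mark)))) (rew (Et b j))
  else Seq (emit (Et b 0) (fun _ _ => Some mark)) (rew (Et b 0)).

Definition power_time N j := (N + 2) * (((N + 2) ^ j * 6 + 4) + 4) + 4 + (2 * (N + 2) ^ j.+1 + 3).

Lemma tape_length_power b j : j <= d * h -> Et b j != Bt ->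
  tape_length (Et b j) = (N + 2) ^ j.
Proof. by move=> le_j; rewrite Et_eq //= inordK // eqb_id => /negPf->. Qed.

Lemma build_power0P b m l : Et b 0 \notin l -> Et b 0 != Bt ->
  builds (build_power b 0) 7 m l (Et b 0 :: l).
Proof.
move=> El EB; have := @builds_written (emit (Et b 0) (fun _ _ => Some mark)) 2 m l _ El.
by rewrite tape_length_power //; apply; apply: ex_emit_mark.
Qed.

Lemma build_powerP b j m l : j < d * h -> Bt \in l -> Et b j \in l ->
  Et b j.+1 \notin l -> Et b j.+1 != Bt ->
  builds (build_power b j.+1) (power_time N j) m l (Et b j.+1 :: l).
Proof.
move=> lt_j Bl El E'l EB.
have EjB : Et b j != Bt by rewrite Et_eq ?(ltnW lt_j) // ltn_eqF // andbF.
have lenE' := tape_length_power lt_j EB.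
have lenE := tape_length_power (ltnW lt_j) EjB.
have lenB : tape_length Bt = N + 2 by rewrite /= inordK ?eqxx.
rewrite /build_power /power_time -lenE'; apply: builds_written => //.
rewrite lenE' expnS.
have := @ex_for_written _ _ _ _ Bt (Et b j.+1) (for_ (Et b j) (emit (Et b j.+1) (fun _ _ => Some mark)))
  (built m l) (fun=> mark) (N + 2) ((N + 2) ^ j) 0 ((N + 2) ^ j * 6 + 4).
rewrite !addn0; apply=> //; first by rewrite eq_sym.
  by rewrite -lenB; apply: filled_built.
move=> i _; rewrite !addn0.
have := @ex_for_written _ _ _ _ (Et b j) (Et b j.+1) (emit (Et b j.+1) (fun _ _ => Some mark))
  (setpos (built m l) Bt i.+1) (fun=> mark) ((N + 2) ^ j) 1 (i * (N + 2) ^ j) 2.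
rewrite muln1 mulSn; apply=> //.
- by rewrite Et_eq ?(ltnW lt_j) // eqxx ltn_eqF.
- by rewrite -lenE; apply: filled_built.
- by rewrite /= updN.
- by move=> k _; rewrite !muln1; apply: ex_emit_mark.
Qed.

Hypothesis h_gt0 : 0 < h.

Definition letter_label (c : cell) : label := (false, false, letter_of c).
Definition set_first (c : cell) : cell :=
  Some (lab (true, (label_of c).1.2, (label_of c).2)).
Definition set_last (c : cell) : cell :=
  Some (lab ((label_of c).1.1, true, (label_of c).2)).

(** The input is read along, giving blanks beyond its end, and the flags of the last and first cell
    are corrected afterwards. The head of [In] ends far beyond the word, where [rew] would not find
    the contents again, so it is moved back by counting. *)
Definition build_base_labels : cmd :=
  Seq (for_ (Et false d)
        (Seq (emit Pt (fun _ r => Some (lab (letter_label (r In))))) (Mv In MoveRight)))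
  (Seq (Mv Pt MoveLeft) (Seq (Put Pt (fun _ r => set_last (r Pt)))
  (Seq (rew Pt) (Seq (Put Pt (fun _ r => set_first (r Pt)))
       (for_ (Et false d) (Mv In MoveLeft)))))).

Definition base_labels_time N :=
  ((N + 2) ^ d * 7 + 4) + (1 + (1 + ((2 * (N + 2) ^ d + 3) + (1 + ((N + 2) ^ d * 5 + 4))))).

Lemma le_d : d <= d * h. Proof. by rewrite leq_pmulr. Qed.

Lemma letter_of_contents j : letter_of (contents In j.+1) = onth w j.
Proof.
rewrite /contents /wtape /=; case: ltnP => le; last by rewrite onth_default.
by have := onthTE w j; rewrite le; case: onth.
Qed.

Lemma build_base_labelsP m l : In \in l -> Et false d \in l -> Pt \notin l ->
  builds build_base_labels (base_labels_time N) m l (Pt :: l).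
Proof.
move=> Il El Pl.
have lenE : tape_length (Et false d) = K by rewrite tape_length_power ?le_d.
have K0 := K_gt0.
set f0 := fun y => lab (false, false, onth w y).
pose mid := written (built m l) Pt f0 K.
apply: ex_seq.
  have := @ex_for _ _ _ _ (Et false d)
    (Seq (emit Pt (fun _ r => Some (lab (letter_label (r In))))) (Mv In MoveRight))
    K 3 (fun j => setpos (written (built m l) Pt f0 j) In j.+1).
  rewrite -{1}(_ : built m l = setpos (written (built m l) Pt f0 0) In 1); last first.
    by rewrite written0 //= ?(negPf Pl) //; apply: st_eq => // X; rewrite /= /upd; case: eqP.
  apply.
    move=> j _; rewrite -lenE; split; last by rewrite /= !updN.
    exact: filled_built.
  move=> j lt_j; apply: (ex_seq (n1 := 2) (n2 := 1)).
    rewrite !setpos_written //.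
    apply: ex_emit; rewrite /letter_label /scan /=. rewrite updN // Il updN // updN // updx.
    by rewrite letter_of_contents.
  set s1 := written _ _ _ _.
  have := ex_right In s1; congr (ex _ _ _ _).
  rewrite /s1; apply: st_eq => // X.
  by rewrite /= /upd; do ![case: eqP => //= ?; subst].
apply: ex_seq; first by apply: ex_left.
apply: ex_seq; first exact: ex_put.
apply: ex_seq.
  apply: (@ex_rew _ _ _ _ _ _ K); last first.
    by rewrite /= updx K0 leqnSn.
  move=> q; rewrite /= !updx [in LHS]/upd; case: eqP => [->|_] /=.
    by rewrite K0 leqnn.
  exact: filled_wtape.
apply: ex_seq; first exact: ex_put.
set s2 := put _ _ _.
have := @ex_for _ _ _ _ (Et false d) (Mv In MoveLeft) K 1 (fun j => setpos s2 In (K - j).+1).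
rewrite (_ : setpos s2 In (K - 0).+1 = s2); last first.
  apply: st_eq => // X; rewrite /= /upd; case: eqP => // ->.
  by rewrite ?eqxx ?subn0.
have -> : setpos s2 In (K - K).+1 = built m (Pt :: l).
  apply: st_eq => // [X q|X].
    rewrite /= /upd inE; do ![case: (X =P Pt) => [->|neq] //=]; rewrite ?eqxx //.
    rewrite /scan /= /upd /= ?eqxx /contents /wtape /= /plabel /set_first /set_last /f0 /=.
    case: (q =P 1) => [->|neq1] /=; rewrite ?eqxx ?K0 /=.
      by case: (1 =P K) => [<-|neqK] /=; rewrite ?eqxx //=; congr (Some (lab (_, _, _))); apply/esym/eqP.
    case: (q =P K) => [EK|neqK] /=.
      rewrite EK /wtape ?K0 leqnn /= prednK ?eqxx //.
      by congr (Some (lab (_, _, _))); apply/esym/eqP; lia.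
    rewrite /wtape; case: ifP => // /andP[q0 qK].
    by congr (Some (lab (_, _, _))); apply/esym/eqP; lia.
  by rewrite /= /upd subnn; do ![case: eqP => //= ?; subst].
apply.
  move=> j _; rewrite -lenE; split; last by rewrite /= !updN.
  have := @filled_built m l _ El.
  by [].
move=> j lt_j.
have := @ex_left _ _ _ _ In (setpos (setpos s2 In (K - j).+1) (Et false d) j.+1).
have -> : setpos (setpos (setpos s2 In (K - j).+1) (Et false d) j.+1) In
   (pos (setpos (setpos s2 In (K - j).+1) (Et false d) j.+1) In).-1 =
   setpos (setpos s2 In (K - j.+1).+1) (Et false d) j.+1.
  apply: st_eq => // X; rewrite /= /upd.
  by do ![case: eqP => //= ?; subst]; lia.
by apply; rewrite /= updN // updx.
Qed.

Definition build_label v : cmd :=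
  Seq (for_ (Et true (d * (h.-1 - enum_rank v)))
        (for_ Pt (for_ (Et false (d * enum_rank v)) (emit (Lt v) (fun _ r => r Pt)))))
      (rew (Lt v)).

Definition label_time (v : Var) N :=
  ((N + 2) ^ d) ^ (h.-1 - enum_rank v) *
   (((N + 2) ^ d * (((N + 2) ^ d) ^ enum_rank v * 6 + 4 + 4) + 4) + 4) + 4
   + (2 * ((N + 2) ^ d) ^ h + 3).

(** The codes are enumerated as [(j1 * K + y) * K ^ r + i], where [j1], [y] and [i] are the indices
    of the three loops and [y] is the digit at [r]; its label is read off [Pt]. *)
Lemma build_labelP m l v : Et true (d * (h.-1 - enum_rank v)) \in l ->
  Et false (d * enum_rank v) \in l -> Pt \in l -> Lt v \notin l ->
  builds (build_label v) (label_time v N) m l (Lt v :: l).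
Proof.
move=> Eo Ei Pl Ll; have lt_r : enum_rank v < h := ltn_ord _.
set r := nat_of_ord (enum_rank v) in Eo Ei lt_r *.
have K0 := K_gt0.
have Kn n : 0 < K ^ n by rewrite expn_gt0 K0.
have Eh : h.-1 - r + r.+1 = h by move: lt_r; clear; lia.
have lt_o : d * (h.-1 - r) < d * h by rewrite ltn_pmul2l //; lia.
have le_i : d * r <= d * h by rewrite leq_mul2l (ltnW lt_r) orbT.
have lenO : tape_length (Et true (d * (h.-1 - r))) = K ^ (h.-1 - r).
  by rewrite tape_length_power ?expnM ?(ltnW lt_o) // Et_eq ?(ltnW lt_o) // ltn_eqF.
have lenI : tape_length (Et false (d * r)) = K ^ r.
  by rewrite tape_length_power ?expnM.
rewrite /build_label /label_time; apply: builds_written => //.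
set f := tape_symbol (Lt v).
have -> : tape_length (Lt v) = K ^ (h.-1 - r) * (K * K ^ r) + 0.
  by rewrite addn0 -expnS -expnD Eh.
apply: ex_for_written => //.
  by rewrite -lenO; apply: filled_built.
move=> j1 lt_j1; rewrite !addn0.
rewrite mulSn; apply: ex_for_written => //.
  exact: filled_built.
move=> y lt_y.
set s := setpos _ Pt _; set b := y * _ + _.
have -> : y.+1 * K ^ r + j1 * (K * K ^ r) = K ^ r * 1 + b by rewrite /b; lia.
apply: (ex_for_written (c := 2)) => //.
- by rewrite -lenI; apply: filled_built.
move=> i lt_i; rewrite !muln1 addSn; apply: ex_emit.
rewrite /s /scan /= updN // Pl updN // updN // updx.
rewrite /contents /wtape /= lt_y /f /= /digit -/r.
have -> : i + b = (j1 * K + y) * K ^ r + i by rewrite /b; lia.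
rewrite divnMDl // divn_small // addn0.
by rewrite modnMDl modn_small.
Qed.
Lemma builds_seq b1 b2 t1 t2 m l1 l2 l3 :
  builds b1 t1 m l1 l2 -> builds b2 t2 m l2 l3 -> builds (Seq b1 b2) (t1 + t2) m l1 l3.
Proof. exact: ex_seq. Qed.

Fixpoint power_list b n l :=
  if n is n'.+1 then Et b n :: power_list b n' l else Et b 0 :: l.

Fixpoint build_powers b n : cmd :=
  if n is n'.+1 then Seq (build_powers b n') (build_power b n) else build_power b 0.

Fixpoint powers_time N n :=
  if n is n'.+1 then powers_time N n' + power_time N n' else 7.

Lemma mem_power_list X b n l :
  (X \in power_list b n l) = (X \in l) || [exists j : 'I_n.+1, X == Et b j].
Proof.
apply/idP/orP => [|[Xl|/existsP[[j lt_j] /eqP->]]].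
- elim: n => [|n IH] /=; rewrite inE => /orP[/eqP->|//].
  + by right; apply/existsP; exists ord0.
  + by left.
  + by right; apply/existsP; exists ord_max.
  + move=> /IH[Xl|/existsP[j /eqP->]]; first by left.
    by right; apply/existsP; exists (widen_ord (leqnSn _) j).
- by elim: n => [|n IH] /=; rewrite inE ?Xl ?IH orbT.
- elim: n lt_j => [|n IH] /=; rewrite ltnS => le_j; rewrite inE.
    by move: le_j; rewrite leqn0 => /eqP ->; rewrite eqxx.
  by move: le_j; rewrite leq_eqVlt => /orP[/eqP->|/IH->]; rewrite ?eqxx ?orbT.
Qed.

Lemma build_powersP (b : bool) n m l : n <= d * h -> (b -> n < d * h) -> Bt \in l ->
  (forall j, j <= n -> Et b j \notin l) ->
  builds (build_powers b n) (powers_time N n) m l (power_list b n l).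
Proof.
move=> + + Bl; have dh0 : 0 < d * h by rewrite muln_gt0 d_gt0.
have EtB j : j <= d * h -> (b -> j < d * h) -> Et b j != Bt.
  move=> le_j; rewrite Et_eq //; case: b => //= /(_ isT) lt_j.
  by rewrite ltn_eqF.
elim: n => [|n IH] le_n lt_n notin.
  by apply: build_power0P; [apply: notin | apply: EtB].
apply: builds_seq.
  by apply: IH => [|/lt_n|j le_j]; [exact: ltnW | exact: ltnW | apply/notin/leqW].
apply: build_powerP => //.
- by rewrite mem_power_list Bl.
- by rewrite mem_power_list; apply/orP; right; apply/existsP; exists ord_max.
- rewrite mem_power_list (negPf (notin _ _)) //=; apply/existsP => -[j].
  by have lt_j := ltn_ord j; rewrite Et_eq // ?eqxx ?gtn_eqF //; lia.
- by apply: EtB.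
Qed.

Fixpoint build_labels (vs : seq Var) : cmd :=
  if vs is v :: vs' then Seq (build_label v) (build_labels vs')
  else Set_ (fun m _ => m).

Definition labels_time vs N := \sum_(v <- vs) label_time v N + 1.

Lemma build_labelsP m vs l : uniq vs ->
  (forall b j, j < d * h -> Et b j \in l) -> Pt \in l ->
  (forall v, v \in vs -> Lt v \notin l) ->
  builds (build_labels vs) (labels_time vs N) m l (catrev (map Lt vs) l).
Proof.
elim: vs l => [|v vs IH] l /=.
  by move=> *; rewrite /labels_time big_nil; apply: ex_set.
move=> /andP[v_vs uniq_vs] El Pl Ll.
have lt_v : enum_rank v < h := ltn_ord _.
rewrite /labels_time big_cons -addnA; apply: builds_seq.
  apply: build_labelP => //; last by apply: Ll; rewrite mem_head.
  - by apply: El; rewrite ltn_pmul2l //; apply: leq_ltn_trans (leq_subr _ _) _; rewrite ltn_predL.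
  - by apply: El; rewrite ltn_pmul2l.
apply: IH; [by []| | |move=> u u_vs].
- by move=> b j lt_j; rewrite inE (El b j lt_j) orbT.
- by rewrite inE Pl orbT.
rewrite inE negb_or Ll ?inE ?u_vs ?orbT // andbT.
by apply: contra v_vs => /eqP[<-].
Qed.

Definition build_all : cmd :=
  Seq build_base (Seq (build_powers true (d * h).-1) (Seq (build_powers false (d * h))
    (Seq build_base_labels (build_labels (enum Var))))).

Definition build_time N :=
  (N * 6 + 4 + 4 + (2 * (N + 2) + 3)) + (powers_time N (d * h).-1 +
    (powers_time N (d * h) + (base_labels_time N + labels_time (enum Var) N))).

Definition ready m : st := St m contents (fun=> 1).

Lemma build_allP m : ex build_all (build_time N) (init_st m w) (ready m).
Proof.
have dh0 : 0 < d * h by rewrite muln_gt0 d_gt0.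
have -> : init_st m w = built m [:: In].
  apply: st_eq => // -[j|] q //=; rewrite /contents /wtape ?inE ?eqxx /=.
  case: q => [//|q] /=; case: ltnP => le.
    by have := onthTE w q; rewrite le; case: onth.
  by rewrite onth_default.
set l1 := power_list true (d * h).-1 [:: Bt; In].
set l2 := power_list false (d * h) l1.
have -> : ready m = built m (catrev (map Lt (enum Var)) (Pt :: l2)).
  apply: st_eq => // X q; rewrite [in RHS]/=; case: ifP => //.
  rewrite catrevE mem_cat mem_rev /l2 /l1 inE !mem_power_list !inE.
  move/negP => H; have [->|nX] := X =P Tt; first by rewrite /= /contents /wtape; case: q.
  case: H; case: X nX => [[[v|[b [j lt_j]]]|b]|] nX.
  - by rewrite map_f ?mem_enum.
  - have E : Some (inl (inr (b, Ordinal lt_j))) = Et b j.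
      by congr (Some (inl (inr (_, _)))); apply: val_inj; rewrite /= inordK.
    rewrite E {E nX}; case: b => /=.
      move: (lt_j); rewrite ltnS leq_eqVlt => /orP[/eqP Ej|lt].
        have -> : Et true j == Bt by apply/eqP; rewrite Ej.
        by rewrite !orbT.
      have lt' : j < (d * h).-1.+1 by rewrite prednK.
      have -> : [exists i : 'I_(d * h).-1.+1, Et true j == Et true i].
        by apply/existsP; exists (Ordinal lt').
      by rewrite !orbT.
    have -> : [exists i : 'I_(d * h).+1, Et false j == Et false i].
      by apply/existsP; exists (Ordinal lt_j).
    by rewrite !orbT.
  - by case: b nX => // _; rewrite eqxx orbT.
  - by rewrite eqxx !orbT.
have notinL v : Lt v \notin l2.
  by rewrite /l2 /l1 !mem_power_list !inE /=; do ![rewrite negb_or]; rewrite /=;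
     apply/andP; split; apply/existsP => -[].
have notinP : Pt \notin l2.
  by rewrite /l2 /l1 !mem_power_list !inE /=; do ![rewrite negb_or]; rewrite /=;
     apply/andP; split; apply/existsP => -[].
have memE b j : j < d * h -> Et b j \in l2.
  move=> lt_j; rewrite /l2 /l1 !mem_power_list; case: b.
    have lt' : j < (d * h).-1.+1 by rewrite prednK.
    have -> : [exists i : 'I_(d * h).-1.+1, Et true j == Et true i].
      by apply/existsP; exists (Ordinal lt').
    by rewrite !orbT.
  have -> : [exists i : 'I_(d * h).+1, Et false j == Et false i].
    by apply/existsP; exists (Ordinal (leqW lt_j)).
  by rewrite !orbT.
have memI : In \in l2 by rewrite /l2 /l1 !mem_power_list !inE eqxx !orbT.
apply: builds_seq; first by apply: build_baseP.
apply: (@builds_seq _ _ _ _ _ _ l1).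
  apply: build_powersP => //; first by rewrite leq_pred.
  - by rewrite prednK.
  - by rewrite mem_head.
  - move=> j le_j; have lt_j : j < d * h by rewrite -(prednK dh0).
    by rewrite !inE Et_eq ?(ltnW lt_j) //= (ltn_eqF lt_j).
apply: (@builds_seq _ _ _ _ _ _ l2).
  apply: build_powersP => //; first by rewrite /l1 mem_power_list mem_head.
  move=> j le_j; rewrite /l1 mem_power_list !inE Et_eq //=; apply/existsP => -[[i lt_i]].
  by rewrite Et_eq //= -ltnS (leq_trans lt_i) // prednK.
apply: builds_seq.
  apply: build_base_labelsP => //.
  rewrite /l2 mem_power_list; apply/orP; right; apply/existsP.
  by exists (inord d); rewrite inordK ?ltnS ?le_d.
apply: build_labelsP.
- exact: enum_uniq.
- by move=> b j lt_j; rewrite inE (memE b j lt_j) orbT.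
- exact: mem_head.
- by move=> v _; rewrite inE negb_or notinL.
Qed.

(** * Sweeping over the table *)

Definition Gt : option tname := Et false (d * h).
Definition Dt (v : Var) : option tname := Et false (d * enum_rank v).

(** [x] is the code whose labels are scanned, [y] the code whose cell of [Tt] is scanned, and [g]
    the head position of the clock [Gt]. The first two differ while the head of [Tt] is displaced to
    the code of a successor valuation. *)
Definition state_at m tc x y g : st :=
  St m (upd contents Tt tc)
    (fun X => if X == Gt then g else
      match X with
      | Some (inl (inl _)) => x.+1
      | Some (inr true) => y.+1
      | _ => 1
      end).

Definition tau (tc : nat -> cell) x := set_of (tc x.+1).

Definition local_succ (l : Var -> label) (X : {set S}) : {set S} :=
  X :|: [set s' | [exists s in X, [|| edge s Nop s',
     [exists v, (l v).1.1 && edge s (Zero v) s'] |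
     [exists v, edge s (Read v (l v).2) s']]]].
Definition inc_succ v (X : {set S}) : {set S} :=
  [set s' | [exists s in X, edge s (Inc v) s']].
Definition dec_succ v (X : {set S}) : {set S} :=
  [set s' | [exists s in X, edge s (Dec v) s']].

Definition skip : cmd := Set_ (fun (m : memory) (_ : option tname -> cell) => m).

Definition merge : cmd :=
  Seq (Set_ (fun (m : memory) (r : option tname -> cell) => (m.1.1 || ~~ (m.2 \subset set_of (r Tt)), m.1.2, m.2)))
      (Put Tt (fun (m : memory) (r : option tname -> cell) => Some (inr (inr (set_of (r Tt) :|: m.2))))).
Definition visit : cmd :=
  Set_ (fun (m : memory) (r : option tname -> cell) => (m.1.1, m.1.2 || (sf \in set_of (r Tt)),
                    local_succ (fun v => label_of (r (Lt v))) (set_of (r Tt)))).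
Definition shift v dir : cmd := for_ (Dt v) (Mv Tt dir).
Definition increment v : cmd :=
  If (fun (_ : memory) (r : option tname -> cell) => (label_of (r (Lt v))).1.2) skip
    (Seq (Set_ (fun (m : memory) (r : option tname -> cell) => (m.1, inc_succ v (set_of (r Tt)))))
    (Seq (shift v MoveRight) (Seq merge (shift v MoveLeft)))).
Definition decrement v : cmd :=
  If (fun (_ : memory) (r : option tname -> cell) => (label_of (r (Lt v))).1.1) skip
    (Seq (Set_ (fun (m : memory) (r : option tname -> cell) => (m.1, dec_succ v (set_of (r Tt)))))
    (Seq (shift v MoveLeft) (Seq merge (shift v MoveRight)))).
Definition cell_body : cmd :=
  Seq (Seq visit merge)
      (foldr (fun v c => Seq (Seq (increment v) (decrement v)) c) skip (enum Var)).
Definition advance dir : cmd := foldr (fun v c => Seq (Mv (Lt v) dir) c) skip (enum Var).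
Definition round : cmd :=
  Seq (Set_ (fun (m : memory) (_ : option tname -> cell) => (false, m.1.2, m.2)))
  (Seq (for_ Gt (Seq cell_body (Seq (Mv Tt MoveRight) (advance MoveRight))))
       (for_ Gt (Seq (Mv Tt MoveLeft) (advance MoveLeft)))).
Definition saturate : cmd := While (fun (m : memory) (_ : option tname -> cell) => m.1.1) round.
Definition simulator : cmd :=
  Seq build_all (Seq (Put Tt (fun (_ : memory) (_ : option tname -> cell) => Some (inr (inr [set s0])))) saturate).

(** All that a sweep changes in the end. The functions below mirror the programs on this part of the
    state, so that saturation can be analysed without head positions. *)
Definition table := (memory * (nat -> cell))%type.
Implicit Types p : table.

Definition mrg y p : table :=
  ((p.1.1.1 || ~~ (p.1.2 \subset tau p.2 y), p.1.1.2, p.1.2),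
   upd p.2 y.+1 (Some (inr (inr (tau p.2 y :|: p.1.2))))).
Definition vis x p : table :=
  ((p.1.1.1, p.1.1.2 || (sf \in tau p.2 x),
    local_succ (fun v => plabel (digit K x v)) (tau p.2 x)), p.2).
Definition inc_fun x v p : table :=
  if (digit K x v).+1 == K then p
  else mrg (x + K ^ enum_rank v) ((p.1.1, inc_succ v (tau p.2 x)), p.2).
Definition dec_fun x v p : table :=
  if digit K x v == 0 then p
  else mrg (x - K ^ enum_rank v) ((p.1.1, dec_succ v (tau p.2 x)), p.2).
Definition body_fun x p : table :=
  foldl (fun p v => dec_fun x v (inc_fun x v p)) (mrg x (vis x p)) (enum Var).
Fixpoint sweep_fun n p : table :=
  if n is n'.+1 then body_fun n' (sweep_fun n' p) else p.
Definition round_fun p : table := sweep_fun (K ^ h) ((false, p.1.1.2, p.1.2), p.2).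

Notation at_ p x y g := (state_at p.1 p.2 x y g).

Lemma pos_state_atN m tc x y y' g X : X <> Tt ->
  pos (state_at m tc x y g) X = pos (state_at m tc x y' g) X.
Proof. by case: X => [[[?|?]|[]]|]. Qed.

Lemma scanT m tc x y g : scan (state_at m tc x y g) Tt = tc y.+1.
Proof. by rewrite /scan /= updx. Qed.

Lemma scanL m tc x y g v : x < K ^ h ->
  label_of (scan (state_at m tc x y g) (Lt v)) = plabel (digit K x v).
Proof. by move=> lt_x; rewrite /scan /= updN // /contents /wtape /= lt_x. Qed.

Lemma ex_merge p x y g : ex merge 2 (at_ p x y g) (at_ (mrg y p) x y g).
Proof.
apply: (ex_seq (n1 := 1) (n2 := 1)); first exact: ex_set.
cbv beta; rewrite scanT; set s := setmem _ _.
have := ex_put Tt (fun (m : memory) (r : option tname -> cell) => Some (inr (inr (set_of (r Tt) :|: m.2)))) s.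
congr (ex _ _ _ _); rewrite (_ : scan s Tt = p.2 y.+1); last exact: scanT.
by apply: st_eq => // X q; rewrite /= /upd; case: (X == Tt).
Qed.

Lemma lenD v : tape_length (Dt v) = K ^ enum_rank v.
Proof.
rewrite tape_length_power ?expnM //; first by rewrite leq_mul2l (ltnW (ltn_ord _)) orbT.
Qed.

Lemma DG v : Dt v != Gt.
Proof.
rewrite Et_eq // ?leq_mul2l ?(ltnW (ltn_ord _)) ?orbT //=.
by rewrite eqn_mul2l negb_or -lt0n d_gt0 ltn_eqF.
Qed.

Lemma filledE X m tc x y g : X != Tt -> filled (tape_length X) (con (state_at m tc x y g) X).
Proof. by move=> neq /=; rewrite updN //; apply: filled_wtape. Qed.

Lemma ex_shift_right v m tc x y g :
  ex (shift v MoveRight) (K ^ enum_rank v * 5 + 4)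
     (state_at m tc x y g) (state_at m tc x (y + K ^ enum_rank v) g).
Proof.
have := @ex_for _ _ _ _ (Dt v) (Mv Tt MoveRight) (K ^ enum_rank v) 1
  (fun j => state_at m tc x (y + j) g).
rewrite addn0; apply.
  move=> j _; rewrite -lenD; split; first exact: filledE.
  by rewrite /= (negPf (DG v)).
move=> j lt_j; set s := setpos _ _ _.
have := ex_right Tt s; congr (ex _ _ _ _); apply: st_eq => // X.
rewrite /s /= /upd addnS; case: (X =P Tt) => [->//|neq].
by case: eqP => // _; apply: pos_state_atN.
Qed.

Lemma ex_shift_left v m tc x y g : K ^ enum_rank v <= y ->
  ex (shift v MoveLeft) (K ^ enum_rank v * 5 + 4)
     (state_at m tc x y g) (state_at m tc x (y - K ^ enum_rank v) g).
Proof.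
move=> le_y.
have := @ex_for _ _ _ _ (Dt v) (Mv Tt MoveLeft) (K ^ enum_rank v) 1
  (fun j => state_at m tc x (y - j) g).
rewrite subn0; apply.
  move=> j _; rewrite -lenD; split; first exact: filledE.
  by rewrite /= (negPf (DG v)).
move=> j lt_j; set s := setpos _ _ _.
have := @ex_left _ _ _ _ Tt s; rewrite {1}/s /= => /(_ isT).
congr (ex _ _ _ _); apply: st_eq => // X.
rewrite /s /= /upd; case: (X =P Tt) => [->|neq] /=; first by lia.
by case: eqP => // _; apply: pos_state_atN.
Qed.

Definition shift_time (v : Var) N := ((N + 2) ^ d) ^ enum_rank v * 5 + 4.
Definition cell_time N := 3 + (\sum_(v <- enum Var) 2 * (shift_time v N * 2 + 4) + 1).

Lemma ex_skip s : ex skip 1 s s.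
Proof. by have := ex_set (fun (m : memory) (_ : option tname -> cell) => m) s; case: s. Qed.

Lemma ex_increment p x v g : x < K ^ h ->
  ex (increment v) (shift_time v N * 2 + 4) (at_ p x x g) (at_ (inc_fun x v p) x x g).
Proof.
move=> lt_x; have K0 := K_gt0.
have := @ex_if _ _ _ _ (fun (_ : memory) (r : option tname -> cell) => (label_of (r (Lt v))).1.2) skip
    (Seq (Set_ (fun (m : memory) (r : option tname -> cell) => (m.1, inc_succ v (set_of (r Tt)))))
    (Seq (shift v MoveRight) (Seq merge (shift v MoveLeft))))
    (1 + (shift_time v N + (2 + shift_time v N))) (at_ p x x g) (at_ (inc_fun x v p) x x g).
rewrite /increment (_ : (1 + _).+1 = shift_time v N * 2 + 4); last by lia.
apply; rewrite scanL // /inc_fun /plabel /=.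
case: eqP => [_|_]; first by apply: ex_leq (ex_skip _); lia.
apply: ex_seq; first exact: ex_set.
cbv beta; rewrite scanT; apply: ex_seq.
  by have := ex_shift_right v (p.1.1, inc_succ v (set_of (p.2 x.+1))) p.2 x x g; apply.
apply: ex_seq; first exact: (ex_merge (_, _)).
have := @ex_shift_left v _ _ x (x + K ^ enum_rank v) g (leq_addl _ _).
by rewrite addnK; apply.
Qed.

Lemma ex_decrement p x v g : x < K ^ h ->
  ex (decrement v) (shift_time v N * 2 + 4) (at_ p x x g) (at_ (dec_fun x v p) x x g).
Proof.
move=> lt_x; have K0 := K_gt0.
have := @ex_if _ _ _ _ (fun (_ : memory) (r : option tname -> cell) => (label_of (r (Lt v))).1.1) skip
    (Seq (Set_ (fun (m : memory) (r : option tname -> cell) => (m.1, dec_succ v (set_of (r Tt)))))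
    (Seq (shift v MoveLeft) (Seq merge (shift v MoveRight))))
    (1 + (shift_time v N + (2 + shift_time v N))) (at_ p x x g) (at_ (dec_fun x v p) x x g).
rewrite /decrement (_ : (1 + _).+1 = shift_time v N * 2 + 4); last by lia.
apply; rewrite scanL // /dec_fun /plabel /=.
case: eqP => [_|/eqP dig]; first by apply: ex_leq (ex_skip _); lia.
have [le_x _] : K ^ enum_rank v <= x /\ _ := @digit_sub _ _ K_gt0 x v (ltac:(lia)).
apply: ex_seq; first exact: ex_set.
cbv beta; rewrite scanT; apply: ex_seq.
  by have := @ex_shift_left v (p.1.1, dec_succ v (set_of (p.2 x.+1))) p.2 x x g le_x; apply.
apply: ex_seq; first exact: (ex_merge (_, _)).
have := @ex_shift_right v _ _ x (x - K ^ enum_rank v) g.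
by rewrite subnK //; apply.
Qed.

Lemma ex_cell_body p x g : x < K ^ h ->
  ex cell_body (cell_time N) (at_ p x x g) (at_ (body_fun x p) x x g).
Proof.
move=> lt_x; apply: ex_seq.
  apply: (ex_seq (n1 := 1) (n2 := 2)); first exact: ex_set.
  have -> : setmem (at_ p x x g) (p.1.1.1, p.1.1.2 || (sf \in set_of (scan (at_ p x x g) Tt)),
      local_succ (fun v => label_of (scan (at_ p x x g) (Lt v)))
        (set_of (scan (at_ p x x g) Tt))) = at_ (vis x p) x x g.
    cbv beta; rewrite scanT; congr state_at; congr (_, local_succ _ _).
    by apply: functional_extensionality => v; rewrite scanL.
  exact: ex_merge.
rewrite /body_fun; move: (mrg x _) => {}p.
elim: (enum Var) p => [|v vs IH] p; first by rewrite big_nil; apply: ex_skip.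
rewrite big_cons -addnA; apply: ex_seq; last exact: IH.
rewrite mul2n -addnn; apply: ex_seq; first exact: ex_increment.
exact: ex_decrement.
Qed.

Lemma ex_advance_right m tc x y g :
  ex (advance MoveRight) (h + 1) (state_at m tc x y g) (state_at m tc x.+1 y g).
Proof.
pose f (vs : seq Var) := St m (upd contents Tt tc)
    (fun X => if X == Gt then g else
      match X with
      | Some (inl (inl v)) => if v \in vs then x.+1 else x.+2
      | Some (inr true) => y.+1
      | _ => 1
      end).
have -> : state_at m tc x y g = f (enum Var).
  apply: st_eq => // -[[[v|//]|//]|//]; by rewrite /= mem_enum.
have -> : state_at m tc x.+1 y g = f [::] by apply: st_eq => // -[[[v|//]|//]|//].
have -> : h = size (enum Var) by rewrite -cardE.
rewrite /advance; have := enum_uniq Var; elim: (enum Var) => [|v vs IH] /= => [_|/andP[v_vs /IH{}IH]].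
  exact: ex_skip.
rewrite addSn -add1n; apply: ex_seq IH.
have := ex_right (Lt v) (f (v :: vs)); congr (ex _ _ _ _); apply: st_eq => // X.
rewrite /= /upd; case: (X =P Lt v) => [->|neq] /=; first by rewrite mem_head (negPf v_vs).
case: X neq => [[[u|//]|//]|//] neq; rewrite in_cons; case: (u =P v) => [E|//].
by case: neq; rewrite E.
Qed.

Lemma ex_advance_left m tc x y g :
  ex (advance MoveLeft) (h + 1) (state_at m tc x.+1 y g) (state_at m tc x y g).
Proof.
pose f (vs : seq Var) := St m (upd contents Tt tc)
    (fun X => if X == Gt then g else
      match X with
      | Some (inl (inl v)) => if v \in vs then x.+2 else x.+1
      | Some (inr true) => y.+1
      | _ => 1
      end).
have -> : state_at m tc x.+1 y g = f (enum Var).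
  apply: st_eq => // -[[[v|//]|//]|//]; by rewrite /= mem_enum.
have -> : state_at m tc x y g = f [::] by apply: st_eq => // -[[[v|//]|//]|//].
have -> : h = size (enum Var) by rewrite -cardE.
rewrite /advance; have := enum_uniq Var; elim: (enum Var) => [|v vs IH] /= => [_|/andP[v_vs /IH{}IH]].
  exact: ex_skip.
rewrite addSn -add1n; apply: ex_seq IH.
have := @ex_left _ _ _ _ (Lt v) (f (v :: vs)); rewrite {1}/f /= mem_head => /(_ isT).
congr (ex _ _ _ _); apply: st_eq => // X.
rewrite /= /upd; case: (X =P Lt v) => [->|neq] /=; first by rewrite ?mem_head (negPf v_vs).
case: X neq => [[[u|//]|//]|//] neq; rewrite in_cons; case: (u =P v) => [E|//].
by case: neq; rewrite E.
Qed.

Definition round_time N :=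
  1 + ((((N + 2) ^ d) ^ h * (cell_time N + (1 + (h + 1)) + 4) + 4)
     + (((N + 2) ^ d) ^ h * (1 + (h + 1) + 4) + 4)).

Lemma lenG : tape_length Gt = K ^ h.
Proof. by rewrite tape_length_power ?expnM // Et_eq. Qed.

Lemma setposG m tc x y g g' : setpos (state_at m tc x y g) Gt g' = state_at m tc x y g'.
Proof. by apply: st_eq => // X; rewrite /= /upd; case: eqP. Qed.

Lemma ex_round p : ex round (round_time N) (at_ p 0 0 1) (at_ (round_fun p) 0 0 1).
Proof.
set M := K ^ h; pose q : table := ((false, p.1.1.2, p.1.2), p.2).
apply: ex_seq; first exact: ex_set.
apply: (ex_seq (s2 := at_ (round_fun p) M M 1)).
  have := @ex_for _ _ _ _ Gt (Seq cell_body (Seq (Mv Tt MoveRight) (advance MoveRight)))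
    M (cell_time N + (1 + (h + 1))) (fun j => at_ (sweep_fun j q) j j 1).
  apply.
    by move=> j _; rewrite /M -lenG; split; [exact: filledE | rewrite /= eqxx].
  move=> j lt_j; rewrite !setposG; apply: ex_seq; first exact: ex_cell_body.
  apply: ex_seq; last exact: ex_advance_right.
  have := ex_right Tt (at_ (sweep_fun j.+1 q) j j j.+1); congr (ex _ _ _ _).
  apply: st_eq => // X; rewrite /= /upd; case: (X =P Tt) => [->//|neq].
  exact: (pos_state_atN p.1 p.2 j j j.+1 j.+1 neq).
have := @ex_for _ _ _ _ Gt (Seq (Mv Tt MoveLeft) (advance MoveLeft))
  M (1 + (h + 1)) (fun j => at_ (round_fun p) (M - j) (M - j) 1).
rewrite subn0 subnn; apply.
  by move=> j _; rewrite /M -lenG; split; [exact: filledE | rewrite /= eqxx].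
move=> j lt_j; rewrite !setposG.
have -> : M - j = (M - j.+1).+1 by lia.
apply: ex_seq; last exact: ex_advance_left.
have := @ex_left _ _ _ _ Tt (at_ (round_fun p) (M - j.+1).+1 (M - j.+1).+1 j.+1).
rewrite {1}/state_at /= => /(_ isT); congr (ex _ _ _ _).
apply: st_eq => // X; rewrite /= /upd; case: (X =P Tt) => [->//|neq].
  exact: (pos_state_atN p.1 p.2 (M - j.+1).+1 _ _ j.+1 neq).
Qed.

(** * Termination, soundness and completeness of saturation *)

Lemma tau_mrg y p z :
  tau (mrg y p).2 z = if z == y then tau p.2 y :|: p.1.2 else tau p.2 z.
Proof. by rewrite /tau /mrg /= /upd eqSS; case: eqP. Qed.

(** The change flag tells faithfully whether the table has grown: a sweep that ends with the flag
    down has found a fixed point ([adv_same]), and one that raises it has made progress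
    ([adv_new]). *)
Record adv p p' : Prop := Adv {
  adv_mono : forall y, tau p.2 y \subset tau p'.2 y;
  adv_flag : p.1.1.1 -> p'.1.1.1;
  adv_same : ~~ p'.1.1.1 -> tau p'.2 = tau p.2;
  adv_new : p'.1.1.1 -> p.1.1.1 \/ exists y, ~~ (tau p'.2 y \subset tau p.2 y);
  adv_acc : p.1.1.2 -> p'.1.1.2
}.

Lemma adv_refl p p' : tau p'.2 = tau p.2 -> p'.1.1.1 = p.1.1.1 ->
  (p.1.1.2 -> p'.1.1.2) -> adv p p'.
Proof. by move=> Et Ef ?; split; rewrite ?Et ?Ef //; left. Qed.

Lemma adv_trans p1 p2 p3 : adv p1 p2 -> adv p2 p3 -> adv p1 p3.
Proof.
move=> [m12 f12 s12 n12 a12] [m23 f23 s23 n23 a23]; split.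
- by move=> y; apply: subset_trans (m12 y) (m23 y).
- by move/f12/f23.
- by move=> nf; rewrite s23 // s12 //; apply: contra nf.
- move=> /n23[/n12[|[y Hy]]|[y Hy]]; first by left.
    by right; exists y; apply: contra Hy => /(subset_trans (m23 y)).
  by right; exists y; apply: contra Hy => /subset_trans; apply.
- by move/a12/a23.
Qed.

Lemma adv_mrg y X p : adv p (mrg y ((p.1.1, X), p.2)).
Proof.
split.
- by move=> z; rewrite tau_mrg /=; case: eqP => // ->; apply: subsetUl.
- by move=> /= ->.
- rewrite [X in ~~ X]/= negb_or negbK => /andP[_ /setUidPl E].
  by apply: functional_extensionality => z; rewrite tau_mrg /=; case: eqP => // ->.
- case/orP => [|nsub]; first by left.
  right; exists y; rewrite tau_mrg eqxx /=; apply: contra nsub; apply: subset_trans.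
  exact: subsetUr.
- by [].
Qed.

Lemma adv_inc x v p : adv p (inc_fun x v p).
Proof. by rewrite /inc_fun; case: ifP => _; [apply: adv_refl | apply: adv_mrg]. Qed.

Lemma adv_dec x v p : adv p (dec_fun x v p).
Proof. by rewrite /dec_fun; case: ifP => _; [apply: adv_refl | apply: adv_mrg]. Qed.

Lemma adv_vis x p : adv p (vis x p).
Proof. by apply: adv_refl => //= ->. Qed.

Definition counter_succs x p v := dec_fun x v (inc_fun x v p).

Lemma adv_counters x vs p : adv p (foldl (counter_succs x) p vs).
Proof.
elim: vs p => [|v vs IH] p; first exact: adv_refl.
by apply: adv_trans (IH _); apply: adv_trans (adv_inc _ _ _) (adv_dec _ _ _).
Qed.

Lemma adv_body x p : adv p (body_fun x p).
Proof.
apply: adv_trans (adv_counters _ _ _); apply: adv_trans (adv_vis x p) _.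
exact: (adv_mrg x _ (vis x p)).
Qed.

Lemma adv_sweep n p : adv p (sweep_fun n p).
Proof.
elim: n => [|n IH]; first exact: adv_refl.
exact: adv_trans IH (adv_body _ _).
Qed.

Record closed_at (tb : nat -> {set S}) (ac : bool) x : Prop := ClosedAt {
  closed_local : local_succ (fun v => plabel (digit K x v)) (tb x) \subset tb x;
  closed_inc : forall v, (digit K x v).+1 <> K ->
    inc_succ v (tb x) \subset tb (x + K ^ enum_rank v);
  closed_dec : forall v, digit K x v <> 0 ->
    dec_succ v (tb x) \subset tb (x - K ^ enum_rank v);
  closed_acc : sf \in tb x -> ac
}.

Lemma closed_mrg y X p : ~~ (mrg y ((p.1.1, X), p.2)).1.1.1 -> X \subset tau p.2 y.
Proof. by rewrite /= negb_or negbK => /andP[]. Qed.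

(** The flag is down at the end, hence throughout, so all intermediate tables coincide and the
    conditions checked one after the other hold for the same table. *)
Lemma closed_counters x vs p : ~~ (foldl (counter_succs x) p vs).1.1.1 ->
  forall v, v \in vs ->
  ((digit K x v).+1 <> K -> inc_succ v (tau p.2 x) \subset tau p.2 (x + K ^ enum_rank v)) /\
  (digit K x v <> 0 -> dec_succ v (tau p.2 x) \subset tau p.2 (x - K ^ enum_rank v)).
Proof.
elim: vs p => [//|u vs IH] p /= nf v.
have nf2 : ~~ (counter_succs x p u).1.1.1.
  by apply: contra nf; apply: (adv_flag (adv_counters _ _ _)).
have nf1 : ~~ (inc_fun x u p).1.1.1.
  by apply: contra nf2; apply: (adv_flag (adv_dec _ _ _)).
have E1 := adv_same (adv_inc x u p) nf1.
have E2 := adv_same (adv_dec x u (inc_fun x u p)) nf2.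
rewrite inE => /orP[/eqP->|v_vs]; last first.
  by have := IH _ nf v v_vs; rewrite {1 2 3 4}/counter_succs E2 E1.
split=> /eqP /negPf dig.
  by move: nf1; rewrite /inc_fun dig; apply: closed_mrg.
by rewrite -E1; move: nf2; rewrite /counter_succs /dec_fun dig; apply: closed_mrg.
Qed.

Lemma closed_body x p : ~~ (body_fun x p).1.1.1 ->
  closed_at (tau (body_fun x p).2) (body_fun x p).1.1.2 x.
Proof.
move=> nf; have E := adv_same (adv_body x p) nf; rewrite E.
have nf1 : ~~ (mrg x (vis x p)).1.1.1.
  by apply: contra nf; apply: (adv_flag (adv_counters _ _ _)).
have E1 : tau (mrg x (vis x p)).2 = tau p.2.
  have a := adv_mrg x (vis x p).1.2 (vis x p).
  by rewrite (adv_same a nf1).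
have nf' := nf; rewrite /body_fun in nf'.
have := closed_counters nf'; rewrite E1 => H.
split.
- exact: (@closed_mrg x _ (vis x p)).
- by move=> v; have [] := H v (mem_enum _ _).
- by move=> v; have [] := H v (mem_enum _ _).
- move=> sfx; apply: (adv_acc (adv_counters _ _ _)).
  by rewrite /= sfx orbT.
Qed.

Lemma closed_sweep n p : ~~ (sweep_fun n p).1.1.1 ->
  forall x, x < n -> closed_at (tau (sweep_fun n p).2) (sweep_fun n p).1.1.2 x.
Proof.
elim: n => [//|n IH] nf x; have nf1 : ~~ (sweep_fun n p).1.1.1.
  by apply: contra nf; apply: (adv_flag (adv_body _ _)).
have E := adv_same (adv_body n (sweep_fun n p)) nf.
rewrite ltnS leq_eqVlt => /orP[/eqP->|/(IH nf1)[c1 c2 c3 c4]].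
  exact: closed_body.
rewrite [sweep_fun _ _]/= E; split=> // /c4.
exact: (adv_acc (adv_body _ _)).
Qed.

Definition reachable (s : S) x := x < K ^ h /\ nreach w K s (digit K x).
Definition sound p := (forall y (s : S), s \in tau p.2 y -> reachable s y) /\
  (p.1.1.2 -> exists r, nreach w K sf r).

Lemma sound_mrg y (X : {set S}) p : sound p -> (forall s : S, s \in X -> reachable s y) ->
  sound (mrg y ((p.1.1, X), p.2)).
Proof.
move=> [Ht Ha] HX; split=> // z s; rewrite tau_mrg; case: eqP => [->|_]; last exact: Ht.
by rewrite inE => /orP[/Ht|/HX].
Qed.

Lemma local_succ_sound x (s : S) (X : {set S}) : (forall s : S, s \in X -> reachable s x) ->
  s \in local_succ (fun v => plabel (digit K x v)) X -> reachable s x.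
Proof.
move=> HX; rewrite !inE => /orP[/HX//|/existsP[s' /andP[/HX[lt_x Hs'] Hs]]]; split=> //.
case/or3P: Hs => [Hs|/existsP[v /andP[/eqP dig Hs]]|/existsP[v Hs]].
- exact: NRS Hs' Hs _.
- exact: NRS Hs' Hs _.
- exact: NRS Hs' Hs _.
Qed.

Lemma sound_inc x v p : sound p -> sound (inc_fun x v p).
Proof.
move=> Hp; rewrite /inc_fun; case: eqP => // dig; apply: sound_mrg => // s.
rewrite inE => /existsP[s' /andP[/Hp.1[lt_x Hs'] Hs]].
have lt_dig : (digit K x v).+1 < K.
  by move/eqP: dig; rewrite neq_ltn => /orP[//|]; rewrite ltnNge ltn_mod K_gt0.
split; first exact: add_digit_lt K_gt0 _ _ _ _.
by apply: NRS Hs' Hs _; split=> //; apply: digit_add K_gt0 _ _ _.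
Qed.

Lemma sound_dec x v p : sound p -> sound (dec_fun x v p).
Proof.
move=> Hp; rewrite /dec_fun; case: eqP => // /eqP; rewrite -lt0n => dig.
apply: sound_mrg => // s; rewrite inE => /existsP[s' /andP[/Hp.1[lt_x Hs'] Hs]].
have [le_x E] := digit_sub K_gt0 dig.
split; first exact: leq_ltn_trans (leq_subr _ _) lt_x.
by apply: NRS Hs' Hs _; split.
Qed.

Lemma sound_body x p : sound p -> sound (body_fun x p).
Proof.
move=> Hp; have : sound (mrg x (vis x p)).
  have Hv : sound (vis x p).
    split=> [y s /Hp.1 //|] /= /orP[/Hp.2//|/Hp.1[_ ?]].
    by eexists; eassumption.
  by apply: (@sound_mrg x _ (vis x p)) => // s; apply: local_succ_sound => {}s /Hp.1.
rewrite /body_fun; elim: (enum Var) (mrg _ _) => [//|v vs IH] q Hq.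
by apply: IH; apply/sound_dec/sound_inc.
Qed.

Lemma sound_sweep n p : sound p -> sound (sweep_fun n p).
Proof. by elim: n => //= n IH Hp; apply: sound_body; apply: IH. Qed.

Definition table_size p := \sum_(y < K ^ h) #|tau p.2 y|.

Lemma table_size_le p : table_size p <= K ^ h * #|S|.
Proof.
rewrite /table_size -[X in _ <= X * _]card_ord -sum_nat_const.
by apply: leq_sum => y _; apply: max_card.
Qed.

(** Soundness confines the new state to a code below [K ^ h], where [table_size] counts it. *)
Lemma adv_size p p' : adv p p' -> sound p' -> ~~ p.1.1.1 -> p'.1.1.1 ->
  table_size p < table_size p'.
Proof.
move=> a [Ht _] nf f'; case: (adv_new a f') => [f|[y Hy]]; first by rewrite f in nf.
have [s sy sny] := subsetPn Hy.
have [lt_y _] := Ht _ _ sy.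
rewrite /table_size (bigD1 (Ordinal lt_y)) //= [X in _ < X](bigD1 (Ordinal lt_y)) //=.
rewrite -addSn leq_add //.
  by apply: proper_card; rewrite properE (adv_mono a).
by apply: leq_sum => z _; apply/subset_leq_card/(adv_mono a).
Qed.

Definition saturate_time k N := k.+1 * (round_time N + 1) + 1.

(** A sweep that leaves the flag up has added a state to some cell; [k] bounds the growth that is
    still possible, and with it the number of sweeps. *)
Lemma ex_saturate k p : sound p -> p.1.1.1 -> K ^ h * #|S| <= table_size p + k ->
  exists p', [/\ ex saturate (saturate_time k N) (at_ p 0 0 1) (at_ p' 0 0 1),
    sound p', forall y, tau p.2 y \subset tau p'.2 y &
    forall x, x < K ^ h -> closed_at (tau p'.2) p'.1.1.2 x].
Proof.
elim: k p => [|k IH] p Hp f le_k;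
  set q : table := ((false, p.1.1.2, p.1.2), p.2);
  have aq : adv q (round_fun p) := adv_sweep _ _;
  have Hq : sound (round_fun p) by [apply: sound_sweep];
  have := ex_round p; case f' : (round_fun p).1.1.1.
- have := adv_size aq Hq isT f'; rewrite [table_size q](_ : _ = table_size p) //.
  by have := table_size_le (round_fun p); lia.
- move=> Hx; exists (round_fun p); split=> //; first 1 last.
  + exact: (adv_mono aq).
  + by apply: closed_sweep; rewrite f'.
  apply: ex_leq (ex_while _ Hx (ex_while_end _ _)) => //; last by rewrite /= f'.
  by rewrite /saturate_time; lia.
- have := adv_size aq Hq isT f'; rewrite [table_size q](_ : _ = table_size p) // => lt_size Hx.
  have [|p' [Hx' Hp' mono' closed']] := IH (round_fun p) Hq f'; first by lia.
  exists p'; split=> //; last first.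
    by move=> y; apply: subset_trans (mono' y); apply: (adv_mono aq).
  apply: ex_leq (ex_while _ Hx Hx') => //.
  by rewrite /saturate_time; lia.
- move=> Hx; exists (round_fun p); split=> //; first 1 last.
  + exact: (adv_mono aq).
  + by apply: closed_sweep; rewrite f'.
  apply: ex_leq (ex_while _ Hx (ex_while_end _ _)) => //; last by rewrite /= f'.
  by rewrite /saturate_time; lia.
Qed.

Lemma closed_complete p : (forall x, x < K ^ h -> closed_at (tau p.2) p.1.1.2 x) ->
  s0 \in tau p.2 0 ->
  forall (s : S) r, nreach w K s r -> exists x, [/\ x < K ^ h, digit K x = r & s \in tau p.2 x].
Proof.
move=> Hc s0p s r; elim=> {s r} [|s r i s' r' _ [x [lt_x Er sx]] Hs Hi].
  by exists 0; rewrite expn_gt0 K_gt0 digit0.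
have [c1 c2 c3 _] := Hc x lt_x.
have loc : r' = r -> s' \in local_succ (fun v => plabel (digit K x v)) (tau p.2 x) ->
    exists x0 : nat, [/\ x0 < K ^ h, digit K x0 = r' & s' \in tau p.2 x0].
  by move=> -> /(subsetP c1) ?; exists x.
subst r; case: i Hs Hi => [|v|v|v|v o] Hs.
- move=> Er'; apply: loc => //; rewrite !inE; apply/orP; right.
  by apply/existsP; exists s; rewrite sx Hs.
- move=> [lt_dig Er']; exists (x + K ^ enum_rank v); split.
  + exact: add_digit_lt K_gt0 _ _ _ _.
  + by rewrite Er'; apply: digit_add K_gt0 _ _ _.
  + apply: (subsetP (c2 v _)); first by move=> E; rewrite E ltnn in lt_dig.
    by rewrite inE; apply/existsP; exists s; rewrite sx.
- move=> [dig Er']; have [le_x E] := digit_sub K_gt0 dig.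
  exists (x - K ^ enum_rank v); split.
  + exact: leq_ltn_trans (leq_subr _ _) lt_x.
  + by rewrite Er'.
  + apply: (subsetP (c3 v _)); first by move=> E0; rewrite E0 in dig.
    by rewrite inE; apply/existsP; exists s; rewrite sx.
- move=> [dig Er']; apply: loc => //; rewrite !inE; apply/orP; right.
  apply/existsP; exists s; rewrite sx /=; apply/or3P/Or32/existsP.
  by exists v; rewrite dig Hs.
- move=> [dig Er']; apply: loc => //; rewrite !inE; apply/orP; right.
  apply/existsP; exists s; rewrite sx /=; apply/or3P/Or33/existsP.
  by exists v; rewrite dig Hs.
Qed.

Definition simulator_time N :=
  build_time N + (1 + saturate_time (((N + 2) ^ d) ^ h * #|S|) N).

Lemma ex_simulator : exists s,
  ex simulator (simulator_time N) (init_st (true, false, set0) w) s /\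
  ((store s).1.2 <-> exists r, nreach w K sf r).
Proof.
(* The flag is up from the start, so that a first sweep takes place. Code 0, stored in cell 1, is
   the valuation with all counters 0. *)
pose p : table := ((true, false, set0), upd (contents Tt) 1 (Some (inr (inr [set s0])))).
have tau_p y : tau p.2 y = if y == 0 then [set s0] else set0.
  rewrite /tau /= /upd eqSS; case: (y =P 0) => // /eqP y0.
have Hp : sound p.
  split=> // y s; rewrite tau_p; case: eqP => [->|_]; rewrite inE // => /eqP->.
  by split; [rewrite expn_gt0 K_gt0 | rewrite digit0; constructor].
have [p' [Hx [Ht Ha] mono Hc]] := ex_saturate Hp isT (leq_addl _ _).
exists (at_ p' 0 0 1); split.
  apply: ex_seq; first exact: build_allP.
  apply: (ex_seq (n1 := 1)); last exact: Hx.
  have -> : at_ p 0 0 1 = put (ready (true, false, set0)) Tt (Some (inr (inr [set s0]))).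
    apply: st_eq => // -[[[v|[b j]]|[]]|] //=; by case: eqP.
  exact: ex_put.
split=> /= [/Ha //|[r Hr]].
have s0p : s0 \in tau p'.2 0 by apply: (subsetP (mono 0)); rewrite tau_p eqxx inE.
by have [x [lt_x _ sx]] := closed_complete Hc s0p Hr; apply: closed_acc (Hc x lt_x) sx.
Qed.

End Simulation.

(** * Regular programs over counters *)

Definition polynomial (f : nat -> nat) := exists p : {poly nat}, forall n, f n = (p.[n])%R.

Lemma polynomial_const c : polynomial (fun=> c).
Proof. by exists (c%:P)%R => n; rewrite hornerC. Qed.

Lemma polynomial_id : polynomial id.
Proof. by exists 'X%R => n; rewrite hornerX. Qed.

Lemma polynomialD f g : polynomial f -> polynomial g -> polynomial (fun n => f n + g n).
Proof. by move=> [p Hp] [q Hq]; exists (p + q)%R => n; rewrite hornerD Hp Hq. Qed.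

Lemma polynomialM f g : polynomial f -> polynomial g -> polynomial (fun n => f n * g n).
Proof. by move=> [p Hp] [q Hq]; exists (p * q)%R => n; rewrite hornerM Hp Hq. Qed.

Lemma polynomialX f k : polynomial f -> polynomial (fun n => f n ^ k).
Proof.
move=> Hf; elim: k => [|k IH]; first exact: polynomial_const.
have [p Hp] := polynomialM Hf IH; exists p => n; by rewrite expnS Hp.
Qed.

Lemma polynomialS f : polynomial f -> polynomial (fun n => (f n).+1).
Proof.
move=> Hf; have [p Hp] := polynomialD Hf (polynomial_const 1).
by exists p => n; rewrite -Hp addn1.
Qed.

Lemma polynomial_sum I (s : seq I) (F : I -> nat -> nat) :
  (forall i, polynomial (F i)) -> polynomial (fun n => \sum_(i <- s) F i n).
Proof.
move=> HF; elim: s => [|i s IH].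
  by have [p Hp] := polynomial_const 0; exists p => n; rewrite big_nil -(Hp n).
by have [p Hp] := polynomialD (HF i) IH; exists p => n; rewrite big_cons -Hp.
Qed.

Ltac polynomial_tac :=
  repeat first [apply: polynomialD | apply: polynomialM | apply: polynomialX
               | apply: polynomialS | apply: polynomial_const | apply: polynomial_id].

Section SimulationTime.
Variables (A Var S : finType) (edge : S -> instr Var A -> S -> bool).
Variables (s0 sf : S) (d : nat).
Hypotheses (d_gt0 : 0 < d) (h_gt0 : 0 < #|Var|).

Lemma polynomial_powers_time n : polynomial (powers_time^~ n).
Proof.
elim: n => [|n IH] /=; first exact: polynomial_const.
by apply: polynomialD => //; rewrite /power_time; polynomial_tac.
Qed.

Lemma polynomial_simulator_time : polynomial (simulator_time Var S d).
Proof.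
rewrite /simulator_time /build_time /base_labels_time /saturate_time /round_time.
rewrite /cell_time /labels_time.
polynomial_tac; try exact: polynomial_powers_time.
- by apply: polynomial_sum => v; rewrite /label_time; polynomial_tac.
- by apply: polynomial_sum => v; rewrite /shift_time; polynomial_tac.
Qed.

(** The exponent, the set of counters and the set of states are fixed, so the number of
    configurations is polynomial in the length of the input. *)
Theorem nreach_inP : inP (fun w => exists r, nreach edge s0 w ((size w + 2) ^ d) sf r).
Proof.
have [p Hp] := polynomial_simulator_time.
exists (compile (simulator edge s0 sf d) (true, false, set0) (fun m => m.1.2)), p.
apply: exec_decides => w.
have [s [[n le_n Hx] Hs]] := ex_simulator edge s0 sf d_gt0 w h_gt0.
by exists n, s; split=> //; rewrite -Hp.
Qed.

End SimulationTime.

Section InstrEq.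
Variables (Var A : finType).

Definition instr_code (i : instr Var A) : option (Var + Var + Var + Var * option A) :=
  match i with
  | Nop => None
  | Inc v => Some (inl (inl (inl v)))
  | Dec v => Some (inl (inl (inr v)))
  | Zero v => Some (inl (inr v))
  | Read v o => Some (inr (v, o))
  end.

Definition instr_decode (c : option (Var + Var + Var + Var * option A)) : instr Var A :=
  match c with
  | None => Nop
  | Some (inl (inl (inl v))) => Inc v
  | Some (inl (inl (inr v))) => Dec v
  | Some (inl (inr v)) => Zero v
  | Some (inr (v, o)) => Read v o
  end.

Lemma instr_codeK : cancel instr_code instr_decode.
Proof. by case. Qed.

HB.instance Definition _ := Equality.copy (instr Var A) (can_type instr_codeK).
End InstrEq.

Inductive star (T : Type) (R : T -> T -> Prop) : T -> T -> Prop :=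
  | StarRefl x : star R x x
  | StarStep x y z : R x y -> star R y z -> star R x z.

Lemma star_trans T (R : T -> T -> Prop) x y z : star R x y -> star R y z -> star R x z.
Proof. by elim=> // {}x y' z' Hxy _ IH /IH; apply: StarStep. Qed.

Lemma star_one T (R : T -> T -> Prop) x y : R x y -> star R x y.
Proof. by move=> H; apply: StarStep H (StarRefl _ _). Qed.

(** * Nondeterministic programs and their automata *)

Section Programs.
Variables (Var A : finType).

(** Regular expressions over instructions, read as relations between valuations: [Alt] and [Star]
    guess, and a guess that makes a later test block is discarded. *)
Inductive prog :=
  | Atom of instr Var A
  | PSeq of prog & prog
  | Alt of prog & prog
  | Star of prog.

Definition valuation := Var -> nat.

Fixpoint run (w : seq A) K p : valuation -> valuation -> Prop :=
  match p with
  | Atom i => istep w K i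
  | PSeq a b => fun r r' => exists2 m, run w K a r m & run w K b m r'
  | Alt a b => fun r r' => run w K a r r' \/ run w K b r r'
  | Star a => star (run w K a)
  end.

(** A variant of Thompson's construction: each program gets an automaton with one entry [pin] and
    one exit [pout], and the automata of its parts are linked by [Nop]. *)
Fixpoint pstate p : finType :=
  match p with
  | Atom _ => bool
  | PSeq a b => (pstate a + pstate b)%type
  | Alt a b => (bool + (pstate a + pstate b))%type
  | Star a => option (pstate a)
  end.

Fixpoint pin p : pstate p :=
  match p with
  | Atom _ => false
  | PSeq a b => inl (pin a)
  | Alt a b => inl false
  | Star a => None
  end.

Fixpoint pout p : pstate p :=
  match p with
  | Atom _ => true
  | PSeq a b => inr (pout b)
  | Alt a b => inl true
  | Star a => None
  end.

Fixpoint pedge p : pstate p -> instr Var A -> pstate p -> bool :=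
  match p with
  | Atom i => fun s j s' => [&& ~~ s, s' & j == i]
  | PSeq a b => fun s j s' =>
      match s, s' with
      | inl x, inl x' => pedge x j x'
      | inr x, inr x' => pedge x j x'
      | inl x, inr x' => [&& j == Nop, x == pout a & x' == pin b]
      | inr _, inl _ => false
      end
  | Alt a b => fun s j s' =>
      match s, s' with
      | inl c, inr (inl x) => [&& j == Nop, ~~ c & x == pin a]
      | inl c, inr (inr x) => [&& j == Nop, ~~ c & x == pin b]
      | inr (inl x), inr (inl x') => pedge x j x'
      | inr (inr x), inr (inr x') => pedge x j x'
      | inr (inl x), inl c => [&& j == Nop, c & x == pout a]
      | inr (inr x), inl c => [&& j == Nop, c & x == pout b]
      | _, _ => false
      end
  | Star a => fun s j s' =>
      match s, s' with
      | None, Some x => (j == Nop) && (x == pin a)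
      | Some x, None => (j == Nop) && (x == pout a)
      | Some x, Some x' => pedge x j x'
      | None, None => false
      end
  end.

Variables (w : seq A) (K : nat).

Definition pstep p (c c' : pstate p * valuation) : Prop :=
  exists2 i, pedge c.1 i c'.1 & istep w K i c.2 c'.2.

Lemma star_embed p q (f : pstate p -> pstate q) :
  (forall x i x', pedge x i x' -> pedge (f x) i (f x')) ->
  forall c c', star (@pstep p) c c' -> star (@pstep q) (f c.1, c.2) (f c'.1, c'.2).
Proof.
move=> Hf c c'; elim=> [x|x y z [i He Hi] _ IH]; first exact: StarRefl.
by apply: StarStep IH; exists i => //; apply: Hf.
Qed.

Lemma star_nop p (x y : pstate p) r : pedge x Nop y -> star (@pstep p) (x, r) (y, r).
Proof. by move=> He; apply: star_one; exists Nop. Qed.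

Lemma run_star p r r' : run w K p r r' -> star (@pstep p) (pin p, r) (pout p, r').
Proof.
elim: p r r' => [i|a IHa b IHb|a IHa b IHb|a IHa] r r' /=.
- by move=> Hi; apply: star_one; exists i; rewrite //= eqxx.
- move=> [m /IHa Ha /IHb Hb].
  apply: star_trans (@star_embed a (PSeq a b) inl _ _ _ Ha) _ => //.
  apply: (@star_trans _ (@pstep (PSeq a b)) _ (inr (pin b), m)); last first.
    exact: (@star_embed b (PSeq a b) inr _ _ _ Hb).
  by apply: (@star_nop (PSeq a b)); rewrite /= !eqxx.
- case=> [/IHa Ha|/IHb Hb].
    apply: (@star_trans _ (@pstep (Alt a b)) _ (inr (inl (pin a)), r)).
      by apply: (@star_nop (Alt a b)); rewrite /= !eqxx.
    apply: star_trans (@star_embed a (Alt a b) (fun x => inr (inl x)) _ _ _ Ha) _ => //.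
    by apply: (@star_nop (Alt a b)); rewrite /= !eqxx.
  apply: (@star_trans _ (@pstep (Alt a b)) _ (inr (inr (pin b)), r)).
    by apply: (@star_nop (Alt a b)); rewrite /= !eqxx.
  apply: star_trans (@star_embed b (Alt a b) (fun x => inr (inr x)) _ _ _ Hb) _ => //.
  by apply: (@star_nop (Alt a b)); rewrite /= !eqxx.
- elim=> [{}r|{}r m {}r' /IHa Ha _ IH]; first exact: StarRefl.
  apply: star_trans IH; apply: (@star_trans _ (@pstep (Star a)) _ (Some (pin a), r)).
    by apply: (@star_nop (Star a)); rewrite /= !eqxx.
  apply: star_trans (@star_embed a (Star a) Some _ _ _ Ha) _ => //.
  by apply: (@star_nop (Star a)); rewrite /= !eqxx.
Qed.

(* The valuations with which the automaton of a program may be in a given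
   state, in terms of the initial valuation. *)
Fixpoint psem p : pstate p -> valuation -> valuation -> Prop :=
  match p with
  | Atom i => fun s r r' => if s then istep w K i r r' else r' = r
  | PSeq a b => fun s r r' =>
      match s with
      | inl x => psem x r r'
      | inr x => exists2 m, run w K a r m & psem x m r'
      end
  | Alt a b => fun s r r' =>
      match s with
      | inl c => if c then run w K a r r' \/ run w K b r r' else r' = r
      | inr (inl x) => psem x r r'
      | inr (inr x) => psem x r r'
      end
  | Star a => fun s r r' =>
      match s with
      | None => star (run w K a) r r'
      | Some x => exists2 m, star (run w K a) r m & psem x m r'
      end
  end.

Lemma psem_pin p r : psem (pin p) r r.
Proof. by elim: p r => //= [a _] r; apply: StarRefl. Qed.

Lemma psem_pout p r r' : psem (pout p) r r' -> run w K p r r'.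
Proof. by elim: p r r' => //= [a _ b IHb] r r' [m ? /IHb ?]; exists m. Qed.

Lemma psem_step p x i x' r r' r'' : pedge x i x' -> istep w K i r' r'' ->
  @psem p x r r' -> @psem p x' r r''.
Proof.
elim: p x i x' r r' r'' => [j|a IHa b IHb|a IHa b IHb|a IHa] x i x' r r' r'' /=.
- by case: x x' => [] [] //= /eqP-> Hi <-.
- case: x x' => x [] x' //.
  + exact: IHa.
  + by move=> /and3P[/eqP-> /eqP-> /eqP->] -> /psem_pout Ha; exists r' => //; apply: psem_pin.
  + by move=> He Hi [m Ha Hm]; exists m => //; apply: IHb He Hi Hm.
- case: x x' => [c|[x|x]] [c'|[x'|x']] //.
  + by move=> /and3P[/eqP-> /negPf-> /eqP->] /= -> ->; apply: psem_pin.
  + by move=> /and3P[/eqP-> /negPf-> /eqP->] /= -> ->; apply: psem_pin.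
  + by move=> /and3P[/eqP-> -> /eqP->] /= -> /psem_pout; left.
  + exact: IHa.
  + by move=> /and3P[/eqP-> -> /eqP->] /= -> /psem_pout; right.
  + exact: IHb.
- case: x x' => [x|] [x'|] //.
  + by move=> He Hi [m Ha Hm]; exists m => //; apply: IHa He Hi Hm.
  + move=> /andP[/eqP-> /eqP->] -> [m Ha /psem_pout Hm].
    exact: star_trans Ha (star_one Hm).
  + by move=> /andP[/eqP-> /eqP->] -> Ha; exists r' => //; apply: psem_pin.
Qed.

End Programs.

Lemma run_inP (Var A : finType) (p : prog Var A) d : 0 < d -> 0 < #|Var| ->
  inP (fun w => exists r, run w ((size w + 2) ^ d) p (fun=> 0) r).
Proof.
move=> d0 h0; have [M [q HM]] := nreach_inP (@pedge _ _ p) (pin p) (pout p) d0 h0.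
exists M, q => w; have [b [Hv Hb]] := HM w; exists b; split=> //.
rewrite Hb; set K := _ ^ d; split=> -[r Hr]; exists r.
- apply: psem_pout; move: (pout p) r Hr => s r Hr.
  elim: Hr => [|{}s {}r i s' r' _ IH He Hi]; first exact: psem_pin.
  exact: psem_step He Hi IH.
- have := run_star Hr; move E : (pin p, _) => c; move E' : (pout p, _) => c'.
  have Hc : nreach (@pedge _ _ p) (pin p) w K c.1 c.2 by rewrite -E; constructor.
  move=> H; have -> : pout p = c'.1 by rewrite -E'.
  have -> : r = c'.2 by rewrite -E'.
  elim: H Hc {E E'} => [//|x y z [i He Hi] _ IH Hx].
  by apply: IH; apply: NRS Hx He Hi.
Qed.

(** * Walks and short cycles *)

Lemma star_exit T (R : T -> T -> Prop) (P : pred T) x y :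
  star R x y -> P x -> ~~ P y -> exists a b, [/\ R a b, P a & ~~ P b].
Proof.
elim=> [a Pa /negP//|a b c Rab _ IH Pa nPc].
by case Pb: (P b); [apply: IH | exists a, b; rewrite Pb].
Qed.

Section Walks.
Variables (V : finType) (E : eqType) (src tgt : E -> V).
Implicit Types (L W Z : seq E) (u v r : V).

Fixpoint walk v L u :=
  if L is e :: L' then (src e == v) && walk (tgt e) L' u else v == u.

Lemma walk_cat v L1 m L2 u : walk v L1 m -> walk m L2 u -> walk v (L1 ++ L2) u.
Proof. by elim: L1 v => [|e L IH] v /= => [/eqP->//|/andP[-> /IH H] /H]. Qed.

Lemma walk_split v L1 L2 u : walk v (L1 ++ L2) u ->
  exists2 m, walk v L1 m & walk m L2 u.
Proof.
elim: L1 v => [|e L IH] v /=; first by exists v.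
by move=> /andP[-> /IH].
Qed.

Lemma walk_perm v L u : walk v L u -> perm_eq (u :: map src L) (v :: map tgt L).
Proof.
elim: L v => [|e L IH] v /=; first by move=> /eqP->.
move=> /andP[/eqP<- /IH H].
by rewrite -(perm_cat2l [:: src e]) /= in H; apply: perm_trans H; apply/permPl/(perm_catCA [:: u] [:: src e]).
Qed.

Lemma closed_walk_perm v L : walk v L v -> perm_eq (map src L) (map tgt L).
Proof. by move/walk_perm; rewrite perm_cons. Qed.

Lemma walk_insert r W r' v Z : walk r W r' -> v \in map src W -> walk v Z v ->
  exists2 W', walk r W' r' & perm_eq W' (W ++ Z).
Proof.
move=> Hw /mapP[e eW ->] Hz; case/splitPr: eW Hw => W1 W2 /walk_split[m H1 /=].
move=> /andP[/eqP Em H2]; exists (W1 ++ Z ++ e :: W2).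
  apply: walk_cat H1 _; rewrite -Em; apply: walk_cat Hz _.
  by rewrite /= eqxx.
by rewrite -catA perm_cat2l perm_catC.
Qed.

Lemma walk_rotate v Z u : walk v Z v -> u \in map src Z ->
  exists2 Z', walk u Z' u & perm_eq Z' Z.
Proof.
move=> Hz /mapP[e eZ ->]; case/splitPr: eZ Hz => Z1 Z2 /walk_split[m H1 /=].
move=> /andP[/eqP Em H2]; exists (e :: Z2 ++ Z1).
  by rewrite /= eqxx /=; apply: walk_cat H2 _; rewrite Em.
by rewrite -cat_cons perm_catC.
Qed.

Lemma walk_traject (nxt : V -> E) L v m :
  {in map src L, forall u, src (nxt u) = u /\ tgt (nxt u) \in map src L} ->
  v \in map src L ->
  walk v (map nxt (traject (tgt \o nxt) v m)) (iter m (tgt \o nxt) v) /\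
  map src (map nxt (traject (tgt \o nxt) v m)) = traject (tgt \o nxt) v m.
Proof.
move=> Hn; elim: m v => [|m IH] v vL //=; have [Es tL] := Hn _ vL.
have [Hw Em] := IH _ tL; split; last by rewrite Es Em.
by rewrite -[tgt (nxt (iter _ _ _))]/(iter m.+1 (tgt \o nxt) v) iterSr Es eqxx.
Qed.

(** Choosing for each source the first edge of [L] that leaves it defines a self-map of the set of
    sources, because balance makes every target a source. An orbit of this map is eventually
    periodic, and its period is a simple cycle. *)
Lemma balanced_cycle L : L != [::] -> perm_eq (map src L) (map tgt L) ->
  exists v Z, [/\ Z != [::], walk v Z v, uniq (map src Z) & {subset Z <= L}].
Proof.
case: L => // e0 L0 _; set L := e0 :: L0 => bal.
pose nxt v := nth e0 L (index v (map src L)).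
have nxtL v : v \in map src L -> nxt v \in L.
  by move=> vL; rewrite mem_nth // -(size_map src) index_mem.
have Hn : {in map src L, forall u, src (nxt u) = u /\ tgt (nxt u) \in map src L}.
  move=> u uL; split; last by rewrite (perm_mem bal) map_f // nxtL.
  by rewrite /nxt -(nth_map _ u) ?nth_index // -(size_map src) index_mem.
set f := tgt \o nxt; set x0 := src e0.
have x0L : x0 \in map src L by rewrite mem_head.
have iterL m : iter m f x0 \in map src L.
  by elim: m => //= m IH; have [] := Hn _ IH.
(* The orbit comes back to its [i]-th point [w], from which it is periodic with period [m]. *)
have /trajectP[i lt_i Ei] : looping f x0 (order f x0) by apply: looping_order.
set w := iter i f x0; pose m := order f x0 - i.
have Eo : order f x0 = i + m by rewrite subnKC // ltnW.
have Em : iter m f w = w by rewrite /w -iterD addnC -Eo Ei.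
have [Hw Hs] := walk_traject m Hn (iterL i).
exists w, (map nxt (traject f w m)); split.
- by rewrite -size_eq0 size_map size_traject subn_eq0 -ltnNge.
- by rewrite -{3}Em.
- rewrite Hs; have := orbit_uniq f x0; rewrite /orbit Eo trajectD cat_uniq.
  by case/and3P.
- move=> e /mapP[v /trajectP[j _ ->] ->]; apply: nxtL.
  by rewrite /w -iterD.
Qed.

Definition short_cycle Z := Z != [::] /\ exists2 v, walk v Z v & size Z <= #|V|.

Lemma cycle_decomposition L : perm_eq (map src L) (map tgt L) ->
  exists2 Zs, perm_eq L (flatten Zs) & forall Z, Z \in Zs -> short_cycle Z.
Proof.
have [k] := ubnP (size L); elim: k L => // k IH L; rewrite ltnS => le_k bal.
have [->|nz] := eqVneq L [::]; first by exists [::].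
have [v [Z [Z0 Hw uniqZ ZL]]] := balanced_cycle nz bal.
(* The sources on [Z] are distinct, so no edge is repeated and [Z] can be removed from the multiset
   [L], which leaves a balanced rest. *)
have [L1 L1L pL1] : exists2 s, subseq s L & perm_eq Z s.
  apply/count_subseqP => x; rewrite count_uniq_mem ?(map_uniq uniqZ) //.
  case xZ: (x \in Z) => //=; by rewrite -has_count has_pred1 ZL.
have [L2 pL2] := perm_to_subseq L1L.
have pL : perm_eq L (Z ++ L2) by apply: perm_trans pL2 _; rewrite perm_cat2r perm_sym.
have sz : size L = size Z + size L2 by rewrite (perm_size pL) size_cat.
have Z0s : 0 < size Z by rewrite lt0n size_eq0.
have bal2 : perm_eq (map src L2) (map tgt L2).
  have : perm_eq (map src (Z ++ L2)) (map tgt (Z ++ L2)).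
    by rewrite -(permPl (perm_map src pL)) -(permPr (perm_map tgt pL)).
  rewrite !map_cat => H; rewrite -(perm_cat2l (map src Z)).
  by apply: perm_trans H _; rewrite perm_cat2r perm_sym (closed_walk_perm Hw).
have [|Zs pZs HZs] := IH L2 _ bal2; first by lia.
exists (Z :: Zs); first by apply: perm_trans pL _; rewrite perm_cat2l.
move=> Z'; rewrite inE => /orP[/eqP->|/HZs//]; split=> //; exists v => //.
by rewrite -(size_map src) -(card_uniqP uniqZ) max_card.
Qed.

Definition edge_step L v u := exists2 e, e \in L & src e = v /\ tgt e = u.

Lemma rotate_all W Zs :
  (forall Z, Z \in Zs -> short_cycle Z /\ has (fun v => v \in map src W) (map src Z)) ->
  exists2 Zs', perm_eq (flatten Zs) (flatten Zs') &
    forall Z, Z \in Zs' -> size Z <= #|V| /\ exists2 v, v \in map src W & walk v Z v.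
Proof.
elim: Zs => [|Z Zs IH] H; first by exists [::].
have [|Zs' pZs HZs] := IH; first by move=> Z' Z'Zs; apply: H; rewrite inE Z'Zs orbT.
have [[_ [v Hw sZ]] /hasP[u uZ uW]] := H Z (mem_head _ _).
have [Z' Hw' pZ'] := walk_rotate Hw uZ.
exists (Z' :: Zs'); first by rewrite /= perm_cat // perm_sym.
move=> Z1; rewrite inE => /orP[/eqP->|/HZs//]; split; last by exists u.
by rewrite (perm_size pZ').
Qed.

(** While some cycle avoids [W], connectivity gives an edge from a vertex of [W] to a vertex
    outside. The cycle containing this edge is inserted into [W], which thereby gains a vertex. So
    at most [k] cycles are inserted, each of length at most [#|V|], before all remaining ones touch
    [W]. *)
Lemma merge_cycles L r W Zs k :
  (forall e, e \in L -> star (edge_step L) r (src e)) ->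
  perm_eq L (W ++ flatten Zs) -> W != [::] -> walk r W r ->
  (forall Z, Z \in Zs -> short_cycle Z) ->
  #|[pred v | v \notin map src W]| <= k ->
  exists W' Zs', [/\ perm_eq L (W' ++ flatten Zs'), W' != [::], walk r W' r,
    size W' <= size W + k * #|V| &
    forall Z, Z \in Zs' -> size Z <= #|V| /\ exists2 v, v \in map src W' & walk v Z v].
Proof.
move=> conn; elim: k W Zs => [|k IH] W Zs pL W0 Hw HZs le_k;
  have [/allP touched|] := boolP (all (fun Z => has (fun v => v \in map src W) (map src Z)) Zs).
- have [Zs' pZs HZs'] := rotate_all (fun Z ZZs => conj (HZs Z ZZs) (touched Z ZZs)).
  exists W, Zs'; split=> //; last by rewrite addn0.
  by apply: perm_trans pL _; rewrite perm_cat2l.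
- case/allPn => Z ZZs /hasPn un; have [Z0 _] := HZs _ ZZs.
  case: Z Z0 ZZs un => // e Z _ ZZs /(_ (src e)); rewrite mem_head => /(_ isT) sn.
  by move: le_k; rewrite leqn0 => /eqP/card0_eq/(_ (src e)); rewrite inE sn.
- have [Zs' pZs HZs'] := rotate_all (fun Z ZZs => conj (HZs Z ZZs) (touched Z ZZs)).
  exists W, Zs'; split=> //; last by rewrite leq_addr.
  by apply: perm_trans pL _; rewrite perm_cat2l.
- case/allPn => Z ZZs /hasPn un; have [Z0 _] := HZs _ ZZs.
  case: Z Z0 ZZs un => // e Z _ ZZs /(_ (src e)); rewrite mem_head => /(_ isT) sn.
  have eL : e \in L.
    rewrite (perm_mem pL) mem_cat; apply/orP; right; apply/flattenP.
    by exists (e :: Z); rewrite ?mem_head.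
  have rW : r \in map src W by case: (W) W0 Hw => //= e' W' _ /andP[/eqP-> _]; rewrite mem_head.
  have [a [b [[e' e'L [Ea Eb]] aW bW]]] := star_exit (P := fun v => v \in map src W) (conn e eL) rW sn.
  (* [W] is closed, so the targets of its edges are vertices of [W]; as [b] is none, [e'] lies on
     one of the cycles. *)
  have e'Zs : e' \in flatten Zs.
    move: e'L; rewrite (perm_mem pL) mem_cat => /orP[e'W|//].
    by rewrite -Eb (perm_mem (closed_walk_perm Hw)) map_f in bW.
  have /flattenP[Z' Z'Zs e'Z'] := e'Zs.
  have [_ [v Hv sZ']] := HZs _ Z'Zs.
  have aZ' : a \in map src Z' by rewrite -Ea map_f.
  have [Z2 Hw2 pZ2] := walk_rotate Hv aZ'.
  have [W' Hw' pW'] := walk_insert Hw aW Hw2.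
  case/splitPr: Z'Zs pL HZs => A B pL HZs.
  have [| | | |W2 [Zs2 [p2 n2 w2 s2 H2]]] := IH W' (A ++ B) _ _ Hw'.
  + apply/permP => x; move/permP/(_ x): pL; move/permP/(_ x): pW'; move/permP/(_ x): pZ2.
    by rewrite !flatten_cat /= !count_cat; clear; lia.
  + by rewrite -size_eq0 (perm_size pW') size_cat addn_eq0 size_eq0 (negPf W0).
  + by move=> Z3; rewrite mem_cat => Z3AB; apply: HZs; rewrite mem_cat inE orbCA Z3AB orbT.
  + rewrite -ltnS; apply: leq_trans le_k; apply: proper_card.
    have sub v' : v' \in map src W -> v' \in map src W'.
      by rewrite (perm_mem (perm_map src pW')) map_cat mem_cat => ->.
    apply/properP; split.
      by apply/subsetP => v'; rewrite !inE; apply: contra; apply: sub.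
    exists b; rewrite !inE // negbK (perm_mem (perm_map src pW')) map_cat mem_cat.
    by rewrite (perm_mem (closed_walk_perm Hw2)) (perm_mem (perm_map tgt pZ2)) -Eb map_f ?orbT.
  + exists W2, Zs2; split=> //; apply: leq_trans s2 _.
    by rewrite (perm_size pW') size_cat (perm_size pZ2); move: sZ'; clear; lia.
Qed.

Lemma walk_insert_all r W r' Zs : walk r W r' ->
  (forall Z, Z \in Zs -> exists2 v, v \in map src W & walk v Z v) ->
  exists2 W', walk r W' r' & perm_eq W' (W ++ flatten Zs).
Proof.
elim: Zs => [|Z Zs IH] Hw H; first by exists W; rewrite ?cats0.
have [|W' Hw' pW'] := IH Hw.
  by move=> Z' Z'Zs; apply: H; rewrite inE Z'Zs orbT.
have [v vW Hv] := H Z (mem_head _ _).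
have [|W2 Hw2 pW2] := walk_insert Hw' _ Hv.
  by rewrite (perm_mem (perm_map src pW')) map_cat mem_cat vW.
exists W2 => //; apply/permP => x; move/permP/(_ x): pW2; move/permP/(_ x): pW'.
by rewrite /= !count_cat; clear; lia.
Qed.

End Walks.

(** * Small integer relations *)

Section Relations.
Import GRing.Theory Num.Theory Order.TTheory.
Variables (T I : finType) (c : T -> I -> int) (b : nat).
Hypothesis c_le : forall t i, (`|c t i| <= b%:Z)%R.

(** The bound of Siegel's lemma. With [k = #|I|], there are [M.+1 ^ k.+1] combinations of [k.+1]
    vectors with coefficients in [0..M], and at most [(2 * k.+1 * M * b + 1) ^ k] values. The latter
    is at most [M.+1 ^ k * (2 * k.+1 * b + 1) ^ k], that is [M.+1 ^ k * M], so two combinations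
    collide. *)
Definition relation_bound := (2 * #|I|.+1 * b + 1) ^ #|I|.
Local Notation M := relation_bound.

Lemma relation_bound_gt0 : 0 < M. Proof. by rewrite expn_gt0 addn1. Qed.

Lemma subset_card (A : {set T}) k : k <= #|A| -> exists2 B : {set T}, B \subset A & #|B| = k.
Proof.
move=> le_k; exists [set x in take k (enum A)].
  by apply/subsetP => x; rewrite inE => /mem_take; rewrite mem_enum.
by rewrite cardsE (card_uniqP _) ?take_uniq ?enum_uniq // size_takel // -cardE.
Qed.

(* Pigeonhole on the combinations with coefficients at most [M] of [#|I|.+1] vectors. *)
Lemma bounded_relation (A : {set T}) : #|I| < #|A| ->
  exists a : T -> int, [/\ forall t, t \notin A -> a t = 0%R,
    forall t, (`|a t| <= M%:Z)%R, exists t, (a t < 0)%R &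
    forall i, (\sum_t a t * c t i = 0)%R].
Proof.
move=> /subset_card[B sBA cardB]; set k := #|I| in cardB *.
pose bound := k.+1 * M * b.
pose value (f : {ffun T -> 'I_M.+1}) i : int := (\sum_t (f t)%:Z * c t i)%R.
have value_le f i : f \in pffun_on (ord0 : 'I_M.+1) B predT -> (`|value f i| <= bound%:Z)%R.
  move=> /pffun_onP[fB _]; rewrite /value (bigID (mem B)) /= [X in (_ + X)%R]big1 ?addr0.
    apply: le_trans (ler_norm_sum _ _ _) _.
    apply: (@le_trans _ _ (\sum_(t in B) (M * b)%:Z)%R).
      apply: ler_sum => t _; rewrite normrM PoszM ler_pM //.
      by rewrite ger0_norm // lez_nat -ltnS ltn_ord.
    by rewrite sumr_const cardB -mulr_natl natz -PoszM mulnA.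
  move=> t tB; have /eqP-> : f t == ord0 by rewrite (supportP fB).
  by rewrite mul0r.
(* The shift by [bound] makes the values natural numbers, so that on the combinations considered
   [phi] loses no information. *)
pose phi f : {ffun I -> 'I_(2 * bound).+1} := [ffun i => inord `|(value f i + bound%:Z)%R|%N].
have : ~~ dinjectiveb phi (pffun_on (ord0 : 'I_M.+1) B predT).
  apply/negP => /dinjectiveP/leq_card_in.
  rewrite card_pffun_on cardB card_ffun !card_ord -/k.
  apply/negP; rewrite -ltnNge.
  apply: (@leq_ltn_trans ((M.+1 * (2 * k.+1 * b + 1)) ^ k)).
    case: (posnP k) => [k_0|k0]; first by rewrite k_0 !expn0 leqnn.
    by rewrite leq_exp2r // /bound; nia.
  by rewrite expnMn expnSr ltn_pmul2l ?expn_gt0.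
case/dinjectivePn => f fD [g]; rewrite inE /= => /andP[neq gD] E.
have Eval i : value f i = value g i.
  have := congr1 (fun p : {ffun I -> 'I_(2 * bound).+1} => nat_of_ord (p i)) E.
  rewrite !ffunE !inordK; have := value_le f i fD; have := value_le g i gD; lia.
have [t Ht] : exists t, f t != g t.
  apply/existsP; apply: contraR neq; rewrite negb_exists => /forallP H.
  by apply/eqP/ffunP => t; apply/eqP; have := H t; rewrite negbK eq_sym.
(* The sign makes the coefficient at [t] negative, so that adding multiples of the relation lowers
   some multiplicity. *)
pose s : int := (if (f t < g t)%N then 1 else -1)%R.
exists (fun t => s * ((f t)%:Z - (g t)%:Z))%R; split.
- move=> u uA; have uB : u \notin B by apply: contra uA => /(subsetP sBA).
  have /pffun_onP[fB _] := fD; have /pffun_onP[gB _] := gD.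
  by rewrite (supportP fB) // (supportP gB) // subrr mulr0.
- move=> u; have := ltn_ord (f u); have := ltn_ord (g u); rewrite /s; case: ifP => _; lia.
- exists t; rewrite /s; case: ltngtP Ht => [||/val_inj->]; rewrite ?eqxx //; lia.
- move=> i; have := Eval i; rewrite /value => Ei.
  under eq_bigr do rewrite -mulrA mulrBl.
  by rewrite -mulr_sumr sumrB Ei subrr mulr0.
Qed.

(* As long as too many coefficients are large, a multiple of a relation among them
   brings one of them below [M]. *)
Lemma relation_reduction (m : T -> nat) :
  exists m' : T -> nat, [/\ forall t, 0 < m' t -> 0 < m t,
    #|[set t | M <= m' t]| <= #|I| &
    forall i, (\sum_t (m' t)%:Z * c t i = \sum_t (m t)%:Z * c t i)%R].
Proof.
have [n] := ubnP #|[set t | M <= m t]|; elim: n m => // n IH m; rewrite ltnS => le_n.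
have M0 := relation_bound_gt0.
have [le_I|lt_I] := leqP #|[set t | M <= m t]| #|I|; first by exists m.
have [a [aA a_le [t0 at0] a_rel]] := bounded_relation lt_I.
pose val j t : int := ((m t)%:Z + j%:Z * a t)%R.
(* The entry at [t0] drops by at least 1 with each addition of the relation, hence is not positive
   after [m t0] of them. *)
have small_ex : exists j, [exists t, (M <= m t) && (val j t < M%:Z)%R].
  exists (m t0); apply/existsP; exists t0; apply/andP; split.
    by apply: contraLR at0 => H; rewrite aA ?inE.
  by rewrite /val; nia.
case: (ex_minnP small_ex) => j /existsP[t1 /andP[t1A t1_small]] j_min.
have j0 : 0 < j.
  by case: j t1_small {j_min} => //; rewrite /val mul0r addr0; move: t1A; lia.
(* By minimality of [j], all large entries were still at least [M] one addition earlier, and an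
   addition lowers an entry by at most [M]. This is why the threshold equals the bound on the
   coefficients. *)
have val_ge0 t : (0 <= val j t)%R.
  have [tA|] := boolP (M <= m t); last first.
    by move=> tA; rewrite /val aA ?inE // mulr0 addr0.
  have [//|neg] := lerP 0%R (val j t).
  have /j_min : [exists t, (M <= m t) && (val j.-1 t < M%:Z)%R].
    apply/existsP; exists t; rewrite tA /=; have := a_le t; move: neg.
    by rewrite /val -{1}(prednK j0) -addn1 PoszD mulrDl mul1r; lia.
  by rewrite -ltnS prednK // ltnn.
pose m1 t := `|val j t|%N.
have m1E t : Posz (m1 t) = val j t by rewrite /m1 gez0_abs.
have [|m' [H1 H2 H3]] := IH m1.
  apply: leq_trans le_n; apply: proper_card; apply/properP; split.
    apply/subsetP => t; rewrite !inE => le_t.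
    case: (leqP M (m t)) => // lt_t; have := m1E t.
    by rewrite /val aA ?inE -?ltnNge // mulr0 addr0 => -[E]; rewrite E leqNgt lt_t in le_t.
  by exists t1; rewrite !inE // -ltnNge; have := m1E t1; move: t1_small; lia.
exists m'; split=> //.
  move=> t /H1; have [tA|tA] := boolP (M <= m t).
    by move=> _; apply: leq_trans M0 tA.
  by have := m1E t; rewrite /val aA ?inE // mulr0 addr0 => -[->].
move=> i; rewrite H3; under eq_bigr do rewrite m1E /val mulrDl -mulrA.
by rewrite big_split /= -mulr_sumr a_rel mulr0 addr0.
Qed.

End Relations.

(** * Runs of regular grammars *)

Lemma connect_star (T : finType) (e : rel T) x y : reflect (star e x y) (connect e x y).
Proof.
apply: (iffP idP) => [/connectP[p]|]; last first.
  by elim=> [//|a b c /connect1 ab _]; apply: connect_trans.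
elim: p x => [|z p IH] x /=; first by move=> _ ->; apply: StarRefl.
by move=> /andP[xz /IH H] /H; apply: StarStep.
Qed.

Section Edges.
Import GRing.Theory Num.Theory Order.TTheory.
Variables (Sigma : finType) (n : nat).

(* A transition of a regular grammar: a source, at most one signed terminal
   ([true] is the negative sign) and at most one target. *)
Definition edge : finType := ('I_n * option (Sigma * bool) * option 'I_n)%type.
Implicit Types (e : edge) (L W Z es : seq edge).

Definition esrc e : 'I_n := e.1.1.
Definition elab e : option (Sigma * bool) := e.1.2.
Definition etgt e : option 'I_n := e.2.

Definition weight (a : option (Sigma * bool)) (x : Sigma) : int :=
  (if a is Some (y, b) then if x == y then if b then -1 else 1 else 0 else 0)%R.

Definition eff L x : int := (\sum_(e <- L) weight (elab e) x)%R.

Definition small_effect (a : option (Sigma * bool)) : {ffun Sigma -> int} :=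
  [ffun x => weight a x].
Definition small_target (t : option 'I_n) : {ffun 'I_n -> nat} :=
  [ffun q => nat_of_bool (Some q == t)].

Definition to_transition e : transition Sigma 'I_n :=
  (esrc e, small_effect (elab e), small_target (etgt e)).

Lemma small_effect_inj : injective small_effect.
Proof.
move=> [[x b]|] [[y c]|] // /ffunP E.
- have := E x; have := E y; rewrite !ffunE /= !eqxx.
  by case: eqP => [->|_]; case: b {E}; case: c.
- by have := E x; rewrite !ffunE /= eqxx; case: b {E}.
- by have := E y; rewrite !ffunE /= eqxx; case: c {E}.
Qed.

Lemma small_target_inj : injective small_target.
Proof.
move=> [x|] [y|] // /ffunP E.
- by have := E x; rewrite !ffunE eqxx; case: eqP.
- by have := E x; rewrite !ffunE eqxx.
- by have := E y; rewrite !ffunE eqxx.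
Qed.

Lemma to_transition_inj : injective to_transition.
Proof.
move=> [[q a] t] [[q' a'] t'] [].
by rewrite /esrc /elab /etgt /= => -> /small_effect_inj -> /small_target_inj ->.
Qed.

Lemma sum_le1 (X : finType) (f : X -> nat) : \sum_x f x <= 1 ->
  (forall x, f x = 0) \/ exists2 x, f x = 1 & forall y, y != x -> f y = 0.
Proof.
move=> le1; have [/existsP[x x0]|] := boolP [exists x, f x != 0]; last first.
  by rewrite negb_exists => /forallP H; left=> x; apply/eqP; have := H x; rewrite negbK.
right; exists x; move: le1; rewrite (bigD1 x) //=; first by lia.
move=> le1 y yx; move: le1; rewrite (bigD1 y) //=; lia.
Qed.

Lemma regular_transition (d : transition Sigma 'I_n) :
  \sum_q target d q <= 1 -> \sum_x `|effect d x| <= 1 -> exists e, d = to_transition e.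
Proof.
case: d => [[q a] t]; rewrite /target /effect /= => Ht Ha.
have [a' Ea] : exists a', a = small_effect a'.
  case: (sum_le1 Ha) => [H|[x Hx H]].
    by exists None; apply/ffunP => x; rewrite ffunE /=; have := H x; lia.
  exists (Some (x, (a x < 0)%R)); apply/ffunP => y; rewrite ffunE /=.
  case: eqP => [->|/eqP yx]; last by have := H y yx; lia.
  by case: ltP; lia.
have [t' Et] : exists t', t = small_target t'.
  case: (sum_le1 Ht) => [H|[x Hx H]].
    by exists None; apply/ffunP => x; rewrite ffunE H.
  exists (Some x); apply/ffunP => y; rewrite ffunE.
  have [->|yx] := eqVneq y x; first by rewrite eqxx.
  by rewrite H //; case: eqP => // -[E]; rewrite E eqxx in yx.
by exists (q, a', t'); rewrite /to_transition Ea Et.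
Qed.

Lemma to_transition_regular e :
  \sum_q target (to_transition e) q <= 1 /\ \sum_x `|effect (to_transition e) x| <= 1.
Proof.
case: e => [[q a] t]; rewrite /target /effect /=; split.
  case: t => [p|]; last by rewrite big1 // => x _; rewrite ffunE.
  rewrite (bigD1 p) //= ffunE eqxx big1 // => x xp; rewrite ffunE.
  by case: eqP => // -[E]; rewrite E eqxx in xp.
case: a => [[x b]|]; last by rewrite big1 // => x _; rewrite ffunE.
rewrite (bigD1 x) //= ffunE /= eqxx big1; first by case: b.
by move=> y /negPf yx; rewrite ffunE /= yx.
Qed.

Definition estep L p q := exists2 e, e \in L & esrc e = p /\ etgt e = Some q.

(** A run as a list of edges with repetitions: the multiplicity of a transition is its number of
    occurrences, and sums over runs become sums over lists. *)
Record run_list q0 L : Prop := RunList {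
  run_balance : forall q,
    count_mem q (map esrc L) = (q == q0) + count_mem (Some q) (map etgt L);
  run_connected : forall e, e \in L -> star (estep L) q0 (esrc e)
}.

Definition grammar q0 es := CGrammar q0 [fset d in map to_transition es]%fset.

Section Represent.
Variables (q0 : 'I_n) (es : seq edge).
Local Notation G := (grammar q0 es).
Variables (R : {ffun delta G -> nat}) (L : seq edge).
Hypothesis L_es : {subset L <= es}.
Hypothesis RL : forall d : delta G, R d = count (fun e => to_transition e == val d) L.

Lemma to_transition_delta e : e \in es -> to_transition e \in delta G.
Proof. by move=> ees; rewrite in_fset map_f. Qed.

Lemma sum_represent (Z : nmodType) (F : transition Sigma 'I_n -> Z) :
  (\sum_(d : delta G) F (val d) *+ R d = \sum_(e <- L) F (to_transition e))%R.
Proof.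
transitivity (\sum_(d : delta G) \sum_(e <- L) F (val d) *+ (to_transition e == val d))%R.
  apply: eq_bigr => d _; rewrite RL -sum1_count -sumrMnr big_mkcond.
  by apply: eq_bigr => e _; case: eqP.
rewrite exchange_big /= big_seq [RHS]big_seq; apply: eq_bigr => e eL.
rewrite (bigD1 [` to_transition_delta (L_es eL)]%fset) //= eqxx mulr1n big1 ?addr0 // => d.
by rewrite -val_eqE /= eq_sym => /negPf->.
Qed.

Lemma sourceR_represent q : sourceR R q = count_mem q (map esrc L).
Proof.
rewrite /sourceR (sum_represent (fun d => msingle (source d))) sum_ffunE.
rewrite -sum1_count big_map [RHS]big_mkcond /=.
by apply: eq_bigr => e _; rewrite ffunE /= eq_sym; case: eqP.
Qed.

Lemma targetR_represent q : targetR R q = count_mem (Some q) (map etgt L).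
Proof.
rewrite /targetR (sum_represent (fun d => target d)) sum_ffunE.
rewrite -sum1_count big_map [RHS]big_mkcond /=.
by apply: eq_bigr => e _; rewrite ffunE /= eq_sym; case: eqP.
Qed.

Lemma effectR_represent x : effectR R x = eff L x.
Proof.
rewrite /effectR (sum_represent (fun d => effect d)) sum_ffunE.
by apply: eq_bigr => e _; rewrite ffunE.
Qed.

Lemma reach1_represent p q : reach1 R p q <-> estep L p q.
Proof.
split=> [/existsP[d /and3P[]]|[e eL [Es Et]]].
  rewrite RL -has_count => /hasP[e eL /eqP <-] /eqP Es.
  by rewrite ffunE => Et; exists e => //; split=> //; move: Et; case: eqP.
apply/existsP; exists [` to_transition_delta (L_es eL)]%fset; apply/and3P; split.
- by rewrite RL -has_count; apply/hasP; exists e => //=.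
- by rewrite /= -Es.
- by rewrite /= ffunE Et eqxx.
Qed.

Lemma is_run_represent : is_run (q0 : nonterm G) R <-> run_list q0 L.
Proof.
have star_iff p q : star (reach1 R) p q <-> star (estep L) p q.
  split; elim=> [a|a b c /reach1_represent H _]; try exact: StarRefl; exact: StarStep.
have subE (a b c : nat) : (a%:Z - c%:Z = b%:Z)%R <-> a = c + b by split; lia.
split=> [[Hb Hc]|[Hb Hc]]; split.
- move=> q; have := Hb q; rewrite sourceR_represent targetR_represent ffunE.
  by move=> E; apply/subE.
- move=> e eL; apply/star_iff/connect_star/Hc.
  by rewrite sourceR_represent -has_count has_pred1 map_f.
- by move=> q; rewrite sourceR_represent targetR_represent ffunE; apply/subE/Hb.
- move=> q; rewrite sourceR_represent -has_count has_pred1 => /mapP[e eL ->].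
  exact/connect_star/star_iff/Hc.
Qed.

End Represent.

Lemma count_flatten_nseq (T : eqType) (f : T -> nat) (s : seq T) (P : pred T) :
  count P (flatten [seq nseq (f x) x | x <- s]) = \sum_(x <- s | P x) f x.
Proof.
elim: s => [|x s IH]; first by rewrite big_nil.
rewrite /= count_cat IH count_nseq big_cons; case: (P x) => //=.
by rewrite mul1n.
Qed.

Lemma languageP q0 es v : language (grammar q0 es) v <->
  exists L, [/\ {subset L <= es}, run_list q0 L & forall x, eff L x = v x].
Proof.
split=> [[R [HR Hv]]|[L [Les HL Hv]]]; last first.
  pose R : {ffun delta (grammar q0 es) -> nat} :=
    [ffun d => count (fun e => to_transition e == val d) L].
  have RL d : R d = count (fun e => to_transition e == val d) L by rewrite ffunE.
  exists R; split; first exact/(is_run_represent Les RL).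
  by apply/ffunP => x; rewrite (effectR_represent Les RL).
pose f e := if insub (to_transition e) is Some d then R d else 0.
(* Repetitions in [es] are dropped, as each transition must occur exactly [R d] times. *)
pose L := flatten [seq nseq (f e) e | e <- undup es].
have Les : {subset L <= es}.
  by move=> e /flattenP[s /mapP[e' e'es ->]] /nseqP[-> _]; rewrite -mem_undup.
have RL d : R d = count (fun e => to_transition e == val d) L.
  rewrite count_flatten_nseq; have := valP d; rewrite in_fset => /mapP[e ees Ed].
  rewrite big_mkcond (bigD1_seq e) ?undup_uniq ?mem_undup //= Ed eqxx big1 => [|e']; last first.
    by rewrite (inj_eq to_transition_inj) => /negPf->.
  rewrite addn0 /f; case: insubP => [d' _ Ed'|]; last by rewrite to_transition_delta.
  by congr (R _); apply: val_inj; rewrite Ed'.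
exists L; split=> //; first exact/(is_run_represent Les RL).
by move=> x; rewrite -(effectR_represent Les RL) Hv.
Qed.

End Edges.

Arguments esrc {Sigma n}.
Arguments elab {Sigma n}.
Arguments etgt {Sigma n}.
Arguments eff {Sigma n}.
Arguments to_transition {Sigma n}.

Section GrammarWalks.
Import GRing.Theory Num.Theory Order.TTheory.
Variables (Sigma : finType) (n : nat).
Local Notation edge := (edge Sigma n).
Implicit Types (e : edge) (L W Z es : seq edge) (q s : 'I_n).

(** Transitions without target lead to the vertex [None], which no transition leaves; a walk to
    [None] from a state therefore ends with its only such transition. *)
Definition gwalk : option 'I_n -> seq edge -> option 'I_n -> bool :=
  walk (fun e : edge => Some (esrc e)) etgt.

Lemma eff_cat L1 L2 x : eff (L1 ++ L2) x = (eff L1 x + eff L2 x)%R.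
Proof. by rewrite /eff big_cat. Qed.

Lemma eff_flatten (Ls : seq (seq edge)) x : eff (flatten Ls) x = (\sum_(L <- Ls) eff L x)%R.
Proof. by elim: Ls => [|L Ls IH]; rewrite ?big_cons /= ?eff_cat ?IH // /eff !big_nil. Qed.

Lemma eff_perm L1 L2 x : perm_eq L1 L2 -> eff L1 x = eff L2 x.
Proof. exact: perm_big. Qed.

Lemma weight_le1 a (x : Sigma) : (`|weight a x| <= 1)%R.
Proof. by case: a => [[y []]|] //=; case: eqP. Qed.

Lemma eff_le L x : (`|eff L x| <= (size L)%:Z)%R.
Proof.
rewrite /eff; elim: L => [|e L IH]; first by rewrite big_nil.
rewrite big_cons /= -addn1 PoszD addrC; apply: le_trans (ler_normD _ _) _.
by rewrite lerD // weight_le1.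
Qed.

Lemma gwalk_connected L q W u : {subset W <= L} -> gwalk (Some q) W u ->
  forall e, e \in W -> star (estep L) q (esrc e).
Proof.
elim: W q => [//|e W IH] q WL /= /andP[/eqP[Eq] Hw] e'.
rewrite inE -Eq => /orP[/eqP->|e'W]; first exact: StarRefl.
have eL : e \in L by apply: WL; rewrite mem_head.
have {}WL : {subset W <= L} by move=> x xW; apply: WL; rewrite inE xW orbT.
case E: (etgt e) Hw => [p|] Hw.
  by apply: StarStep (IH p WL Hw e' e'W); exists e.
by case: W Hw e'W {IH WL}.
Qed.

(** Inserting the closed walks at states of [W] gives a single walk, which is balanced by
    telescoping and connected by following it. *)
Lemma walk_language q0 es W Zs (v : {ffun Sigma -> int}) : {subset W ++ flatten Zs <= es} ->
  gwalk (Some q0) W None ->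
  (forall Z, Z \in Zs -> exists2 s, s \in map esrc W & gwalk (Some s) Z (Some s)) ->
  (forall x, eff (W ++ flatten Zs) x = v x) -> language (grammar q0 es) v.
Proof.
move=> sub Hw HZs Hv; have [|W' Hw' pW'] := walk_insert_all (Zs := Zs) Hw.
  move=> Z /HZs[s /mapP[e eW ->] ?]; exists (Some (esrc e)) => //.
  exact: (map_f (fun e => Some (esrc e))).
apply/languageP; exists W'; split.
- by move=> e; rewrite (perm_mem pW'); apply: sub.
- split; last exact: (@gwalk_connected W' q0 W' None).
  move=> q; have /permP/(_ (pred1 (Some q))) := walk_perm Hw'.
  rewrite /= add0n [Some q0 == _]eq_sym (inj_eq Some_inj) => <-.
  by rewrite !count_map; apply: eq_count => e /=; rewrite (inj_eq Some_inj).
- by move=> x; rewrite (eff_perm x pW').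
Qed.

(** * Decomposition of a run *)

Section Decomposition.
Variables (q0 : 'I_n) (L : seq edge).
Hypothesis HL : run_list q0 L.

(* A run is turned into a circulation by an additional edge [None], which leads
   from the additional vertex [None] to [q0]; final transitions lead to the
   vertex [None]. *)
Definition osrc (o : option edge) : option 'I_n := omap esrc o.
Definition otgt (o : option edge) : option 'I_n := if o is Some e then etgt e else Some q0.
Definition circulation : seq (option edge) := None :: map Some L.

Lemma sum_count_mem (s : seq 'I_n) : \sum_q count_mem q s = size s.
Proof.
elim: s => [|p s IH] /=; first by rewrite big1.
by rewrite big_split /= IH (bigD1 p) //= eqxx big1 // => q /negPf; rewrite eq_sym => ->.
Qed.

Lemma sum_count_option (s : seq (option 'I_n)) :
  count_mem None s + \sum_q count_mem (Some q) s = size s.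
Proof.
elim: s => [|[p|] s IH] /=; first by rewrite big1.
- rewrite big_split /= addnCA IH (bigD1 p) //= eqxx big1 // => q /negPf.
  by rewrite (inj_eq Some_inj) eq_sym => ->.
- by rewrite big_split /= big1 // add0n -addnA IH.
Qed.

Lemma circulation_balanced : perm_eq (map osrc circulation) (map otgt circulation).
Proof.
have srcE q : count_mem (Some q) (map osrc (map Some L)) = count_mem q (map esrc L).
  by rewrite -map_comp !count_map; apply: eq_count => e /=; rewrite (inj_eq Some_inj).
have tgtE v : count_mem v (map otgt (map Some L)) = count_mem v (map etgt L).
  by rewrite -map_comp !count_map; apply: eq_count.
have src0 : count_mem None (map osrc (map Some L)) = 0.
  by rewrite -map_comp count_map; apply/eqP; rewrite -leqn0 -(count_pred0 L); apply: sub_count.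
apply/allP => -[q|] _ /=.
  by rewrite srcE tgtE (run_balance HL) (inj_eq Some_inj) add0n [q == q0]eq_sym.
rewrite src0 tgtE; apply/eqP.
(* Balance at [None]: comparing the total numbers of sources and targets shows that exactly one
   transition of [L] has no target. *)
have := sum_count_option (map etgt L); have := sum_count_mem (map esrc L).
rewrite (eq_bigr _ (fun q _ => run_balance HL q)) big_split /= (bigD1 q0) //= eqxx big1.
  by rewrite !size_map addn0 add0n => <- /eqP; rewrite eqn_add2r => /eqP->.
by move=> q /negPf->.
Qed.

Lemma circulation_connected o : o \in circulation ->
  star (edge_step osrc otgt circulation) None (osrc o).
Proof.
rewrite inE => /orP[/eqP->|/mapP[e eL ->]]; first exact: StarRefl.
apply: (@StarStep _ _ _ (Some q0)); first by exists None; rewrite ?mem_head.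
have := run_connected HL eL; rewrite /osrc /=; elim=> [q|p q r [e' e'L [<- Et]] _ IH].
  exact: StarRefl.
by apply: StarStep IH; exists (Some e'); rewrite // inE map_f ?orbT.
Qed.

Lemma walk_map_some v Z u : walk osrc otgt v (map Some Z) u = gwalk v Z u.
Proof. by rewrite /gwalk; elim: Z v => //= e Z IH v; rewrite IH. Qed.

Lemma map_some_pmap (T : eqType) (Z : seq (option T)) : None \notin Z -> Z = map Some (pmap id Z).
Proof. by elim: Z => [|[x|] Z IH] //=; rewrite inE /= => /IH <-. Qed.

(** The additional edge occurs once in the circulation, hence on just one cycle. Rotated so as to
    start at [None], that cycle is the closed walk into which others are merged, and removing the
    edge afterwards leaves a walk from [q0] to [None]. The bound counts the first cycle and at most
    [n.+1] merged ones, each of length at most [n.+1], the number of vertices. *)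
Lemma circulation_split : exists W Zs,
  [/\ perm_eq L (W ++ flatten Zs), gwalk (Some q0) W None, size W <= n.+1 + n.+1 * n.+1 &
   forall Z, Z \in Zs -> size Z <= n.+1 /\
     exists2 s, s \in map esrc W & gwalk (Some s) Z (Some s)].
Proof.
have cardV : #|{: option 'I_n}| = n.+1 by rewrite card_option card_ord.
have [Zs0 pZs0 HZs0] := cycle_decomposition circulation_balanced.
have : None \in flatten Zs0 by rewrite -(perm_mem pZs0) mem_head.
case/flattenP => Z0 Z0Zs NZ0; have [_ [v Hv sZ0]] := HZs0 _ Z0Zs.
have [W0 HW0 pW0] := walk_rotate Hv (map_f osrc NZ0).
case/splitPr: Z0Zs pZs0 HZs0 => A B pZs0 HZs0.
have [| | | |W1 [Zs1 [p1 n1 w1 s1 H1]]] := @merge_cycles _ _ osrc otgt circulation None W0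
    (A ++ B) n.+1 circulation_connected _ _ HW0.
- apply/permP => x; move/permP/(_ x): pZs0; move/permP/(_ x): pW0.
  by rewrite !flatten_cat /= !count_cat; clear; lia.
- by apply/negP => /eqP E; have := perm_mem pW0 None; rewrite E NZ0.
- by move=> Z ZAB; apply: HZs0; move: ZAB; rewrite !mem_cat inE orbCA => ->; rewrite orbT.
- by rewrite -cardV max_card.
have N1 : count_mem None (W1 ++ flatten Zs1) = 1.
  rewrite -(permP p1) /= count_map.
  by rewrite (@eq_count _ _ pred0) ?count_pred0.
case: W1 p1 n1 w1 s1 H1 N1 => // o W2 p1 _ /= /andP[/eqP Eo w1] s1 H1.
have {}Eo : o = None by case: o Eo {p1 H1 w1}.
subst o; rewrite /= count_cat => N1.
have /andP[NW2 NZs1] : (None \notin W2) && (None \notin flatten Zs1).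
  rewrite -!has_pred1 !has_count -!leqNgt !leqn0 -addn_eq0.
  by apply/eqP/succn_inj; rewrite -[RHS]N1.
have EW := map_some_pmap NW2; set W := pmap id W2 in EW.
have Hw : gwalk (Some q0) W None by rewrite -walk_map_some -EW.
have q0W : q0 \in map esrc W.
  by case: (W) Hw => //= e W' /andP[/eqP[<-] _]; rewrite mem_head.
have EZ (Z : seq (option edge)) : Z \in Zs1 -> Z = map Some (pmap id Z).
  by move=> ZZs; apply: map_some_pmap; apply: contra NZs1 => NZ; apply/flattenP; exists Z.
exists W, (map (pmap id) Zs1); split=> //.
- have := perm_pmap id p1; rewrite /circulation /= pmap_cat.
  rewrite (_ : pmap id (map Some L) = L); last by elim: (L) => //= e L' ->.
  rewrite (_ : pmap id (flatten Zs1) = flatten (map (pmap id) Zs1)) //.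
  by elim: (Zs1) => //= Z Zs' IH; rewrite pmap_cat IH.
- rewrite -(size_map Some) -EW; move: s1; rewrite (perm_size pW0) cardV.
  by move: sZ0; rewrite cardV; clear; lia.
move=> _ /mapP[Z ZZs ->]; have [sZ [u uW Hu]] := H1 _ ZZs; split.
  by rewrite -(size_map Some) -EZ // -cardV.
move: Hu; rewrite [in walk _ _ _ _ _](EZ _ ZZs) walk_map_some => Hu.
case: u uW Hu => [s sW Hu|_ Hu].
  exists s => //; move: sW; rewrite inE /= EW -map_comp => /mapP[e eW [->]].
  exact: map_f.
(* No transition leaves [None], so a closed walk based there is empty and may be based at [q0]
   instead. *)
by exists q0 => //; case: (pmap id Z) Hu => // _; apply: eqxx.
Qed.

Local Notation b := n.+1.
(** The effects of walks of length at most [b], shifted by [b] into a finite type, whose cardinality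
    is polynomial in [n] for fixed [Sigma]. *)
Definition effect_type := {ffun Sigma -> 'I_(2 * b).+1}.
Definition type_of Z : effect_type := [ffun x => inord `|(eff Z x + b%:Z)%R|%N].
Definition type_effect (t : effect_type) (x : Sigma) : int := ((t x)%:Z - b%:Z)%R.

Lemma type_effect_le t x : (`|type_effect t x| <= b%:Z)%R.
Proof. by rewrite /type_effect; have := ltn_ord (t x); lia. Qed.

Lemma type_ofK Z x : size Z <= b -> type_effect (type_of Z) x = eff Z x.
Proof.
move=> sZ; have := eff_le Z x; rewrite /type_effect ffunE inordK; first by lia.
by have := eff_le Z x; lia.
Qed.

(** The first summand is the bound of [circulation_split]; the second allows, for each effect, up to
    [relation_bound Sigma b] inserted closed walks of length at most [b]. *)
Definition walk_bound :=
  (b + b * b) + #|{: effect_type}| * relation_bound Sigma b * b.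

Lemma sum_ranked (T : finType) (t0 : T) (A : {set T}) (F : T -> int) : #|A| <= #|Sigma| ->
  (\sum_(x : Sigma) (if (enum_rank x < #|A|)%N then F (nth t0 (enum A) (enum_rank x)) else 0)
   = \sum_(t in A) F t)%R.
Proof.
move=> le_A; rewrite -[RHS]big_enum [RHS](big_nth t0) [RHS]big_mkord -cardE.
rewrite (big_ord_widen _ (fun i => F (nth t0 (enum A) i)) le_A) [RHS]big_mkcond /=.
rewrite (reindex (@enum_val Sigma predT)) /=.
  by apply: eq_bigr => i _; rewrite enum_valK.
by exists enum_rank => i _; [apply: enum_valK | apply: enum_rankK].
Qed.

Theorem run_decomposition : exists W (r : Sigma -> 'I_n) C lam,
  [/\ {subset W <= L}, gwalk (Some q0) W None, size W <= walk_bound,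
   forall x : Sigma, [/\ r x \in map esrc W, gwalk (Some (r x)) (C x) (Some (r x)),
      {subset C x <= L} & size (C x) <= n.+1] &
   forall y, (eff L y = eff W y + \sum_x (lam x)%:Z * eff (C x) y)%R].
Proof.
have [W [Zs [pL Hw sW HZs]]] := circulation_split.
pose m (t : effect_type) := count (fun Z => type_of Z == t) Zs.
have [m' [m'_pos m'_large m'_sum]] := relation_reduction type_effect_le m.
set M := relation_bound Sigma b in m'_large.
pose rep t := nth [::] Zs (find (fun Z => type_of Z == t) Zs).
(* The reduction creates no new support, so an effect that is still used occurs among the given
   closed walks. *)
have repP t : 0 < m' t -> rep t \in Zs /\ type_of (rep t) = t.
  move=> /m'_pos; rewrite -has_count => Ht; split; first by rewrite mem_nth -?has_find.
  by apply/eqP; have := nth_find [::] Ht.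
have sumZs y : (eff (flatten Zs) y = \sum_t (m t)%:Z * type_effect t y)%R.
  rewrite eff_flatten /m; elim: (Zs) HZs => [|Z Zs' IH] HZs'.
    by rewrite big_nil big1 // => t _; rewrite mul0r.
  have [sZ _] := HZs' Z (mem_head _ _).
  rewrite big_cons IH; last by move=> Z' Z'Zs; apply: HZs'; rewrite inE Z'Zs orbT.
  under [RHS]eq_bigr do rewrite /= PoszD mulrDl.
  rewrite big_split /=; congr (_ + _)%R; rewrite (bigD1 (type_of Z)) //= eqxx mul1r type_ofK // big1 ?addr0 //.
  by move=> t /negPf; rewrite eq_sym => ->; rewrite mul0r.
have effE t y : ((m' t)%:Z * type_effect t y = (m' t)%:Z * eff (rep t) y)%R.
  case: (posnP (m' t)) => [->|/repP[rZs Et]]; first by rewrite !mul0r.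
  by rewrite -{2}Et type_ofK //; have [] := HZs _ rZs.
(* The closed walks of small multiplicity, all of which go into the walk. *)
pose S := flatten [seq nseq (m' t) (rep t) | t <- enum {: effect_type} & m' t < M].
have SP Z : Z \in S -> Z \in Zs.
  case/flattenP => s /mapP[t _ ->] /nseqP[-> m't_pos].
  by have [] := repP t m't_pos.
have [|W' Hw' pW'] := walk_insert_all (Zs := S) Hw.
  move=> Z /SP/HZs[_ [s /mapP[e eW ->] ?]]; exists (Some (esrc e)) => //.
  exact: (map_f (fun e => Some (esrc e))).
have subW s : s \in map esrc W -> s \in map esrc W'.
  by rewrite (perm_mem (perm_map _ pW')) map_cat mem_cat => ->.
have ZsL Z : Z \in Zs -> {subset Z <= L}.
  move=> ZZs e eZ; rewrite (perm_mem pL) mem_cat; apply/orP; right.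
  by apply/flattenP; exists Z.
have q0W : q0 \in map esrc W.
  by case: (W) Hw => //= e W2 /andP[/eqP[<-] _]; rewrite mem_head.
pose A := [set t | M <= m' t].
pose start Z := odflt q0 [pick s | (s \in map esrc W) && gwalk (Some s) Z (Some s)].
have startP Z : Z \in Zs -> start Z \in map esrc W /\ gwalk (Some (start Z)) Z (Some (start Z)).
  move=> /HZs[_ [s sW' Hs]]; rewrite /start; case: pickP => [s' /andP[]//|/(_ s)].
  by rewrite sW' Hs.
pose tx (x : Sigma) := nth [ffun=> ord0] (enum A) (enum_rank x).
have txP x : enum_rank x < #|A| -> rep (tx x) \in Zs /\ type_of (rep (tx x)) = tx x.
  move=> lt_x; apply: repP; have : tx x \in A.
    by rewrite -mem_enum mem_nth // -cardE.
  by rewrite inE; apply: leq_trans; apply: relation_bound_gt0.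
(* Terminals without a large effect get the empty closed walk at the visited state [q0], with
   multiplicity 0. *)
exists W', (fun x => if enum_rank x < #|A| then start (rep (tx x)) else q0),
  (fun x => if enum_rank x < #|A| then rep (tx x) else [::]),
  (fun x => if enum_rank x < #|A| then m' (tx x) else 0); split=> //.
- move=> e; rewrite (perm_mem pW') mem_cat => /orP[eW|/flattenP[Z /SP ZZs]].
    by rewrite (perm_mem pL) mem_cat eW.
  exact: ZsL.
- rewrite (perm_size pW') size_cat leq_add // size_flatten /shape.
  have sizeS : size S <= #|{: effect_type}| * M.
    rewrite size_flatten /shape -map_comp sumnE big_map big_filter.
    rewrite cardE -[X in _ <= X * _]count_predT -sum1_count big_distrl /= big_mkcond.
    by apply: leq_sum => t _; rewrite mul1n; case: ifP => // /ltnW; rewrite size_nseq.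
  apply: (@leq_trans (size S * b)); last by rewrite leq_mul2r sizeS orbT.
  rewrite sumnE big_map; elim: (S) SP => [|Z S' IH] SP'; first by rewrite big_nil.
  rewrite big_cons mulSn leq_add //; first by have [] := HZs Z (SP' Z (mem_head _ _)).
  by apply: IH => Z' Z'S; apply: SP'; rewrite inE Z'S orbT.
- move=> x; case: ifP => [/txP[rZs _]|_]; last by split; rewrite ?subW //= eqxx.
  have [s1 s2] := startP _ rZs; split=> //; first exact: subW.
    exact: ZsL.
  by have [] := HZs _ rZs.
- move=> y; rewrite (eff_perm y pL) (eff_perm y pW') !eff_cat sumZs -m'_sum -addrA.
  congr (_ + _)%R; rewrite (bigID (mem A)) /= addrC; congr (_ + _)%R.
    rewrite eff_flatten /S big_flatten /= big_map big_filter big_enum_cond /=.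
    apply: eq_big => [t|t _]; first by rewrite inE -ltnNge.
    by rewrite big_nseq iter_addr_0 -mulr_natl natz effE.
  transitivity (\sum_(x : Sigma) (if (enum_rank x < #|A|)%N then
      (m' (tx x))%:Z * type_effect (tx x) y else 0))%R.
    rewrite (sum_ranked [ffun=> ord0] (fun t => (m' t)%:Z * type_effect t y)%R) //.
  by apply: eq_bigr => x _; case: ifP; rewrite ?effE // mul0r.
Qed.

End Decomposition.
End GrammarWalks.

(** * Arithmetic on counters *)

Section CounterPrograms.
Variables (Var A : finType).
Local Notation prog := (prog Var A).
Implicit Types (r : Var -> nat) (v a b t : Var) (ds js : seq Var).

Definition seqs (ps : seq prog) : prog := foldr (@PSeq _ _) (Atom Nop) ps.
(** Blocks on every valuation, and so is neutral for [Alt]. *)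
Definition fail v : prog := PSeq (Atom (Zero v)) (Atom (Dec v)).
Definition alts v (ps : seq prog) : prog := foldr (@Alt _ _) (fail v) ps.

Definition linear ds js : prog :=
  PSeq (seqs [seq Atom (Dec v) | v <- ds]) (seqs [seq Atom (Inc v) | v <- js]).

(** The number of iterations is guessed, and the test for zero keeps only the right guess. The
    programs below rely on the same pattern. *)
Definition clear v : prog := PSeq (Star (linear [:: v] [::])) (Atom (Zero v)).

(* [t] is a scratch counter, left at 0. *)
Definition restore t js : prog := PSeq (Star (linear [:: t] js)) (Atom (Zero t)).
Definition copy t a b : prog :=
  seqs [:: clear b; clear t; Star (linear [:: a] [:: b; t]); Atom (Zero a); restore t [:: a]].
Definition test_eq t a b : prog :=
  seqs [:: clear t; Star (linear [:: a; b] [:: t]); Atom (Zero a); Atom (Zero b);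
           restore t [:: a; b]].
(** Decrementing and incrementing [b] once [a] is used up tests that something is left of [b]; what
    was taken from both is then given back from [t]. *)
Definition test_lt t a b : prog :=
  seqs [:: clear t; Star (linear [:: a; b] [:: t]); Atom (Zero a); linear [:: b] [:: b];
           restore t [:: a; b]].
Definition halve t a : prog :=
  seqs [:: clear t; Star (linear [:: a; a] [:: t]); Atom (Zero a); restore t [:: a]].
Definition cancel_pair a b : prog := Star (linear [:: a; b] [::]).

Variables (w : seq A) (K : nat).
Local Notation run := (run w K).

Definition bounded r := forall v, r v < K.

Lemma run_bounded (p : prog) r r' : run p r r' -> bounded r -> bounded r'.
Proof.
elim: p r r' => [i|p IHp q IHq|p IHp q IHq|p IHp] r r' /=.
- case: i => [|v|v|v|v o] /=; try by [move=> -> | move=> [_ ->]].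
    by move=> [lt ->] b u; rewrite /upd; case: eqP.
  move=> [_ ->] b u; rewrite /upd; case: eqP => // _.
  by apply: leq_ltn_trans (leq_pred _) (b v).
- by move=> [m /IHp H /IHq H'] /H/H'.
- by move=> [/IHp|/IHq].
- by elim=> // {}r m {}r' /IHp H _ IH /H/IH.
Qed.

Lemma run_seq p q r r' : run (PSeq p q) r r' <-> exists2 m, run p r m & run q m r'.
Proof. by []. Qed.

Lemma run_alt p q r r' : run (Alt p q) r r' <-> run p r r' \/ run q r r'.
Proof. by []. Qed.

Lemma run_iter p r r' : run (Star p) r r' <-> star (run p) r r'.
Proof. by []. Qed.

Lemma run_cons p ps r r' : run (seqs (p :: ps)) r r' <->
  exists2 m, run p r m & run (seqs ps) m r'.
Proof. by []. Qed.

Lemma run_cat ps qs r r' : run (seqs (ps ++ qs)) r r' <->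
  exists2 m, run (seqs ps) r m & run (seqs qs) m r'.
Proof.
elim: ps r => [|p ps IH] r /=; first by split=> [H|[m ->]] //; exists r.
split=> [[m Hp /IH[m' H1 H2]]|[m' [m Hp H1] H2]]; first by exists m' => //; exists m.
by exists m => //; apply/IH; exists m'.
Qed.

Lemma run_alts v ps r r' : run (alts v ps) r r' <-> exists i, i < size ps /\ run (nth (fail v) ps i) r r'.
Proof.
elim: ps => [|p ps IH] /=.
  by split=> [[m [E ->] [H _]]|[i []]] //; rewrite E in H.
split=> [[Hp|/IH[i [lt_i Hi]]]|[[|i] [lt_i Hi]]]; [by exists 0 | by exists i.+1 | by left |].
by right; apply/IH; exists i.
Qed.

Lemma run_decs ds r r' : run (seqs [seq Atom (Dec v) | v <- ds]) r r' <->
  (forall v, count_mem v ds <= r v) /\ r' = fun v => r v - count_mem v ds.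
Proof.
elim: ds r r' => [|d ds IH] r r' /=.
  by split=> [->|[_ ->]]; [split=> // |]; apply: functional_extensionality => v; rewrite subn0.
have E : r d > 0 -> (fun v => upd r d (r d).-1 v - count_mem v ds) =
    (fun v => r v - ((d == v) + count_mem v ds)).
  move=> d_gt0; apply: functional_extensionality => v.
  by rewrite /upd eq_sym; case: eqP => [<-|_] /=; lia.
split=> [[m [d_gt0 ->] /IH[Hc ->]]|[Hc ->]].
  split=> [v|]; last exact: E.
  by have := Hc v; rewrite /upd eq_sym; case: eqP => [<-|_] /=; lia.
have d_gt0 : 0 < r d by have := Hc d; rewrite eqxx /=; lia.
exists (upd r d (r d).-1) => //; rewrite -E //; apply/IH; split=> // v.
by have := Hc v; rewrite /upd eq_sym; case: eqP => [<-|_] /=; lia.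
Qed.

(** From here on lemmas come in pairs: [run_p] tells what any execution of [p] does, and [p_run]
    provides an execution, for which the counters must stay below [K]. *)
Lemma run_incs js r r' : run (seqs [seq Atom (Inc v) | v <- js]) r r' ->
  r' = fun v => r v + count_mem v js.
Proof.
elim: js r => [|i js IH] r /=.
  by move=> ->; apply: functional_extensionality => v; rewrite addn0.
move=> [m [_ ->] /IH->]; apply: functional_extensionality => v.
by rewrite /upd eq_sym; case: eqP => [<-|_] /=; lia.
Qed.

Lemma incs_run js r : (forall v, v \in js -> r v + count_mem v js < K) ->
  run (seqs [seq Atom (Inc v) | v <- js]) r (fun v => r v + count_mem v js).
Proof.
elim: js r => [|i js IH] r Hlt /=.
  by apply: functional_extensionality => v; rewrite addn0.
exists (upd r i (r i).+1).
  by split=> //; have := Hlt i (mem_head _ _); rewrite /= eqxx /=; lia.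
have -> : (fun v => r v + ((i == v) + count_mem v js)) =
    (fun v => upd r i (r i).+1 v + count_mem v js).
  by apply: functional_extensionality => v; rewrite /upd eq_sym; case: eqP => [<-|_] /=; lia.
apply: IH => v vis; have := Hlt v; rewrite inE vis orbT => /(_ isT).
by rewrite /= /upd eq_sym; case: eqP => [<-|_] /=; lia.
Qed.

Definition shifted k ds js r : Var -> nat :=
  fun v => r v - k * count_mem v ds + k * count_mem v js.

Lemma run_linear ds js r r' : run (linear ds js) r r' ->
  (forall v, count_mem v ds <= r v) /\ r' = shifted 1 ds js r.
Proof.
move=> [m /run_decs[Hc ->] /run_incs->]; split=> //.
by apply: functional_extensionality => v; rewrite /shifted !mul1n.
Qed.

Lemma linear_run ds js r : (forall v, count_mem v ds <= r v) ->
  (forall v, v \in js -> r v + count_mem v js < K + count_mem v ds) ->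
  run (linear ds js) r (shifted 1 ds js r).
Proof.
move=> Hc Hlt; exists (fun v => r v - count_mem v ds); first exact/run_decs.
have -> : shifted 1 ds js r = fun v => r v - count_mem v ds + count_mem v js.
  by apply: functional_extensionality => v; rewrite /shifted !mul1n.
by apply: incs_run => v /Hlt; have := Hc v; lia.
Qed.

(** Disjointness rules out that a round consumes what an earlier round has produced; therefore the
    total consumption is bounded by the initial values. *)
Lemma run_star_linear ds js r r' : (forall v, v \in ds -> v \notin js) ->
  run (Star (linear ds js)) r r' ->
  exists2 k, (forall v, k * count_mem v ds <= r v) & r' = shifted k ds js r.
Proof.
move=> disj; elim=> [{}r|{}r m {}r' /run_linear[Hc ->] _ [k Hk ->]].
  by exists 0 => //; apply: functional_extensionality => v; rewrite /shifted !mul0n subn0 addn0.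
have H0 v : count_mem v ds = 0 \/ count_mem v js = 0.
  have [/disj vis|vds] := boolP (v \in ds); [right|left]; exact/count_memPn.
exists k.+1 => [v|].
  by have := Hk v; have := Hc v; rewrite /shifted; case: (H0 v) => ->; lia.
apply: functional_extensionality => v; have := Hk v; have := Hc v.
by rewrite /shifted; case: (H0 v) => ->; lia.
Qed.

Lemma star_linear_run k ds js r : (forall v, v \in ds -> v \notin js) ->
  (forall v, k * count_mem v ds <= r v) ->
  (forall v, v \in js -> r v + k * count_mem v js < K) ->
  run (Star (linear ds js)) r (shifted k ds js r).
Proof.
move=> disj; elim: k r => [|k IH] r Hc Hlt.
  have -> : shifted 0 ds js r = r; last exact: StarRefl.
  by apply: functional_extensionality => v; rewrite /shifted !mul0n subn0 addn0.
have H0 v : count_mem v ds = 0 \/ count_mem v js = 0.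
  have [/disj vis|vds] := boolP (v \in ds); [right|left]; exact/count_memPn.
have E : shifted k.+1 ds js r = shifted k ds js (shifted 1 ds js r).
  apply: functional_extensionality => v; have := Hc v.
  by rewrite /shifted; case: (H0 v) => ->; lia.
rewrite E; apply: (@StarStep _ _ _ (shifted 1 ds js r)).
  by apply: linear_run => v; [have := Hc v | move=> vis; have := Hlt v vis]; lia.
apply: IH => v; first by have := Hc v; rewrite /shifted; case: (H0 v) => ->; lia.
move=> vis; have := Hlt v vis; rewrite /shifted; case: (H0 v) => ->; lia.
Qed.

Lemma run_clear v r r' : run (clear v) r r' <-> r' = upd r v 0.
Proof.
split=> [/run_seq[m Hs [E ->]]|->].
  have [//|k Hk Em] := run_star_linear _ Hs; subst m.
  apply: functional_extensionality => u; move: E; rewrite /shifted /upd /= eqxx.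
  rewrite [v == u]eq_sym; case: eqP => [->|_] /=; lia.
exists (upd r v 0); last by rewrite /= updx.
have -> : upd r v 0 = shifted (r v) [:: v] [::] r.
  apply: functional_extensionality => u; rewrite /shifted /upd /=.
  by rewrite [v == u]eq_sym; case: eqP => [->|_] /=; lia.
by apply: star_linear_run => // u; rewrite /= addn0; case: eqP => [->|_] /=; lia.
Qed.

Definition restored t js r : Var -> nat :=
  fun v => if v == t then 0 else r v + r t * count_mem v js.

Lemma restoredE t js r : t \notin js -> restored t js r = shifted (r t) [:: t] js r.
Proof.
move=> /count_memPn tjs; apply: functional_extensionality => v.
by rewrite /restored /shifted /= eq_sym; case: eqP => [<-|_]; rewrite ?tjs /=; lia.
Qed.

Lemma run_restore t js r r' : t \notin js -> run (restore t js) r r' -> r' = restored t js r.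
Proof.
move=> tjs /run_seq[m Hs [E ->]]; rewrite restoredE //.
have [|k Hk Em] := run_star_linear _ Hs; first by move=> v; rewrite inE => /eqP->.
have <- : k = r t; last by [].
by have := Hk t; move: E; rewrite Em /shifted /= eqxx (count_memPn tjs) /=; lia.
Qed.

Lemma restore_run t js r : t \notin js ->
  (forall v, v \in js -> r v + r t * count_mem v js < K) ->
  run (restore t js) r (restored t js r).
Proof.
move=> tjs Hlt; exists (restored t js r); last by rewrite /= /restored eqxx.
rewrite restoredE //; apply: star_linear_run => //.
  by move=> v; rewrite inE => /eqP->.
by move=> v; rewrite /= addn0; case: eqP => [->|_] /=; lia.
Qed.

Ltac counter_eq u := rewrite /restored /shifted /upd /=;
  repeat match goal with
  | H : is_true (?a != ?b) |- _ => move/eqP: H => H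
  end;
  repeat match goal with
  | |- context [u == ?b] => case: (u =P b) => ?; subst => //=
  | |- context [?b == u] => case: (b =P u) => ?; subst => //=
  | |- context [?a == ?b] => case: (a =P b) => ?; subst => //=
  end; try lia.

Lemma run_copy t a b r r' : a != b -> a != t -> b != t ->
  run (copy t a b) r r' -> r' = upd (upd r b (r a)) t 0.
Proof.
rewrite /copy => ab at_ bt /run_cons[_ /run_clear-> /run_cons[_ /run_clear-> /run_cons[m3 Hs]]].
move=> /run_cons[_ [E ->] /run_cons[m5 /run_restore H ->]].
have [|k Hk Em] := run_star_linear _ Hs.
  by move=> v; rewrite !inE => /eqP->; rewrite (negPf ab) (negPf at_).
rewrite H ?inE 1?eq_sym // Em {H Hs}.
have Ek : k = r a.
  have := Hk a; move: E; rewrite Em /shifted /= eqxx [b == a]eq_sym [t == a]eq_sym.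
  by rewrite (negPf ab) (negPf at_) /= !updN //; lia.
rewrite Ek; clear -ab at_ bt; apply: functional_extensionality => v.
counter_eq v.
Qed.

Lemma copy_run t a b r : a != b -> a != t -> b != t -> r a < K ->
  run (copy t a b) r (upd (upd r b (r a)) t 0).
Proof.
move=> ab at_ bt lt_a.
exists (upd r b 0); first exact/run_clear.
exists (upd (upd r b 0) t 0); first exact/run_clear.
exists (shifted (r a) [:: a] [:: b; t] (upd (upd r b 0) t 0)).
  apply: star_linear_run => v.
  - by rewrite !inE => /eqP->; rewrite (negPf ab) (negPf at_).
  - by clear lt_a; counter_eq v.
  - by rewrite !inE; counter_eq v.
exists (shifted (r a) [:: a] [:: b; t] (upd (upd r b 0) t 0)).
  by split=> //; counter_eq a.
have -> : upd (upd r b (r a)) t 0 =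
    restored t [:: a] (shifted (r a) [:: a] [:: b; t] (upd (upd r b 0) t 0)).
  apply: functional_extensionality => v; clear lt_a; counter_eq v.
eexists; last by [].
apply: restore_run; first by rewrite inE eq_sym.
by move=> v; rewrite inE => /eqP->; counter_eq a.
Qed.

Lemma run_test_eq t a b r r' : a != b -> a != t -> b != t ->
  run (test_eq t a b) r r' -> r a = r b /\ r' = upd r t 0.
Proof.
rewrite /test_eq => ab at_ bt /run_cons[_ /run_clear-> /run_cons[m3 Hs]].
move=> /run_cons[_ [Ea ->] /run_cons[_ [Eb ->] /run_cons[m5 /run_restore H ->]]].
have [|k Hk Em] := run_star_linear _ Hs.
  by move=> v; rewrite !inE => /orP[] /eqP->.
rewrite H ?inE ?negb_or 1?eq_sym ?at_ 1?eq_sym ?bt // Em {H Hs}.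
have [Eka Ekb] : k = r a /\ k = r b.
  have := Hk a; have := Hk b; move: Ea Eb; rewrite Em /shifted /= !eqxx [b == a]eq_sym.
  by rewrite ![t == _]eq_sym (negPf ab) (negPf at_) (negPf bt) !updN //=; lia.
split; first by rewrite -Eka.
rewrite Eka in Ekb *; clear -ab at_ bt Ekb; apply: functional_extensionality => v.
counter_eq v.
Qed.

Lemma test_eq_run t a b r : a != b -> a != t -> b != t -> r a < K -> r a = r b ->
  run (test_eq t a b) r (upd r t 0).
Proof.
move=> ab at_ bt lt_a Eab.
exists (upd r t 0); first exact/run_clear.
pose m := shifted (r a) [:: a; b] [:: t] (upd r t 0).
exists m.
  apply: star_linear_run => v.
  - by rewrite !inE => /orP[] /eqP->.
  - by clear lt_a; counter_eq v.
  - by rewrite !inE; counter_eq v.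
exists m; first by split=> //; rewrite /m; counter_eq a.
exists m; first by split=> //; rewrite /m; counter_eq b.
have -> : upd r t 0 = restored t [:: a; b] m.
  by rewrite /m; clear m; apply: functional_extensionality => v; clear lt_a; counter_eq v.
eexists; last by [].
apply: restore_run; first by rewrite !inE negb_or 1?eq_sym at_ 1?eq_sym bt.
by rewrite /m; clear m => v; rewrite !inE => /orP[] /eqP->; [counter_eq a | counter_eq b].
Qed.

Lemma run_test_lt t a b r r' : a != b -> a != t -> b != t ->
  run (test_lt t a b) r r' -> r a < r b /\ r' = upd r t 0.
Proof.
rewrite /test_lt => ab at_ bt /run_cons[_ /run_clear-> /run_cons[m3 Hs]].
move=> /run_cons[_ [Ea ->] /run_cons[_ /run_linear[Hb ->] /run_cons[m5 /run_restore H ->]]].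
have [|k Hk Em] := run_star_linear _ Hs.
  by move=> v; rewrite !inE => /orP[] /eqP->.
rewrite H ?inE ?negb_or 1?eq_sym ?at_ 1?eq_sym ?bt // Em {H Hs}.
have [Eka Ekb] : k = r a /\ k < r b.
  have := Hk a; have := Hk b; move: Ea (Hb b); rewrite Em /shifted /= !eqxx [b == a]eq_sym.
  by rewrite ![t == _]eq_sym (negPf ab) (negPf at_) (negPf bt) !updN //=; lia.
split; first by rewrite -Eka.
rewrite Eka in Ekb *; clear -ab at_ bt Ekb; apply: functional_extensionality => v.
counter_eq v.
Qed.

Lemma test_lt_run t a b r : a != b -> a != t -> b != t -> r b < K -> r a < r b ->
  run (test_lt t a b) r (upd r t 0).
Proof.
move=> ab at_ bt lt_b Eab.
exists (upd r t 0); first exact/run_clear.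
pose m := shifted (r a) [:: a; b] [:: t] (upd r t 0).
exists m.
  apply: star_linear_run => v.
  - by rewrite !inE => /orP[] /eqP->.
  - by clear lt_b; counter_eq v.
  - by rewrite !inE; counter_eq v.
exists m; first by split=> //; rewrite /m; counter_eq a.
have mb : m b = r b - r a by rewrite /m; counter_eq b.
exists m.
  have {2}-> : m = shifted 1 [:: b] [:: b] m.
    by apply: functional_extensionality => v; move: mb; clearbody m; counter_eq v.
  apply: linear_run => v; move: mb; clearbody m; first by counter_eq v.
  by rewrite !inE => ? /eqP->; counter_eq b.
have -> : upd r t 0 = restored t [:: a; b] m.
  by rewrite /m; clear m mb; apply: functional_extensionality => v; clear lt_b; counter_eq v.
eexists; last by [].
rewrite /m; clear m mb; apply: restore_run; first by rewrite !inE negb_or 1?eq_sym at_ 1?eq_sym bt.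
by move=> v; rewrite !inE => /orP[] /eqP->; [counter_eq a | counter_eq b].
Qed.

Lemma run_halve t a r r' : a != t -> run (halve t a) r r' ->
  ~~ odd (r a) /\ r' = upd (upd r a (r a)./2) t 0.
Proof.
rewrite /halve => at_ /run_cons[_ /run_clear-> /run_cons[m3 Hs]].
move=> /run_cons[_ [Ea ->] /run_cons[m5 /run_restore H ->]].
have [|k Hk Em] := run_star_linear _ Hs.
  by move=> v; rewrite !inE => /orP[] /eqP->.
rewrite H ?inE 1?eq_sym ?at_ // Em {H Hs}.
have Ek : r a = k.*2.
  have := Hk a; move: Ea; rewrite Em /shifted /= !eqxx.
  by rewrite ![t == _]eq_sym (negPf at_) !updN //=; lia.
rewrite Ek odd_double doubleK; split=> //.
clear -at_ Ek; apply: functional_extensionality => v; counter_eq v.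
Qed.

Lemma halve_run t a r : a != t -> r a < K -> ~~ odd (r a) ->
  run (halve t a) r (upd (upd r a (r a)./2) t 0).
Proof.
move=> at_ lt_a even_a.
have Ea : r a = (r a)./2.*2 by rewrite even_halfK.
move: ((r a)./2) Ea => k Ea {even_a}.
exists (upd r t 0); first exact/run_clear.
exists (shifted k [:: a; a] [:: t] (upd r t 0)).
  apply: star_linear_run => v.
  - by rewrite !inE => /orP[] /eqP->.
  - by clear lt_a; counter_eq v.
  - by rewrite !inE; counter_eq v.
exists (shifted k [:: a; a] [:: t] (upd r t 0)); first by split=> //; counter_eq a.
have -> : upd (upd r a k) t 0 = restored t [:: a] (shifted k [:: a; a] [:: t] (upd r t 0)).
  by apply: functional_extensionality => v; clear lt_a; counter_eq v.
eexists; last by [].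
apply: restore_run; first by rewrite !inE 1?eq_sym at_.
by move=> v; rewrite !inE => /eqP->; counter_eq a.
Qed.

Lemma run_cancel a b r r' : a != b -> run (cancel_pair a b) r r' <->
  exists2 k, k <= r a /\ k <= r b & r' = upd (upd r a (r a - k)) b (r b - k).
Proof.
rewrite /cancel_pair => ab.
have E k : upd (upd r a (r a - k)) b (r b - k) = shifted k [:: a; b] [::] r.
  by apply: functional_extensionality => v; counter_eq v.
split=> [Hs|[k [le_a le_b] ->]].
  have [//|k Hk ->] := run_star_linear _ Hs; exists k; last by rewrite E.
  have := Hk a; have := Hk b; rewrite /= !eqxx [b == a]eq_sym (negPf ab) /=; lia.
by rewrite E; apply: star_linear_run => // v; clear E; counter_eq v.
Qed.

End CounterPrograms.

(** * Encodings *)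

Fixpoint natval (bs : seq bool) : nat := if bs is b :: bs' then b + (natval bs').*2 else 0.

Lemma natval_bits n : natval (bits n) = n.
Proof.
rewrite -[RHS](bin_of_natK n) /bits; case: (bin_of_nat n) => //= p.
elim: p => [p IH|p IH|] //=; last by rewrite IH add0n NatTrec.doubleE.
by rewrite IH NatTrec.doubleE.
Qed.

Lemma last_behead b bs : last true (b :: bs) -> last true bs.
Proof. by case: bs. Qed.

Lemma last_bits n : last true (bits n).
Proof.
rewrite /bits; case: (bin_of_nat n) => // p.
suff H b : last b (bits_of_pos p) by [].
by elim: p b => [p IH|p IH|] b //=; apply: IH.
Qed.

Lemma natval_eq0 bs : last true bs -> natval bs = 0 -> bs = [::].
Proof.
elim: bs => //= -[] bs IH // lst; have lst' : last true bs by case: (bs) lst.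
by rewrite add0n => /eqP; rewrite double_eq0 => /eqP/(IH lst') E; rewrite E in lst.
Qed.

(** The condition [last true bs] means that [bs] is empty or has top digit 1, as the least
    significant digit comes first; without leading zeros the digits are unique. *)
Lemma natval_inj bs cs : last true bs -> last true cs -> natval bs = natval cs -> bs = cs.
Proof.
elim: bs cs => [|b bs IH] cs lb lc E; first by rewrite (natval_eq0 lc).
case: cs lc E => [|c cs] lc; first exact: natval_eq0.
rewrite /= => E.
have Ebc : b = c.
  by have := congr1 odd E; rewrite !oddD !odd_double !addbF !oddb.
rewrite Ebc in E *; congr cons.
apply: IH; [exact: last_behead lb | exact: last_behead lc |].
by apply: double_inj; apply: addnI E.
Qed.

Lemma bits_natval bs : last true bs -> bits (natval bs) = bs.
Proof. by move=> lb; apply: natval_inj; rewrite ?last_bits ?natval_bits. Qed.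

Definition prefix_free T (enc : T -> seq letter) :=
  forall x y s t, enc x ++ s = enc y ++ t -> x = y /\ s = t.

Lemma enc_unary_prefix_free : prefix_free enc_unary.
Proof.
move=> m n s t; rewrite /enc_unary -!catA /=.
elim: m n => [|m IH] [|n] //=; first by case.
by case=> /IH[-> ->].
Qed.

Lemma map_some_prefix (bs cs : seq bool) s t :
  map Some bs ++ None :: s = map Some cs ++ None :: t -> bs = cs /\ s = t.
Proof.
elim: bs cs => [|b bs IH] [|c cs] //=; first by case.
by case=> -> /IH[-> ->].
Qed.

Lemma bits_inj : injective bits.
Proof. by move=> m n E; rewrite -(natval_bits m) E natval_bits. Qed.

Lemma enc_nat_prefix_free : prefix_free enc_nat.
Proof. by move=> m n s t; rewrite /enc_nat -!catA /= => /map_some_prefix[/bits_inj]. Qed.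

Lemma enc_int_prefix_free : prefix_free enc_int.
Proof.
move=> m n s t [Es] /enc_nat_prefix_free[Ea ->]; split=> //.
by move: Es Ea; case: m => m; case: n => n //= _; lia.
Qed.

Lemma enc_vector_prefix_free (X : finType) T (enc : T -> seq letter) :
  prefix_free enc -> prefix_free (@enc_vector X T enc).
Proof.
move=> pf v v' s t; rewrite /enc_vector => E.
suff [H ->] : (forall x, x \in enum X -> v x = v' x) /\ s = t.
  by split=> //; apply/ffunP => x; apply: H; rewrite mem_enum.
elim: (enum X) E => [|x xs IH] //=.
rewrite -!catA => /pf[Ex /IH[H ->]]; split=> // y.
by rewrite inE => /orP[/eqP->|/H].
Qed.

Lemma enc_transition_prefix_free (Sigma : finType) n :
  prefix_free (@enc_transition Sigma n).
Proof.
have E d s : enc_transition d ++ s = enc_unary (source d) ++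
    (enc_vector enc_int (effect d) ++ (enc_vector enc_nat (target d) ++ s)).
  by move=> *; rewrite /enc_transition !catA.
move=> [[q a] t] [[q' a'] t'] s s'; rewrite !E /source /effect /target => /enc_unary_prefix_free[/val_inj /= ->].
move=> /(enc_vector_prefix_free enc_int_prefix_free)[/= ->].
by move=> /(enc_vector_prefix_free enc_nat_prefix_free)[/= -> ->].
Qed.

Lemma enc_edge_prefix_free (Sigma : finType) n :
  prefix_free (fun e : edge Sigma n => enc_transition (to_transition e)).
Proof. by move=> e e' s t /enc_transition_prefix_free[/to_transition_inj]. Qed.

Lemma flatten_prefix_free T (enc : T -> seq letter) (xs ys : seq T) :
  prefix_free enc -> (forall x, enc x <> [::]) ->
  flatten (map enc xs) = flatten (map enc ys) -> xs = ys.
Proof.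
move=> pf nz; elim: xs ys => [|x xs IH] [|y ys] //=.
- by case E: (enc y) => //; case: (nz y).
- by case E: (enc x) => //; case: (nz x).
- by move=> /pf[-> /IH->].
Qed.

(** The encoding of 0 is the bare terminator and that of 1 is [[:: Some true; None]], so a target
    vector of size at most 1 is a row of terminators with at most one digit inserted. *)
Definition target_word n (o : option nat) : seq letter :=
  if o is Some t then nseq t None ++ [:: Some true; None] ++ nseq (n - t.+1) None
  else nseq n None.

Lemma flatten_blank (T : Type) (f : T -> seq letter) (s : seq T) :
  (forall x, f x = [:: None]) -> flatten (map f s) = nseq (size s) None.
Proof. by move=> Hf; elim: s => //= x s ->; rewrite Hf. Qed.

Lemma enc_small_target n (o : option 'I_n) :
  enc_vector enc_nat (small_target o) = target_word n (omap val o).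
Proof.
pose f i := if Some i == omap val o then [:: Some true; None] else [:: None : letter].
have -> : enc_vector enc_nat (small_target o) = flatten (map f (iota 0 n)).
  rewrite /enc_vector -val_enum_ord -[in RHS]map_comp; congr flatten; apply: eq_map => q /=.
  rewrite ffunE /f; case: o {f} => [t|] //=; rewrite !(inj_eq Some_inj).
  by rewrite (inj_eq val_inj); case: eqP.
rewrite /f {f}; case: o => [t|] /=; set f := (fun i => _).
  have lt_t := ltn_ord t.
  have -> : iota 0 n = iota 0 t ++ (t : nat) :: iota t.+1 (n - t.+1).
    have E : n = t + (1 + (n - t.+1)) by lia.
    by rewrite {1}E iotaD add0n iotaD addn1.
  have blank i : i != t :> nat -> f i = [:: None].
    by rewrite /f (inj_eq Some_inj) => /negPf->.
  rewrite map_cat flatten_cat /= {2}/f eqxx; congr (_ ++ _).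
    rewrite -{2}(size_iota 0 t); have: all (fun i => i != t :> nat) (iota 0 t).
      by apply/allP => i; rewrite mem_iota; lia.
    by elim: (iota 0 t) => //= i s IH /andP[/blank-> /IH->].
  congr (_ :: _ :: _).
  rewrite -{2}(size_iota t.+1 (n - t.+1)); have: all (fun i => i != t :> nat) (iota t.+1 (n - t.+1)).
    by apply/allP => i; rewrite mem_iota; lia.
  by elim: (iota _ _) => //= i s IH /andP[/blank-> /IH->].
by rewrite flatten_blank ?size_iota.
Qed.

(** * Parsing a transition *)

Ltac lookups := rewrite !(updx, updN) //.

Section Membership.
Variable Sigma : finType.

Definition var : finType := ('I_11 + 'I_5 * Sigma)%type.
Local Notation prog := (prog var letter).
Local Notation val_ := (var -> nat).
Implicit Types (r : val_) (u : seq letter).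

(* A head on the input, the numbers of non-terminals and of transitions, the
   initial non-terminal and the current one, the source and target of the
   transition under the head, a loop counter, the positions of the first
   transition and of the end of the list of transitions, and a scratch counter. *)
Definition P : var := inl (@Ordinal 11 0 isT).
Definition NN : var := inl (@Ordinal 11 1 isT).
Definition MM : var := inl (@Ordinal 11 2 isT).
Definition QI : var := inl (@Ordinal 11 3 isT).
Definition CUR : var := inl (@Ordinal 11 4 isT).
Definition SRC : var := inl (@Ordinal 11 5 isT).
Definition TGT : var := inl (@Ordinal 11 6 isT).
Definition J : var := inl (@Ordinal 11 7 isT).
Definition DD : var := inl (@Ordinal 11 8 isT).
Definition VV : var := inl (@Ordinal 11 9 isT).
Definition T : var := inl (@Ordinal 11 10 isT).

(* For each terminal, a carry is stored as the difference of two counters; then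
   come the base state of a cycle and the positions in the input of the sign and
   of the next bit of the given vector. *)
Definition POS x : var := inr (@Ordinal 5 0 isT, x).
Definition NEG x : var := inr (@Ordinal 5 1 isT, x).
Definition BASE x : var := inr (@Ordinal 5 2 isT, x).
Definition SIGN x : var := inr (@Ordinal 5 3 isT, x).
Definition BIT x : var := inr (@Ordinal 5 4 isT, x).

(** The counters that reading a transition may overwrite, besides the carries. *)
Definition is_aux (v : var) := v \in [:: P; SRC; TGT; J; T].
Definition is_carry (v : var) := if v is inr (i, _) then i < 2 else false.

Definition match_word u : prog :=
  seqs (flatten [seq [:: Atom (Read P (Some l)); Atom (Inc P)] | l <- u]).
Definition count_letter l c : prog := Star (seqs [:: match_word [:: l]; Atom (Inc c)]).
Definition parse_unary c : prog :=
  seqs [:: clear letter c; count_letter (Some true) c; match_word [:: None]].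

Definition count_effect (a : option (Sigma * bool)) : prog :=
  if a is Some (x, b) then Atom (Inc (if b then NEG x else POS x)) else Atom Nop.
(** A regular transition has one of [2 * #|Sigma| + 1] effects, so its effect vector is recognized
    by trying finitely many fixed words. *)
Definition parse_effect (c : bool) : prog :=
  alts T [seq PSeq (match_word (enc_vector enc_int (small_effect a)))
                   (if c then count_effect a else Atom Nop)
         | a <- enum {: option (Sigma * bool)}].
(** [J] counts the entries of the target vector. Its value at the entry 1 is the target, and the
    comparison with [NN] checks the number of entries. *)
Definition parse_some_target : prog :=
  seqs [:: clear letter J; count_letter None J; match_word [:: Some true; None];
           copy letter T J TGT; Atom (Inc J); count_letter None J; test_eq letter T J NN].
Definition parse_no_target : prog :=
  seqs [:: clear letter J; count_letter None J; test_eq letter T J NN].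
(* [c] tells whether the effect is counted in [POS] and [NEG]. *)
Definition parse_transition c tgt : prog :=
  seqs [:: parse_unary SRC; test_lt letter T SRC NN; parse_effect c; tgt].
Definition skip_transition : prog :=
  parse_transition false (Alt parse_some_target parse_no_target).

Variables (w : seq letter) (K : nat).
Hypothesis w_lt : size w < K.
Local Notation run := (run w K).

Definition occ p u := prefix u (drop p w).

Lemma occ_cons p l u : occ p (l :: u) = (onth w p == Some l) && occ p.+1 u.
Proof.
rewrite /occ; have [lt_p|le_p] := ltnP p (size w); last first.
  by rewrite drop_oversize // onth_default.
rewrite (drop_nth None lt_p) /= eq_sym; congr (_ && _).
have := onthTE w p; rewrite lt_p; case E: onth => [y|] // _.
by rewrite -odflt_onth E (inj_eq Some_inj).
Qed.

Lemma occ_refl : occ 0 w. Proof. by rewrite /occ drop0 prefix_refl. Qed.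

Lemma occ_nil p : occ p [::]. Proof. exact: prefix0s. Qed.

Lemma occ_cat p u1 u2 : occ p (u1 ++ u2) = occ p u1 && occ (p + size u1) u2.
Proof.
elim: u1 p => [|l u1 IH] p; first by rewrite occ_nil addn0.
by rewrite cat_cons !occ_cons IH andbA addSnnS.
Qed.

Lemma occ_size p u : p <= size w -> occ p u -> p + size u <= size w.
Proof. by move=> le_p /size_prefix; rewrite size_drop leq_subRL. Qed.

Lemma occP p u : reflect (drop p w = u ++ drop (p + size u) w) (occ p u).
Proof.
rewrite /occ; apply: (iffP idP) => [/prefixP[s Es]|->]; last exact: prefix_prefix.
by rewrite addnC -drop_drop Es drop_size_cat.
Qed.

Ltac lookup := rewrite ?(updx, updN) //.

Lemma run_match u r r' : run (match_word u) r r' ->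
  occ (r P) u /\ r' = upd r P (r P + size u).
Proof.
rewrite /match_word; elim: u r => [|l u IH] r /=.
  by move=> ->; rewrite occ_nil addn0 upd_id.
move=> [_ [El ->] [m [_ ->] /IH[]]]; lookup => Hu ->; rewrite occ_cons El eqxx; split=> //.
by apply: functional_extensionality => v; rewrite /upd addnS addSn; case: eqP.
Qed.

Lemma match_run u r : occ (r P) u -> r P <= size w ->
  run (match_word u) r (upd r P (r P + size u)).
Proof.
rewrite /match_word; elim: u r => [|l u IH] r /=.
  by rewrite addn0 upd_id.
rewrite occ_cons => /andP[/eqP El Hu] le_p.
have lt_p : r P < size w by have := onthTE w (r P); rewrite El.
exists r => //; exists (upd r P (r P).+1); first by split=> //; lia.
have := IH (upd r P (r P).+1); lookup => /(_ Hu lt_p).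
have -> // : upd (upd r P (r P).+1) P ((r P).+1 + size u) = upd r P (r P + (size u).+1).
by apply: functional_extensionality => v; rewrite /upd addnS addSn; case: eqP.
Qed.

Lemma run_count_letter l c r r' : c != P -> run (count_letter l c) r r' ->
  exists2 k, occ (r P) (nseq k l) & r' = upd (upd r c (r c + k)) P (r P + k).
Proof.
move=> cP /run_iter; elim=> [{}r|{}r m {}r' /run_cons[m1 /run_match[]]].
  by exists 0; rewrite ?occ_nil // !addn0 !upd_id.
rewrite addn1 => Hl -> [_ [_ ->] ->] _ [k].
rewrite [upd (upd _ _ _) _ _ P]updN 1?eq_sym // !updx => Hk ->.
move: Hl; rewrite occ_cons => /andP[Hl _].
exists k.+1; first by rewrite /= occ_cons Hl.
apply: functional_extensionality => v; move/eqP: cP; rewrite /upd.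
by repeat (case: eqP => [?|?] //; subst => //); lia.
Qed.

Lemma count_letter_run l c r k : c != P -> occ (r P) (nseq k l) -> r P <= size w ->
  r c + k < K -> run (count_letter l c) r (upd (upd r c (r c + k)) P (r P + k)).
Proof.
move=> cP; elim: k r => [|k IH] r.
  by rewrite !addn0 !upd_id => _ _ _; apply: StarRefl.
rewrite /= occ_cons => /andP[Hl Hk] le_p lt_c.
have lt_p : r P < size w by have := onthTE w (r P); rewrite (eqP Hl).
pose m := upd (upd r P (r P).+1) c (r c).+1.
have [mP mc] : m P = (r P).+1 /\ m c = (r c).+1 by rewrite /m !updx updN 1?eq_sym ?updx.
apply: (@StarStep _ _ _ m).
  exists (upd r P (r P + 1)).
    by apply: (@match_run [:: l] r _ le_p); rewrite occ_cons Hl occ_nil.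
  exists m => //; rewrite /= /m addn1 updN //; split=> //; lia.
have := IH m; rewrite mP mc => /(_ Hk lt_p).
have -> : upd (upd m c ((r c).+1 + k)) P ((r P).+1 + k) = upd (upd r c (r c + k.+1)) P (r P + k.+1).
  apply: functional_extensionality => v; rewrite /m /upd.
  by repeat (case: eqP => [?|?] //; subst => //); lia.
by apply; lia.
Qed.

Lemma run_parse_unary c r r' : c != P -> run (parse_unary c) r r' ->
  exists2 k, occ (r P) (enc_unary k) & r' = upd (upd r c k) P (r P + k.+1).
Proof.
rewrite /parse_unary => cP /run_cons[_ /run_clear-> /run_cons[m /(run_count_letter cP)[k]]].
rewrite updx updN 1?eq_sym // add0n => Hk -> /run_cons[m' /run_match[]].
rewrite updx => H1 -> ->; exists k; first by rewrite occ_cat Hk size_nseq.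
apply: functional_extensionality => v; rewrite /upd /=.
by repeat (case: eqP => [?|?] //; subst => //); lia.
Qed.

Lemma parse_unary_run c r k : c != P -> occ (r P) (enc_unary k) -> r P <= size w ->
  run (parse_unary c) r (upd (upd r c k) P (r P + k.+1)).
Proof.
move=> cP; rewrite occ_cat size_nseq => /andP[Hk H1] le_p.
have := occ_size le_p Hk; rewrite size_nseq => le_pk.
have Pc : P != c by rewrite eq_sym.
exists (upd r c 0); first exact/run_clear.
exists (upd (upd r c k) P (r P + k)).
  have := @count_letter_run (Some true) c (upd r c 0) k cP.
  rewrite updx updN // add0n => /(_ Hk le_p).
  have -> : upd (upd r c 0) c k = upd r c k.
    by apply: functional_extensionality => v; rewrite /upd; case: eqP.
  by apply; lia.
exists (upd (upd r c k) P (r P + k.+1)) => //.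
have := @match_run [:: None] (upd (upd r c k) P (r P + k)); rewrite updx => /(_ H1 le_pk).
have -> // : upd (upd (upd r c k) P (r P + k)) P (r P + k + size [:: None : letter]) =
  upd (upd r c k) P (r P + k.+1).
by apply: functional_extensionality => v; rewrite /upd /= addn1 addnS; case: eqP.
Qed.

Record reads_target n o r r' : Prop := ReadsTarget {
  rt_occ : occ (r P) (target_word n o);
  rt_pos : r' P = r P + size (target_word n o);
  rt_target : forall t, o = Some t -> r' TGT = t;
  rt_frame : forall v, v \notin [:: P; TGT; J; T] -> r' v = r v
}.

Lemma run_some_target r r' : run parse_some_target r r' ->
  exists2 t, t < r NN & reads_target (r NN) (Some t) r r'.
Proof.
rewrite /parse_some_target => /run_cons[_ /run_clear-> /run_cons[m2 /run_count_letter[//|k1]]].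
lookups; rewrite add0n => H1 E2 /run_cons[m3 /run_match[]].
have [P2 [J2 N2]] : m2 P = r P + k1 /\ m2 J = k1 /\ m2 NN = r NN by rewrite E2; lookups.
rewrite P2 => H2 E3 /run_cons[m4 /run_copy E4].
have {}E4 : m4 = upd (upd m3 TGT (m3 J)) T 0 by apply: E4.
move=> /run_cons[m5 [_ E5] /run_cons[m6 /run_count_letter[//|k2 H3 E6]]].
move=> /run_cons[m7 /run_test_eq H7 ->]; have [//|//|//|EJ E7] := H7.
have [P5 [J5 N5]] : m5 P = r P + k1 + 2 /\ m5 J = k1.+1 /\ m5 NN = r NN.
  by rewrite E5 E4 E3; lookups; rewrite J2 N2 /=.
rewrite P5 in H3.
have Et : r NN = k1.+1 + k2 by move: EJ; rewrite E6; lookups; rewrite J5 N5.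
exists k1; first by rewrite Et ltnS leq_addr.
have Ew : target_word (r NN) (Some k1) =
    nseq k1 None ++ [:: Some true; None] ++ nseq k2 None by rewrite /= Et addKn.
split.
- by rewrite Ew !occ_cat H1 size_nseq H2 H3.
- rewrite Ew !size_cat !size_nseq E7 E6; lookups; rewrite P5 /=; lia.
- by move=> t [<-]; rewrite E7 E6 E5 E4; lookups; rewrite E3; lookups.
- move=> v; rewrite !inE !negb_or => /and4P[*].
  by rewrite E7 E6 E5 E4 E3 E2; lookups.
Qed.

Lemma some_target_run r t : bounded K r -> r P <= size w -> t < r NN ->
  occ (r P) (target_word (r NN) (Some t)) ->
  exists2 r', run parse_some_target r r' & reads_target (r NN) (Some t) r r'.
Proof.
move=> r_lt le_p lt_t Hw; set k2 := r NN - t.+1.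
have Et : r NN = t.+1 + k2 by rewrite subnKC.
have Ew : target_word (r NN) (Some t) =
  nseq t None ++ [:: Some true; None] ++ nseq k2 None by [].
have := Hw; rewrite Ew !occ_cat !size_nseq => /and3P[H1 H2 H3].
have lt_n := r_lt NN.
have le1 := occ_size le_p H1; rewrite size_nseq in le1.
have le2 := occ_size le1 H2.
have H := @count_letter_run None J (upd r J 0) t isT.
set m2 := upd (upd _ _ _) _ _ in H.
have [P2 [J2 N2]] : m2 P = r P + t /\ m2 J = t /\ m2 NN = r NN by rewrite /m2; lookups.
have := @match_run [:: Some true; None] m2; rewrite P2 => /(_ H2 le1).
set m3 := upd m2 P _ => R3.
have [P3 [J3 N3]] : m3 P = r P + t + 2 /\ m3 J = t /\ m3 NN = r NN by rewrite /m3; lookups.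
have R4 := @copy_run _ _ w K T J TGT m3 isT isT isT; set m4 := upd (upd _ _ _) _ _ in R4.
have [P4 [J4 N4]] : m4 P = r P + t + 2 /\ m4 J = t /\ m4 NN = r NN by rewrite /m4; lookups.
pose m5 := upd m4 J (m4 J).+1.
have [P5 [J5 N5]] : m5 P = r P + t + 2 /\ m5 J = t.+1 /\ m5 NN = r NN.
  by rewrite /m5; lookups; rewrite J4.
have := @count_letter_run None J m5 k2 isT; rewrite P5 J5 => /(_ H3 le2).
set m6 := upd (upd _ _ _) _ _ => R6.
have [P6 [J6 N6]] : m6 P = r P + t + 2 + k2 /\ m6 J = r NN /\ m6 NN = r NN.
  by rewrite /m6; lookups; rewrite N5.
have R7 := @test_eq_run _ _ w K T J NN m6 isT isT isT.
exists (upd m6 T 0).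
  exists (upd r J 0); first exact/run_clear.
  exists m2; first by apply: H; lookups; lia.
  exists m3 => //; exists m4; first by apply: R4; rewrite J3; lia.
  exists m5; first by split=> //; rewrite J4; lia.
  exists m6; first by apply: R6; lia.
  by exists (upd m6 T 0) => //; apply: R7; rewrite J6 ?N6.
split=> //.
- by lookups; rewrite P6 /= size_cat /= !size_nseq; lia.
- by move=> _ [<-]; rewrite /m6 /m5 /m4; lookups.
- move=> v; rewrite !inE !negb_or => /and4P[*].
  by rewrite /m6 /m5 /m4 /m3 /m2; lookups.
Qed.

Lemma run_no_target r r' : run parse_no_target r r' -> reads_target (r NN) None r r'.
Proof.
rewrite /parse_no_target => /run_cons[_ /run_clear-> /run_cons[m2 /run_count_letter[//|k]]].
lookups; rewrite add0n => H1 E2 /run_cons[m3 /run_test_eq H3 ->]; have [//|//|//|EJ ->] := H3.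
have Ek : r NN = k by move: EJ; rewrite E2; lookups.
split=> //=; first by rewrite Ek.
- by rewrite size_nseq E2 Ek; lookups.
- move=> v; rewrite !inE !negb_or => /and4P[*].
  by rewrite E2; lookups.
Qed.

Lemma no_target_run r : bounded K r -> r P <= size w -> occ (r P) (target_word (r NN) None) ->
  exists2 r', run parse_no_target r r' & reads_target (r NN) None r r'.
Proof.
move=> r_lt le_p H1; have lt_n := r_lt NN.
have H := @count_letter_run None J (upd r J 0) (r NN) isT.
set m2 := upd (upd _ _ _) _ _ in H.
have [P2 [J2 N2]] : m2 P = r P + r NN /\ m2 J = r NN /\ m2 NN = r NN.
  by rewrite /m2; lookups.
have R3 := @test_eq_run _ _ w K T J NN m2 isT isT isT.
exists (upd m2 T 0).
  exists (upd r J 0); first exact/run_clear.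
  exists m2; first by apply: H; lookups.
  by exists (upd m2 T 0) => //; apply: R3; rewrite J2 ?N2.
split=> //.
- by lookups; rewrite P2 /= size_nseq.
- move=> v; rewrite !inE !negb_or => /and4P[*].
  by rewrite /m2; lookups.
Qed.

Lemma run_count_effect a r r' : run (count_effect a) r r' ->
  [/\ forall x, r' (POS x) = r (POS x) + (a == Some (x, false)),
      forall x, r' (NEG x) = r (NEG x) + (a == Some (x, true)) &
      forall v, ~~ is_carry v -> r' v = r v].
Proof.
case: a => [[y b]|]; last first.
  by move=> ->; split=> *; rewrite /= ?addn0.
move=> [_ ->]; split.
- move=> x; rewrite /upd (inj_eq Some_inj) xpair_eqE; case: b => /=.
    by rewrite andbF addn0.
  rewrite andbT [y == x]eq_sym -[POS x == POS y]/(x == y); case: eqP => [->|_].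
    by rewrite addn1.
  by rewrite addn0.
- move=> x; rewrite /upd (inj_eq Some_inj) xpair_eqE; case: b => /=; last first.
    by rewrite andbF addn0.
  rewrite andbT [y == x]eq_sym -[NEG x == NEG y]/(x == y); case: eqP => [->|_].
    by rewrite addn1.
  by rewrite addn0.
- by move=> v; rewrite /upd; case: eqP => // ->; case: b.
Qed.

Lemma count_effect_run a r :
  (forall x, (r (POS x)).+1 < K /\ (r (NEG x)).+1 < K) -> exists r', run (count_effect a) r r'.
Proof.
case: a => [[x b]|] H; last by exists r.
by exists (upd r (if b then NEG x else POS x) (r (if b then NEG x else POS x)).+1); split=> //;
  case: (H x); case: b.
Qed.

Record reads_transition n c (e : edge Sigma n) r r' : Prop := ReadsTransition {
  rr_occ : occ (r P) (enc_transition (to_transition e));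
  rr_pos : r' P = r P + size (enc_transition (to_transition e));
  rr_source : r' SRC = esrc e;
  rr_target : forall t, etgt e = Some t -> r' TGT = t;
  rr_plus : forall x, r' (POS x) = r (POS x) + (c && (elab e == Some (x, false)));
  rr_minus : forall x, r' (NEG x) = r (NEG x) + (c && (elab e == Some (x, true)));
  rr_frame : forall v, ~~ is_aux v -> ~~ is_carry v -> r' v = r v
}.

Lemma run_parse_effect c r r' : run (parse_effect c) r r' ->
  exists a, [/\ occ (r P) (enc_vector enc_int (small_effect a)),
    r' P = r P + size (enc_vector enc_int (small_effect a)),
    forall x, r' (POS x) = r (POS x) + (c && (a == Some (x, false))),
    forall x, r' (NEG x) = r (NEG x) + (c && (a == Some (x, true))) &
    forall v, ~~ is_carry v -> v != P -> r' v = r v].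
Proof.
rewrite /parse_effect => /run_alts[i [lt_i]]; rewrite size_map in lt_i.
rewrite (nth_map None) //; set a := nth _ _ _.
move=> /run_seq[m /run_match[Hw Em] Hc]; exists a.
have [Ep En Ef] : [/\ forall x, r' (POS x) = m (POS x) + (c && (a == Some (x, false))),
    forall x, r' (NEG x) = m (NEG x) + (c && (a == Some (x, true))) &
    forall v, ~~ is_carry v -> r' v = m v].
  by case: c Hc => [/run_count_effect//|->]; split=> *; rewrite /= ?addn0.
split=> //.
- by rewrite Ef // Em updx.
- by move=> x; rewrite Ep Em; lookups.
- by move=> x; rewrite En Em; lookups.
- by move=> v v1 v2; rewrite Ef // Em updN.
Qed.

Lemma parse_effect_run c a r : r P <= size w ->
  occ (r P) (enc_vector enc_int (small_effect a)) ->
  (forall x, (r (POS x)).+1 < K /\ (r (NEG x)).+1 < K) ->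
  exists r', [/\ run (parse_effect c) r r',
    r' P = r P + size (enc_vector enc_int (small_effect a)),
    forall x, r' (POS x) = r (POS x) + (c && (a == Some (x, false))),
    forall x, r' (NEG x) = r (NEG x) + (c && (a == Some (x, true))) &
    forall v, ~~ is_carry v -> v != P -> r' v = r v].
Proof.
move=> le_p Hw r_lt; set u := enc_vector _ _ in Hw *.
have R1 := match_run Hw le_p; set m := upd r P _ in R1.
have [r' Hr'] : exists r', run (if c then count_effect a else Atom Nop) m r'.
  case: c; last by exists m.
  by apply: count_effect_run => x; rewrite /m; lookups.
have [Ep En Ef] : [/\ forall x, r' (POS x) = m (POS x) + (c && (a == Some (x, false))),
    forall x, r' (NEG x) = m (NEG x) + (c && (a == Some (x, true))) &
    forall v, ~~ is_carry v -> r' v = m v].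
  by case: c Hr' => [/run_count_effect//|->]; split=> *; rewrite /= ?addn0.
exists r'; split.
- rewrite /parse_effect; apply/run_alts; exists (index a (enum {: option (Sigma * bool)})).
  have lt_a : index a (enum {: option (Sigma * bool)}) < size (enum {: option (Sigma * bool)}).
    by rewrite index_mem mem_enum.
  by rewrite size_map; split=> //; rewrite (nth_map None) // nth_index ?mem_enum //; exists m.
- by rewrite Ef // /m updx.
- by move=> x; rewrite Ep /m; lookups.
- by move=> x; rewrite En /m; lookups.
- by move=> v v1 v2; rewrite Ef // /m updN.
Qed.

(** The reader of the target is a parameter: skipping accepts any target, a step of a walk requires
    one, and the final step forbids one. The predicate [good] records which. *)
Lemma run_parse_transition n c tgt (good : pred (option nat)) r r' : r NN = n ->
  (forall r1 r2, run tgt r1 r2 -> exists o, [/\ good o,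
     reads_target (r1 NN) o r1 r2 & oapp (fun t => t < r1 NN) true o]) ->
  run (parse_transition c tgt) r r' ->
  exists e : edge Sigma n, good (omap val (etgt e)) /\ reads_transition c e r r'.
Proof.
move=> En Ht; rewrite /parse_transition.
move=> /run_cons[m1 /run_parse_unary[//|q Hq E1]] /run_cons[m2 /run_test_lt H2].
have [//|//|//|lt_q E2] := H2.
move=> /run_cons[m3 /run_parse_effect[a [Ha P3 Ep En3 Ef]]] /run_cons[m4 /Ht[o [go Ho lt_o]] ->].
have N3 : m3 NN = n by rewrite Ef // E2 E1; lookups.
have lt_q' : q < n by move: lt_q; rewrite E1; lookups; rewrite En.
have [t Et] : exists t : option 'I_n, o = omap val t.
  case: o lt_o {go Ho} => [t|] /= lt_t; last by exists None.
  by rewrite N3 in lt_t; exists (Some (Ordinal lt_t)).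
exists (Ordinal lt_q', a, t); rewrite -Et; split=> //.
have P2 : m2 P = r P + q.+1 by rewrite E2 E1; lookups.
have size_q : size (enc_unary q) = q.+1 by rewrite size_cat size_nseq addn1.
have Ew : enc_transition (to_transition (Ordinal lt_q', a, t)) =
    enc_unary q ++ enc_vector enc_int (small_effect a) ++ target_word n o.
  by rewrite /enc_transition /to_transition /target /= enc_small_target Et.
split.
- rewrite Ew occ_cat Hq size_q -P2 occ_cat Ha -P3 /=.
  by have := rt_occ Ho; rewrite N3.
- by rewrite Ew size_cat size_q size_cat (rt_pos Ho) P3 P2 N3; lia.
- by rewrite (rt_frame Ho) // Ef // E2 E1; lookups.
- by move=> t' Et'; apply: (rt_target Ho); rewrite Et -[t]/(etgt (Ordinal lt_q', a, t)) Et'.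
- by move=> x; rewrite (rt_frame Ho) // Ep E2 E1; lookups.
- by move=> x; rewrite (rt_frame Ho) // En3 E2 E1; lookups.
- move=> v; rewrite /is_aux !inE !negb_or => /and5P[*].
  rewrite (rt_frame Ho) ?inE ?negb_or; last by apply/and4P.
  by rewrite Ef // E2 E1; lookups.
Qed.

Lemma parse_transition_run n c tgt (e : edge Sigma n) r : r NN = n -> bounded K r ->
  r P <= size w -> occ (r P) (enc_transition (to_transition e)) ->
  (forall x, (r (POS x)).+1 < K /\ (r (NEG x)).+1 < K) ->
  (forall r1, bounded K r1 -> r1 P <= size w -> r1 NN = n ->
     occ (r1 P) (target_word n (omap val (etgt e))) ->
     exists2 r2, run tgt r1 r2 & reads_target n (omap val (etgt e)) r1 r2) ->
  exists2 r', run (parse_transition c tgt) r r' & reads_transition c e r r'.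
Proof.
move=> En r_lt le_p Hw r_lt1 Ht.
case: e Hw Ht => [[q a] t] Hw Ht.
have Ew : enc_transition (to_transition (q, a, t)) =
    enc_unary q ++ enc_vector enc_int (small_effect a) ++ target_word n (omap val t).
  by rewrite /enc_transition /to_transition /target /= enc_small_target.
have size_q : size (enc_unary q) = q.+1 by rewrite size_cat size_nseq addn1.
have := Hw; rewrite Ew occ_cat => /andP[Hq]; rewrite occ_cat => /andP[Ha Hto].
have le1 := occ_size le_p Hq; have le2 := occ_size le1 Ha.
rewrite size_q in le1 le2 Ha Hto.
have R1 := @parse_unary_run SRC r q isT Hq le_p; set m1 := upd (upd _ _ _) _ _ in R1.
have m1_lt := run_bounded R1 r_lt.
have [P1 [S1 N1]] : m1 P = r P + q.+1 /\ m1 SRC = q /\ m1 NN = n by rewrite /m1; lookups.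
have R2 := @test_lt_run _ _ w K T SRC NN m1 isT isT isT; rewrite S1 N1 in R2.
have {}R2 := R2 (leq_trans (eq_leq (esym (congr1 S N1))) (m1_lt NN)) (ltn_ord q).
have m2_lt := run_bounded R2 m1_lt; set m2 := upd m1 T 0 in R2 m2_lt.
have P2 : m2 P = r P + q.+1 by rewrite /m2; lookups.
have [|||m3 [R3 P3 Ep En3 Ef]] := @parse_effect_run c a m2; rewrite ?P2 //.
have m3_lt := run_bounded R3 m2_lt.
have N3 : m3 NN = n by rewrite Ef // /m2; lookups.
have [||||m4 R4 Ho] := Ht m3; rewrite ?P3 ?P2 //.
exists m4; first by exists m1 => //; exists m2 => //; exists m3 => //; exists m4.
split=> //.
- by rewrite Ew size_cat size_q size_cat (rt_pos Ho) P3 P2 /=; lia.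
- by rewrite (rt_frame Ho) // Ef // /m2; lookups.
- by move=> t' Et'; apply: (rt_target Ho); rewrite Et'.
- by move=> x; rewrite (rt_frame Ho) // Ep /m2 /m1; lookups.
- by move=> x; rewrite (rt_frame Ho) // En3 /m2 /m1; lookups.
- move=> v; rewrite /is_aux !inE !negb_or => /and5P[*].
  rewrite (rt_frame Ho) ?inE ?negb_or; last by apply/and4P.
  by rewrite Ef // /m2 /m1; lookups.
Qed.

End Membership.

(** * Guessing walks *)

Section Counts.
Variables (Sigma : finType) (n : nat).
Implicit Type Z : seq (edge Sigma n).

Definition npos Z x := count (fun e => elab e == Some (x, false)) Z.
Definition nneg Z x := count (fun e => elab e == Some (x, true)) Z.

Lemma npos_le Z x : npos Z x <= size Z. Proof. exact: count_size. Qed.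
Lemma nneg_le Z x : nneg Z x <= size Z. Proof. exact: count_size. Qed.

Lemma eff_counts Z x : eff Z x = ((npos Z x)%:Z - (nneg Z x)%:Z)%R.
Proof.
rewrite /eff /npos /nneg; elim: Z => [|e Z IH]; first by rewrite big_nil.
rewrite big_cons IH /=; case: (elab e) => [[y b]|] /=; last by lia.
rewrite !(inj_eq Some_inj) !xpair_eqE [x == y]eq_sym.
by case: (y == x); case: b => /=; lia.
Qed.

End Counts.

Section Walking.
Import GRing.Theory Num.Theory Order.TTheory.
Variable Sigma : finType.
Local Notation var := (var Sigma).
Local Notation prog := (prog var letter).
Local Notation P := (P Sigma).
Local Notation NN := (NN Sigma).
Local Notation CUR := (CUR Sigma).
Local Notation SRC := (SRC Sigma).
Local Notation TGT := (TGT Sigma).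
Local Notation J := (J Sigma).
Local Notation DD := (DD Sigma).
Local Notation VV := (VV Sigma).
Local Notation T := (T Sigma).
Implicit Types (r : var -> nat).

(* The transition is guessed by skipping some of those listed; [to_end] ensures
   that it was not read beyond the end [VV] of the list. *)
Definition read_edge tgt : seq prog :=
  [:: copy letter T DD P; Star (skip_transition Sigma); parse_transition true tgt;
      test_eq letter T SRC CUR].
Definition to_end : seq prog := [:: Star (skip_transition Sigma); test_eq letter T P VV].
Definition step_program : prog :=
  seqs (read_edge (parse_some_target Sigma) ++ copy letter T TGT CUR :: to_end).
Definition final_program : prog := seqs (read_edge (parse_no_target Sigma) ++ to_end).
(* Executed between the steps of a walk, so that [BASE x] holds a visited state. *)
Definition set_bases : prog := alts T [seq copy letter T CUR (BASE x) | x <- enum Sigma].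
Definition walk_program : prog := Star (Alt step_program set_bases).
Definition cycle_program x : prog :=
  seqs [:: copy letter T (BASE x) CUR; Star step_program; test_eq letter T CUR (BASE x)].
Definition cycles_program : prog := seqs [seq cycle_program x | x <- enum Sigma].

(** The bit of [v x] is subtracted from the carry, so a positive sign is counted in [NEG] and a
    negative one in [POS]. *)
Definition add_sign x : prog :=
  PSeq (copy letter T (SIGN x) P)
       (Alt (PSeq (match_word Sigma [:: Some false]) (Atom (Inc (NEG x))))
            (PSeq (match_word Sigma [:: Some true]) (Atom (Inc (POS x))))).
(** At the terminator the pointer [BIT x] stays where it is: missing digits are read as 0, for as
    many levels as needed. *)
Definition read_bit x : prog :=
  PSeq (copy letter T (BIT x) P)
       (Alt (match_word Sigma [:: None])
       (Alt (PSeq (match_word Sigma [:: Some false]) (copy letter T P (BIT x)))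
            (PSeq (match_word Sigma [:: Some true])
                  (PSeq (copy letter T P (BIT x)) (add_sign x))))).
(* The carry plus the effects, minus the bit, is halved. The amount cancelled is
   guessed; it keeps the two counters bounded. *)
Definition bit_program x : prog :=
  PSeq (read_bit x)
       (seqs [:: cancel_pair letter (POS x) (NEG x); halve letter T (POS x); halve letter T (NEG x)]).
Definition bits_program : prog := seqs [seq bit_program x | x <- enum Sigma].
Definition level_program : prog := PSeq cycles_program bits_program.
Definition end_one x : prog :=
  seqs [:: copy letter T (BIT x) P; match_word Sigma [:: None]; cancel_pair letter (POS x) (NEG x);
           Atom (Zero (POS x)); Atom (Zero (NEG x))].
Definition end_program : prog := seqs [seq end_one x | x <- enum Sigma].

Variables (w : seq letter) (K : nat).
Hypothesis w_lt : size w < K.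
Local Notation run := (run w K).
Local Notation occ := (occ w).
Variables (n : nat) (es : seq (edge Sigma n)) (dd vv : nat).
Implicit Types (Z W : seq (edge Sigma n)) (q s : 'I_n).

Definition enc_edge (e : edge Sigma n) := enc_transition (to_transition e).
Definition enc_edges Z := flatten (map enc_edge Z).
Hypotheses (occ_es : occ dd (enc_edges es)) (vv_eq : vv = dd + size (enc_edges es)).
Hypothesis dd_le : dd <= size w.

Record env r : Prop := Env { env_n : r NN = n; env_d : r DD = dd; env_v : r VV = vv }.

(** Room for [k] further increments of each carry counter. *)
Definition low_carry k r := forall x, r (POS x) + k < K /\ r (NEG x) + k < K.

Lemma enc_edges_cat Z1 Z2 : enc_edges (Z1 ++ Z2) = enc_edges Z1 ++ enc_edges Z2.
Proof. by rewrite /enc_edges map_cat flatten_cat. Qed.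

Lemma size_cons_edges e Z : size (enc_edges (e :: Z)) = size (enc_edge e) + size (enc_edges Z).
Proof. exact: size_cat. Qed.

Lemma enc_edge_neq0 e : enc_edge e <> [::].
Proof. by rewrite /enc_edge /enc_transition /enc_unary; case: (nat_of_ord _). Qed.

Lemma enc_edges_inj : injective enc_edges.
Proof. by move=> Z1 Z2; apply: flatten_prefix_free; [apply: enc_edge_prefix_free | apply: enc_edge_neq0]. Qed.

Lemma occ_inj p u1 u2 : occ p u1 -> occ p u2 -> size u1 = size u2 -> u1 = u2.
Proof.
move=> /occP E1 /occP E2 Es; have /eqP := etrans (esym E1) E2.
by rewrite eqseq_cat // => /andP[/eqP].
Qed.

Lemma carry_frame (v : var) (R : var -> Prop) : is_carry v ->
  (forall x, R (POS x)) -> (forall x, R (NEG x)) -> R v.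
Proof.
case: v => // -[[[|[|//]] lt_i] x] _ Rp Rn.
  by have := Rp x; congr (R (inr (_, x))); apply: val_inj.
by have := Rn x; congr (R (inr (_, x))); apply: val_inj.
Qed.

Lemma skip_frame e r r' : @reads_transition Sigma w n false e r r' ->
  forall v, ~~ is_aux v -> r' v = r v.
Proof.
move=> He v Hv; case Hc: (is_carry v); last by apply: (rr_frame He); rewrite ?Hc.
apply: (carry_frame (R := fun v => r' v = r v) Hc) => x.
  by rewrite (rr_plus He) addn0.
by rewrite (rr_minus He) addn0.
Qed.

Lemma run_skip_one r r' : r NN = n -> run (skip_transition Sigma) r r' ->
  exists e : edge Sigma n, reads_transition w false e r r'.
Proof.
move=> En Hm; have [|e [_ He]] := run_parse_transition w_lt (good := predT) En _ Hm.
  move=> r1 r2 /run_alt[/(run_some_target w_lt)[t lt_t Ht]|/(run_no_target w_lt) Ht].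
    by exists (Some t).
  by exists None.
by exists e.
Qed.

Lemma skip_one_run (e : edge Sigma n) r : r NN = n -> bounded K r -> r P <= size w ->
  occ (r P) (enc_edge e) -> low_carry 1 r ->
  exists2 r', run (skip_transition Sigma) r r' & reads_transition w false e r r'.
Proof.
move=> En r_lt le_p Hw low; apply: (parse_transition_run w_lt) => //.
  by move=> x; have := low x; rewrite !addn1.
move=> r1 r1_lt le1 E1 H1; case: (etgt e) H1 => [t|] /= H1.
  have [||r2 Hr2 H2] := some_target_run w_lt r1_lt le1 (t := t); rewrite ?E1 //.
  by exists r2; [left | rewrite E1 in H2].
have [|r2 Hr2 H2] := no_target_run w_lt r1_lt le1; rewrite ?E1 //.
by exists r2; [right | rewrite E1 in H2].
Qed.

Lemma run_skip r r' : r NN = n -> run (Star (skip_transition Sigma)) r r' ->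
  exists Z, [/\ occ (r P) (enc_edges Z), r' P = r P + size (enc_edges Z) &
    forall v, ~~ is_aux v -> r' v = r v].
Proof.
move=> En /run_iter H; elim: H En => [{}r|{}r m {}r' Hm _ IH] En.
  by exists [::]; split=> //; rewrite /= ?occ_nil ?addn0.
have [e He] := run_skip_one En Hm; have Hf := skip_frame He.
have Ho : occ (r P) (enc_edge e) := rr_occ He.
have Hp : m P = r P + size (enc_edge e) := rr_pos He.
have [|Z [HZ P' Hf']] := IH; first by rewrite Hf.
exists (e :: Z); split.
- by rewrite [enc_edges _]/= occ_cat Ho -Hp.
- by rewrite P' Hp size_cons_edges addnA.
- by move=> v Hv; rewrite Hf' // Hf //.
Qed.

Lemma skip_run Z r : r NN = n -> bounded K r -> r P <= size w ->
  occ (r P) (enc_edges Z) -> low_carry 1 r ->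
  exists r', [/\ run (Star (skip_transition Sigma)) r r',
    r' P = r P + size (enc_edges Z) & forall v, ~~ is_aux v -> r' v = r v].
Proof.
elim: Z r => [|e Z IH] r En r_lt le_p.
  by exists r; split=> //; [apply: StarRefl | rewrite addn0].
rewrite [enc_edges _]/= occ_cat => /andP[He HZ] low.
have [m Hm Em] := skip_one_run En r_lt le_p He low; have Hf := skip_frame Em.
have [|||||r' [Hr' P' Hf']] := IH m.
- by rewrite Hf.
- exact: run_bounded Hm r_lt.
- by rewrite (rr_pos Em) (occ_size le_p He).
- by rewrite (rr_pos Em).
- by move=> x; rewrite !Hf.
exists r'; split.
- by apply: StarStep Hr'.
- by rewrite P' (rr_pos Em) size_cons_edges addnA.
- by move=> v Hv; rewrite Hf' // Hf //.
Qed.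

Definition is_fixed (v : var) := [&& ~~ is_aux v, ~~ is_carry v & v != CUR].

Record walks Z r r' : Prop := Walks {
  w_plus : forall x, r' (POS x) = r (POS x) + npos Z x;
  w_minus : forall x, r' (NEG x) = r (NEG x) + nneg Z x;
  w_frame : forall v, is_fixed v -> r' v = r v
}.

Lemma walks_trans Z1 Z2 r1 r2 r3 : walks Z1 r1 r2 -> walks Z2 r2 r3 -> walks (Z1 ++ Z2) r1 r3.
Proof.
move=> [p1 m1 f1] [p2 m2 f2]; split=> [x|x|v Hv].
- by rewrite p2 p1 /npos count_cat addnA.
- by rewrite m2 m1 /nneg count_cat addnA.
- by rewrite f2 // f1.
Qed.

Lemma walks_nil r r' : (forall v, is_carry v -> r' v = r v) ->
  (forall v, is_fixed v -> r' v = r v) -> walks [::] r r'.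
Proof. by move=> Hc Hf; split=> [x|x|//]; rewrite addn0 Hc. Qed.

Lemma env_walks Z r r' : env r -> walks Z r r' -> env r'.
Proof. by move=> [En Ed Ev] [_ _ Hf]; split; rewrite Hf. Qed.

(** Lists of transitions are uniquely decodable, so any guessed parse that fills the segment from
    [dd] to [vv] is [es] itself. *)
Lemma split_edges Z1 e Z2 : occ dd (enc_edges Z1) ->
  occ (dd + size (enc_edges Z1)) (enc_edge e) ->
  occ (dd + size (enc_edges Z1) + size (enc_edge e)) (enc_edges Z2) ->
  vv = dd + size (enc_edges Z1) + size (enc_edge e) + size (enc_edges Z2) ->
  es = Z1 ++ e :: Z2.
Proof.
move=> H1 H2 H3 Ev; apply: enc_edges_inj; apply: (@occ_inj dd) => //.
  rewrite enc_edges_cat occ_cat H1 (_ : enc_edges (e :: Z2) = enc_edge e ++ enc_edges Z2) //.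
  by rewrite occ_cat H2 H3.
by rewrite enc_edges_cat size_cat size_cons_edges; move: Ev; rewrite vv_eq; clear; lia.
Qed.

(** At this point [e] is merely something that parses as a transition; that it belongs to [es]
    follows only after [to_end] has parsed the rest up to [VV]. *)
Lemma run_edge tgt (good : pred (option nat)) r r' : env r ->
  (forall r1 r2, run tgt r1 r2 -> exists o, [/\ good o,
     reads_target w (r1 NN) o r1 r2 & oapp (fun t => t < r1 NN) true o]) ->
  run (seqs (read_edge tgt)) r r' ->
  exists Z e, [/\ occ dd (enc_edges Z), occ (dd + size (enc_edges Z)) (enc_edge e),
    r' P = dd + size (enc_edges Z) + size (enc_edge e) /\ r' CUR = r CUR,
    (esrc e = r CUR :> nat) /\ good (omap val (etgt e)) &
    (forall t, etgt e = Some t -> r' TGT = t) /\ walks [:: e] r r'].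
Proof.
rewrite /read_edge => -[En Ed Ev] Ht /run_cons[m1 /run_copy E1] /run_cons[m2 Hs] /run_cons[m3 Hp].
move=> /run_cons[m4 /run_test_eq E4 ->].
have {}E1 := E1 isT isT isT; have {E4}[] := E4 isT isT isT.
have [|Z [HZ P2 F2]] := run_skip _ Hs; first by rewrite E1; lookups.
have N2 : m2 NN = n by rewrite F2 // E1; lookups.
have [e [ge He]] := run_parse_transition w_lt N2 Ht Hp.
have P1 : m1 P = dd by rewrite E1; lookups.
rewrite P1 in HZ P2.
rewrite (rr_source He) (rr_frame He) // F2 // => E3 E4.
have C1 v : ~~ is_aux v -> m1 v = r v.
  rewrite /is_aux !inE !negb_or => /and5P[*]; rewrite E1; lookups.
exists Z, e; split.
- by [].
- by have := rr_occ He; rewrite P2.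
- split; first by rewrite E4 updN // (rr_pos He) P2.
  by rewrite E4 updN // (rr_frame He) // F2 // C1.
- by split=> //; rewrite E3 C1.
- split; first by move=> t Et; rewrite E4 updN // (rr_target He Et).
  split=> [x|x|v /and3P[v1 v2 v3]]; rewrite E4.
  + by rewrite updN // (rr_plus He) F2 // C1 //= addn0.
  + by rewrite updN // (rr_minus He) F2 // C1 //= addn0.
  + have vT : v != T by move: v1; rewrite /is_aux !inE !negb_or => /and5P[].
    by rewrite updN // (rr_frame He) // F2 // C1.
Qed.

Lemma edge_run tgt Z e r : env r -> bounded K r -> low_carry 1 r ->
  occ dd (enc_edges Z) -> occ (dd + size (enc_edges Z)) (enc_edge e) ->
  r CUR = esrc e ->
  (forall r1, bounded K r1 -> r1 P <= size w -> r1 NN = n ->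
     occ (r1 P) (target_word n (omap val (etgt e))) ->
     exists2 r2, run tgt r1 r2 & reads_target w n (omap val (etgt e)) r1 r2) ->
  exists r', [/\ run (seqs (read_edge tgt)) r r',
    r' P = dd + size (enc_edges Z) + size (enc_edge e) /\ r' CUR = r CUR,
    (forall t, etgt e = Some t -> r' TGT = t) & walks [:: e] r r'].
Proof.
move=> [En Ed Ev] r_lt low HZ He Ecur Ht.
have R1 := @copy_run _ _ w K T DD P r isT isT isT (r_lt DD).
set m1 := upd (upd _ _ _) _ _ in R1.
have C1 v : ~~ is_aux v -> m1 v = r v.
  by rewrite /is_aux !inE !negb_or => /and5P[*]; rewrite /m1; lookups.
have P1 : m1 P = dd by rewrite /m1; lookups.
have m1_lt := run_bounded R1 r_lt.
have [|||||m2 [R2 P2 F2]] := @skip_run Z m1; rewrite ?P1 ?C1 //.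
rewrite P1 in P2.
have m2_lt := run_bounded R2 m1_lt.
have N2 : m2 NN = n by rewrite F2 // C1.
have le2 : m2 P <= size w by rewrite P2 (occ_size dd_le HZ).
have [||m3 R3 H3] := parse_transition_run w_lt true N2 m2_lt le2 _ _ Ht.
- by rewrite P2.
- by move=> x; rewrite !F2 // !C1 //; have := low x; rewrite !addn1.
have m3_lt := run_bounded R3 m2_lt.
have F3 v : ~~ is_aux v -> ~~ is_carry v -> m3 v = r v.
  by move=> v1 v2; rewrite (rr_frame H3) // F2 // C1.
have R4 := @test_eq_run _ _ w K T SRC CUR m3 isT isT isT (m3_lt SRC).
rewrite (rr_source H3) F3 // in R4; have {}R4 := R4 (esym Ecur).
exists (upd m3 T 0); split.
- by exists m1 => //; exists m2 => //; exists m3 => //; exists (upd m3 T 0).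
- by rewrite !updN // (rr_pos H3) P2 F3.
- by move=> t Et; rewrite updN // (rr_target H3 Et).
- split=> [x|x|v /and3P[v1 v2 v3]].
  + by rewrite updN // (rr_plus H3) F2 // C1 //= addn0.
  + by rewrite updN // (rr_minus H3) F2 // C1 //= addn0.
  + have vT : v != T by move: v1; rewrite /is_aux !inE !negb_or => /and5P[].
    by rewrite updN // F3.
Qed.

Lemma fixedP (v : var) : is_fixed v -> [/\ v != P, v != T, v != CUR & ~~ is_aux v].
Proof.
move=> /and3P[Ha Hc vC]; split=> //;
  by move: Ha; rewrite /is_aux !inE !negb_or => /and5P[].
Qed.

Lemma run_to_end r r' Z e : env r -> occ dd (enc_edges Z) ->
  occ (dd + size (enc_edges Z)) (enc_edge e) ->
  r P = dd + size (enc_edges Z) + size (enc_edge e) -> run (seqs to_end) r r' ->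
  e \in es /\ forall v, ~~ is_aux v -> r' v = r v.
Proof.
move=> [En Ed Ev] HZ He EP; rewrite /to_end => /run_cons[m1 Hs /run_cons[m2 /run_test_eq H2 ->]].
have [Z2 [HZ2 P1 F1]] := run_skip En Hs; have {H2}[] := H2 isT isT isT.
rewrite EP in HZ2 P1; rewrite P1 F1 // Ev => E ->; split.
  by rewrite (split_edges HZ He HZ2) // mem_cat inE eqxx orbT.
move=> v Hv; rewrite updN ?F1 //.
by move: Hv; rewrite /is_aux !inE !negb_or => /and5P[].
Qed.

Lemma to_end_run r Z e Z2 : es = Z ++ e :: Z2 -> env r -> bounded K r -> low_carry 1 r ->
  r P = dd + size (enc_edges Z) + size (enc_edge e) ->
  exists2 r', run (seqs to_end) r r' & forall v, ~~ is_aux v -> r' v = r v.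
Proof.
move=> Ees [En Ed Ev] r_lt low EP.
have Ew : enc_edges es = enc_edges Z ++ enc_edge e ++ enc_edges Z2.
  by rewrite Ees enc_edges_cat.
have := occ_es; rewrite Ew occ_cat => /andP[HZ]; rewrite occ_cat => /andP[He HZ2].
have le1 := occ_size (occ_size dd_le HZ) He.
rewrite -EP in HZ2 le1.
have [r' [R1 P1 F1]] := skip_run En r_lt le1 HZ2 low.
have R2 := @test_eq_run _ _ w K T P VV r' isT isT isT (run_bounded R1 r_lt P).
rewrite P1 F1 // EP Ev vv_eq Ew size_cat [size (enc_edge e ++ _)]size_cat !addnA in R2.
exists (upd r' T 0); first by exists r' => //; exists (upd r' T 0) => //; apply: R2.
move=> v Hv; rewrite updN ?F1 //.
by move: Hv; rewrite /is_aux !inE !negb_or => /and5P[].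
Qed.

Lemma carry_aux (v : var) : is_carry v -> ~~ is_aux v.
Proof. by case: v. Qed.

Lemma run_step r r' : env r -> run step_program r r' ->
  exists e t, [/\ e \in es, esrc e = r CUR :> nat, etgt e = Some t, r' CUR = t
    & walks [:: e] r r'].
Proof.
move=> Hr /run_cat[m1 /(run_edge (good := fun o => o) Hr)].
case=> [r1 r2 /(run_some_target w_lt)[t lt_t Ht]|Z [e [HZ He [P1 C1] [Es gt] [Ht Hw]]]].
  by exists (Some t).
move=> /run_cons[m2 /run_copy E2]; have {}E2 := E2 isT isT isT.
case Et: (etgt e) gt => [t|] // _ He2.
have env1 := env_walks Hr Hw.
have env2 : env m2 by rewrite E2; case: env1 => *; split; lookups.
have [|ees F2] := run_to_end env2 HZ He _ He2; first by rewrite E2; lookups.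
exists e, t; split=> //; first by rewrite F2 // E2; lookups; apply: Ht.
rewrite -[[:: e]]cats0; apply: walks_trans Hw _; apply: walks_nil => v Hv.
  by rewrite F2 ?carry_aux // E2 !updN //; case: v Hv.
by have [vP vT vC vA] := fixedP Hv; rewrite F2 // E2; lookups.
Qed.

Lemma step_run e t r : env r -> bounded K r -> low_carry 2 r -> e \in es ->
  r CUR = esrc e -> etgt e = Some t ->
  exists r', [/\ run step_program r r', r' CUR = t & walks [:: e] r r'].
Proof.
move=> Hr r_lt low ees Ecur Et; case/splitPr Ees: _ / ees => [Z Z2].
have Ew : enc_edges es = enc_edges Z ++ enc_edge e ++ enc_edges Z2.
  by rewrite Ees enc_edges_cat.
have := occ_es; rewrite Ew occ_cat => /andP[HZ]; rewrite occ_cat => /andP[He HZ2].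
have low1 : low_carry 1 r by move=> x; have := low x; clear; lia.
have [|m1 [R1 [P1 C1] Ht Hw]] := edge_run (tgt := parse_some_target Sigma) Hr r_lt low1 HZ He Ecur.
  move=> r1 r1_lt le1 E1; rewrite Et => H1.
  by have := some_target_run w_lt r1_lt le1 (t := t); rewrite E1; apply.
have m1_lt := run_bounded R1 r_lt.
have R2 := @copy_run _ _ w K T TGT CUR m1 isT isT isT (m1_lt TGT).
rewrite (Ht t Et) in R2; set m2 := upd (upd _ _ _) _ _ in R2.
have m2_lt := run_bounded R2 m1_lt.
have env1 := env_walks Hr Hw.
have env2 : env m2 by rewrite /m2; case: env1 => *; split; lookups.
have [||r' R3 F3] := to_end_run Ees env2 m2_lt.
- move=> x; rewrite /m2; lookups; rewrite (w_plus Hw) (w_minus Hw); have := low x.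
  by rewrite /npos /nneg /=; do ![case: (_ == _)]; rewrite /=; clear; lia.
- by rewrite /m2; lookups.
exists r'; split; first by apply/run_cat; exists m1 => //; exists m2.
  by rewrite F3 // /m2; lookups.
rewrite -[[:: e]]cats0; apply: walks_trans Hw _; apply: walks_nil => v Hv.
  by rewrite F3 ?carry_aux // /m2 !updN //; case: v Hv.
by have [vP vT vC vA] := fixedP Hv; rewrite F3 // /m2; lookups.
Qed.

Lemma run_final r r' : env r -> run final_program r r' ->
  exists e, [/\ e \in es, esrc e = r CUR :> nat, etgt e = None & walks [:: e] r r'].
Proof.
move=> Hr /run_cat[m1 /(run_edge (good := fun o => ~~ o) Hr)].
case=> [r1 r2 /(run_no_target w_lt) Ht|Z [e [HZ He [P1 C1] [Es gt] [Ht Hw]]] He2].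
  by exists None.
case Et: (etgt e) gt => [t|] // _.
have [ees F2] := run_to_end (env_walks Hr Hw) HZ He P1 He2.
exists e; split=> //.
rewrite -[[:: e]]cats0; apply: walks_trans Hw _; apply: walks_nil => v Hv.
  by rewrite F2 ?carry_aux.
by have [vP vT vC vA] := fixedP Hv; rewrite F2.
Qed.

Lemma final_run e r : env r -> bounded K r -> low_carry 2 r -> e \in es ->
  r CUR = esrc e -> etgt e = None ->
  exists2 r', run final_program r r' & walks [:: e] r r'.
Proof.
move=> Hr r_lt low ees Ecur Et; case/splitPr Ees: _ / ees => [Z Z2].
have Ew : enc_edges es = enc_edges Z ++ enc_edge e ++ enc_edges Z2.
  by rewrite Ees enc_edges_cat.
have := occ_es; rewrite Ew occ_cat => /andP[HZ]; rewrite occ_cat => /andP[He HZ2].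
have low1 : low_carry 1 r by move=> x; have := low x; clear; lia.
have [|m1 [R1 [P1 C1] Ht Hw]] := edge_run (tgt := parse_no_target Sigma) Hr r_lt low1 HZ He Ecur.
  move=> r1 r1_lt le1 E1; rewrite Et => H1.
  by have := no_target_run w_lt r1_lt le1; rewrite E1; apply.
have m1_lt := run_bounded R1 r_lt.
have [|r' R3 F3] := to_end_run Ees (env_walks Hr Hw) m1_lt _ P1.
  move=> x; rewrite (w_plus Hw) (w_minus Hw); have := low x.
  by rewrite /npos /nneg /=; do ![case: (_ == _)]; rewrite /=; clear; lia.
exists r'; first by apply/run_cat; exists m1.
rewrite -[[:: e]]cats0; apply: walks_trans Hw _; apply: walks_nil => v Hv.
  by rewrite F3 ?carry_aux.
by have [vP vT vC vA] := fixedP Hv; rewrite F3.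
Qed.

Lemma run_steps r r' q : env r -> r CUR = q -> run (Star step_program) r r' ->
  exists Z s, [/\ {subset Z <= es}, gwalk (Some q) Z (Some s), r' CUR = s & walks Z r r'].
Proof.
move=> Hr Eq /run_iter H; elim: H q Hr Eq => [{}r|{}r m {}r' Hm _ IH] q Hr Eq.
  by exists [::], q; split=> //; [apply: eqxx | apply: walks_nil].
have [e [t [ees Es Et Ec Hw]]] := run_step Hr Hm.
have [Z [s [Zes HZ Er' Hw']]] := IH t (env_walks Hr Hw) Ec.
exists (e :: Z), s; split=> //.
- by move=> e'; rewrite inE => /orP[/eqP->|/Zes].
- rewrite /gwalk /= Et; apply/andP; split=> //.
  by apply/eqP; congr Some; apply: val_inj; rewrite /= Es.
- exact: (walks_trans Hw Hw').
Qed.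

Lemma steps_run Z q s r : env r -> bounded K r -> low_carry (size Z).+1 r -> {subset Z <= es} ->
  r CUR = q -> gwalk (Some q) Z (Some s) ->
  exists r', [/\ run (Star step_program) r r', r' CUR = s & walks Z r r'].
Proof.
elim: Z q r => [|e Z IH] q r Hr r_lt low Zes Eq /=.
  move=> /eqP[<-]; exists r; split=> //; [exact: StarRefl | exact: walks_nil].
move=> /andP[/eqP[Es]]; case Et: (etgt e) => [t|] HZ; last by case: (Z) HZ.
have low2 : low_carry 2 r by move=> x; have := low x; rewrite /=; clear; lia.
have [m [Hm Ec Hw]] := step_run Hr r_lt low2 (Zes e (mem_head _ _)) (etrans Eq (congr1 val (esym Es))) Et.
have [||r' [Hr' Ec' Hw']] := IH t m (env_walks Hr Hw) (run_bounded Hm r_lt) _ _ Ec HZ.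
- move=> x; rewrite (w_plus Hw) (w_minus Hw); have := low x.
  by rewrite /npos /nneg /=; do ![case: (_ == _)]; rewrite /=; clear; lia.
- by move=> e' e'Z; apply: Zes; rewrite inE e'Z orbT.
exists r'; split=> //; first exact: StarStep Hm Hr'.
exact: (walks_trans Hw Hw').
Qed.

Definition is_base (v : var) := if v is inr (i, _) then i == 2 :> nat else false.

Record base_walks W r r' : Prop := BaseWalks {
  bw_plus : forall x, r' (POS x) = r (POS x) + npos W x;
  bw_minus : forall x, r' (NEG x) = r (NEG x) + nneg W x;
  bw_frame : forall v, is_fixed v -> ~~ is_base v -> r' v = r v
}.

Lemma base_walks_trans Z1 Z2 r1 r2 r3 :
  base_walks Z1 r1 r2 -> base_walks Z2 r2 r3 -> base_walks (Z1 ++ Z2) r1 r3.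
Proof.
move=> [p1 m1 f1] [p2 m2 f2]; split=> [x|x|v Hv Hb].
- by rewrite p2 p1 /npos count_cat addnA.
- by rewrite m2 m1 /nneg count_cat addnA.
- by rewrite f2 // f1.
Qed.

Lemma walks_base Z r r' : walks Z r r' -> base_walks Z r r'.
Proof. by move=> [p m f]; split=> // v Hv _; apply: f. Qed.

Lemma env_base Z r r' : env r -> base_walks Z r r' -> env r'.
Proof. by move=> [En Ed Ev] [_ _ Hf]; split; rewrite Hf. Qed.

Lemma base_neq (x y : Sigma) : x != y -> BASE x != BASE y.
Proof. by apply: contra => /eqP[->]. Qed.

Lemma run_set_base x r r' : run (copy letter T CUR (BASE x)) r r' ->
  [/\ forall v, ~~ is_base v -> v != T -> r' v = r v, r' (BASE x) = r CUR &
      forall y, y != x -> r' (BASE y) = r (BASE y)].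
Proof.
move=> /run_copy H; have -> := H isT isT isT; split.
- by move=> v vB vT; rewrite !updN //; apply: contra vB => /eqP->.
- by lookups.
- by move=> y yx; rewrite updN // updN // base_neq.
Qed.

Lemma run_walk r r' q : env r -> r CUR = q -> run walk_program r r' ->
  exists W s, [/\ {subset W <= es}, gwalk (Some q) W (Some s), r' CUR = s,
    base_walks W r r' &
    forall x, r' (BASE x) = r (BASE x) \/
      exists2 b : 'I_n, b \in s :: map esrc W & r' (BASE x) = b].
Proof.
move=> Hr Eq /run_iter H; elim: H q Hr Eq => [{}r|{}r m {}r' Hm _ IH] q Hr Eq.
  exists [::], q; split=> //; [exact: eqxx | exact/walks_base/walks_nil | by left].
case/run_alt: Hm => [Hm|/run_alts[i [lt_i]]].
  have [e [t [ees Es Et Ec Hw]]] := run_step Hr Hm.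
  have [Z [s [Zes HZ Er' Hw' HB]]] := IH t (env_walks Hr Hw) Ec.
  exists (e :: Z), s; split=> //.
  - by move=> e'; rewrite inE => /orP[/eqP->|/Zes].
  - rewrite /gwalk /= Et; apply/andP; split=> //.
    by apply/eqP; congr Some; apply: val_inj; rewrite /= Es.
  - exact: (base_walks_trans (walks_base Hw) Hw').
  - move=> x; case: (HB x) => [->|[b Hb ->]]; first by left; rewrite (w_frame Hw).
    right; exists b => //; move: Hb; rewrite /= !inE => /orP[->//|->].
    by rewrite !orbT.
rewrite size_map in lt_i.
case: (enum Sigma) lt_i => // x0 xs lt_i.
rewrite (nth_map x0) // => /run_set_base[F1 B1 B2]; set x1 := nth _ _ _ in B1 B2.
have Hm : base_walks [::] r m.
  split=> [x|x|v Hv Hb]; rewrite ?addn0 F1 //.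
  by have [] := fixedP Hv.
have Ec : m CUR = q by rewrite F1.
have [Z [s [Zes HZ Er' Hw' HB]]] := IH q (env_base Hr Hm) Ec.
exists Z, s; split=> //.
  by have := base_walks_trans Hm Hw'.
move=> x; case: (HB x) => [->|]; last by right.
have [->|xx1] := eqVneq x x1; last by left; apply: B2.
right; exists q; last by rewrite B1.
(* The base was set at the present state [q], which is the last state if no step follows and the
   source of the next step otherwise. *)
case: (Z) HZ => [/eqP[->]|e Z' /= /andP[/eqP[->] _]]; first exact: mem_head.
by rewrite !inE eqxx orbT.
Qed.

Lemma set_bases_run (xs : seq Sigma) r : bounded K r ->
  exists r', [/\ run walk_program r r', forall v, ~~ is_base v -> v != T -> r' v = r v &
    forall x, r' (BASE x) = if x \in xs then r CUR else r (BASE x)].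
Proof.
elim: xs r => [|x xs IH] r r_lt; first by exists r; split=> //; apply: StarRefl.
have R1 := @copy_run _ _ w K T CUR (BASE x) r isT isT isT (r_lt CUR).
have [F1 B1 B2] := run_set_base R1; set m := upd _ _ _ in R1 F1 B1 B2.
have [r' [R2 F2 B3]] := IH m (run_bounded R1 r_lt).
exists r'; split.
- apply: StarStep R2; right; apply/run_alts; exists (index x (enum Sigma)).
  have lt_i : index x (enum Sigma) < size (enum Sigma) by rewrite index_mem mem_enum.
  rewrite size_map; split=> //; rewrite (nth_map x) // (nth_index x (s := enum Sigma)) ?mem_enum //; exact: R1.
- by move=> v v1 v2; rewrite F2 // F1.
- move=> y; rewrite B3 inE F1 //; case: (y =P x) => [->|/eqP yx] /=.
    by rewrite B1; case: ifP.
  by rewrite B2.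
Qed.

(** On arriving at a state, all bases [b x] equal to it are set before the next step is taken. For
    the induction, the claim also says that bases not met keep their value. *)
Lemma walk_run W q s r (b : Sigma -> 'I_n) : env r -> bounded K r ->
  low_carry (size W).+1 r -> {subset W <= es} -> r CUR = q -> gwalk (Some q) W (Some s) ->
  exists r', [/\ run walk_program r r', r' CUR = s, base_walks W r r' &
    forall x, b x \in s :: map esrc W -> r' (BASE x) = b x].
Proof.
move=> Hr r_lt low Wes Eq HW.
suff [r' [H1 H2 H3 H4]] : exists r', [/\ run walk_program r r', r' CUR = s, base_walks W r r' &
    forall x, r' (BASE x) = if b x \in s :: map esrc W then b x : nat else r (BASE x)].
  by exists r'; split=> // x Hx; rewrite H4 Hx.
elim: W q r Hr r_lt low Wes Eq HW => [|e W IH] q r Hr r_lt low Wes Eq HW;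
  have [m [R1 F1 B1]] := set_bases_run [seq x <- enum Sigma | b x == q] r_lt;
  have {}B1 x : m (BASE x) = if b x == q then b x : nat else r (BASE x) by
    [rewrite B1 mem_filter mem_enum andbT Eq; case: eqP => // ->];
  have Hm : base_walks [::] r m by
    [split=> [x|x|v Hv Hb]; rewrite ?addn0 F1 //; have [] := fixedP Hv].
  move: HW => /eqP[<-]; exists m; split=> //; first by rewrite F1.
  by move=> x; rewrite inE B1.
move: HW => /= /andP[/eqP[Es]]; case Et: (etgt e) => [t|] HW; last by case: (W) HW.
have m_lt := run_bounded R1 r_lt.
have low2 : low_carry 2 m by move=> x; have := low x; rewrite /= !F1 //; clear; lia.
have Ec : m CUR = esrc e by rewrite F1 // Eq Es.
have [m2 [R2 Ec2 Hw2]] := step_run (env_base Hr Hm) m_lt low2 (Wes e (mem_head _ _)) Ec Et.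
have env2 := env_walks (env_base Hr Hm) Hw2.
have [||r' [R3 Ec3 Hw3 HB]] := IH t m2 env2 (run_bounded R2 m_lt) _ _ Ec2 HW.
- move=> x; rewrite (w_plus Hw2) (w_minus Hw2) !F1 //; have := low x.
  by rewrite /npos /nneg /=; do ![case: (_ == _)]; rewrite /=; clear; lia.
- by move=> e' e'W; apply: Wes; rewrite inE e'W orbT.
exists r'; split=> //.
- by apply: star_trans R1 _; apply: StarStep R3; left.
- exact: (base_walks_trans Hm (base_walks_trans (walks_base Hw2) Hw3)).
- move=> x; rewrite HB (w_frame Hw2) // B1 /= !inE Es.
  by case: (b x == s); case: (b x == q); case: (_ \in _).
Qed.

Definition is_cycle (b : Sigma -> 'I_n) Z :=
  {subset Z <= es} /\ exists x, gwalk (Some (b x)) Z (Some (b x)).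

Lemma run_cycle (b : Sigma -> 'I_n) x r r' : env r -> r (BASE x) = b x ->
  run (cycle_program x) r r' -> exists2 Z, is_cycle b Z & walks Z r r'.
Proof.
rewrite /cycle_program => Hr Eb /run_cons[m1 /run_copy E1 /run_cons[m2 Hs /run_cons[m3]]].
move=> /run_test_eq H3 ->; have {}E1 := E1 isT isT isT; have [Ec ->] := H3 isT isT isT.
have H1 : walks [::] r m1.
  apply: walks_nil => v Hv; rewrite E1; first by lookups; case: v Hv.
  by have [vP vT vC vA] := fixedP Hv; lookups.
have [|Z [s [Zes HZ Er' Hw]]] := run_steps (q := b x) (env_walks Hr H1) _ Hs.
  by rewrite E1; lookups.
have Es : s = b x.
  apply: val_inj; rewrite /= -Er' Ec (w_frame Hw) // E1; lookups.
exists Z; first by split=> //; exists x; rewrite -{2}Es.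
rewrite -[Z]cats0; apply: walks_trans (walks_trans H1 Hw) _.
apply: walks_nil => v Hv; first by rewrite updN //; case: v Hv.
by have [vP vT vC vA] := fixedP Hv; lookups.
Qed.

Lemma cycle_run (b : 'I_n) x Z r : env r -> bounded K r -> low_carry (size Z).+1 r ->
  {subset Z <= es} -> r (BASE x) = b -> gwalk (Some b) Z (Some b) ->
  exists2 r', run (cycle_program x) r r' & walks Z r r'.
Proof.
move=> Hr r_lt low Zes Eb HZ.
have R1 := @copy_run _ _ w K T (BASE x) CUR r isT isT isT (r_lt _).
set m1 := upd (upd _ _ _) _ _ in R1; have m1_lt := run_bounded R1 r_lt.
have H1 : walks [::] r m1.
  apply: walks_nil => v Hv; rewrite /m1; first by lookups; case: v Hv.
  by have [vP vT vC vA] := fixedP Hv; lookups.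
have [||m2 [R2 Ec Hw]] := steps_run (env_walks Hr H1) m1_lt _ Zes _ HZ.
- by move=> y; rewrite (w_plus H1) (w_minus H1) !addn0; apply: low.
- by rewrite /m1; lookups.
have R3 := @test_eq_run _ _ w K T CUR (BASE x) m2 isT isT isT (run_bounded R2 m1_lt CUR).
exists (upd m2 T 0).
  exists m1 => //; exists m2 => //; exists (upd m2 T 0) => //; apply: R3.
  by rewrite Ec (w_frame Hw) // (w_frame H1) // Eb.
rewrite -[Z]cats0; apply: walks_trans (walks_trans H1 Hw) _.
apply: walks_nil => v Hv; first by rewrite updN //; case: v Hv.
by have [vP vT vC vA] := fixedP Hv; lookups.
Qed.

Lemma run_cycles (b : Sigma -> 'I_n) xs r r' : env r -> (forall x, r (BASE x) = b x) ->
  run (seqs [seq cycle_program x | x <- xs]) r r' ->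
  exists2 Zs, (forall Z, Z \in Zs -> is_cycle b Z) & walks (flatten Zs) r r'.
Proof.
elim: xs r => [|x xs IH] r Hr Eb.
  by move=> ->; exists [::] => //; apply: walks_nil.
move=> /run_cons[m /(run_cycle Hr (Eb x))[Z HZ Hw]] /IH[||Zs HZs Hw'].
- exact: env_walks Hr Hw.
- by move=> y; rewrite (w_frame Hw).
exists (Z :: Zs); last exact: (walks_trans Hw Hw').
by move=> Z'; rewrite inE => /orP[/eqP->|/HZs].
Qed.

Lemma cycles_run (b : Sigma -> 'I_n) (C : Sigma -> seq (edge Sigma n)) xs r :
  env r -> bounded K r ->
  low_carry (size (flatten (map C xs))).+1 r -> (forall x, r (BASE x) = b x) ->
  (forall x, {subset C x <= es}) -> (forall x, gwalk (Some (b x)) (C x) (Some (b x))) ->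
  exists2 r', run (seqs [seq cycle_program x | x <- xs]) r r' & walks (flatten (map C xs)) r r'.
Proof.
move=> + + + + Ces HC; elim: xs r => [|x xs IH] r Hr r_lt low Eb.
  by exists r => //; apply: walks_nil.
have low1 : low_carry (size (C x)).+1 r.
  by move=> y; have := low y; rewrite /= size_cat; clear; lia.
have [m Hm Hw] := cycle_run Hr r_lt low1 (@Ces x) (Eb x) (HC x).
have [||||r' Hr' Hw'] := IH m.
- exact: env_walks Hr Hw.
- exact: run_bounded Hm r_lt.
- move=> y; rewrite (w_plus Hw) (w_minus Hw); have := low y; rewrite /= size_cat.
  have arith a p c f k : p <= c -> a + (c + f).+1 < k -> a + p + f.+1 < k by lia.
  by move=> [h1 h2]; split; [apply: arith h1 | apply: arith h2]; [apply: npos_le | apply: nneg_le].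
- by move=> y; rewrite (w_frame Hw).
exists r'; first by exists m.
exact: (walks_trans Hw Hw').
Qed.

End Walking.

(** * Binary digits *)

Section Levels.
Import GRing.Theory Num.Theory Order.TTheory.
Variable Sigma : finType.
Local Notation var := (var Sigma).
Local Notation P := (P Sigma).
Local Notation T := (T Sigma).
Variables (w : seq letter) (K : nat).
Hypothesis w_lt : size w < K.
Local Notation run := (run w K).
Local Notation occ := (occ w).
Local Notation low_carry := (low_carry K).
Implicit Types (r : var -> nat) (xs : seq Sigma) (x y : Sigma).

Definition stored p (bs : seq bool) := occ p (map Some bs ++ [:: None]) && (p <= size w).
Definition signed (sg : bool) (k : nat) : int := (if sg then - k%:Z else k%:Z)%R.
Definition carry r x : int := ((r (POS x))%:Z - (r (NEG x))%:Z)%R.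

Definition is_bit_aux x v := v \in [:: P; T; POS x; NEG x; BIT x].

Lemma stored_cons p b bs : stored p (b :: bs) -> occ p [:: Some b] /\ stored p.+1 bs.
Proof.
rewrite /stored -cat1s map_cat -catA occ_cat addn1 => /andP[/andP[Hb ->] le_p]; split=> //.
by have := occ_size le_p Hb; rewrite addn1 => ->.
Qed.

Lemma stored_nil p : stored p [::] -> occ p [:: None].
Proof. by case/andP. Qed.

Lemma occ1_inj p l l' : occ p [:: l] -> occ p [:: l'] -> l = l'.
Proof. by rewrite !occ_cons => /andP[/eqP E _] /andP[/eqP E' _]; move: E'; rewrite E => -[]. Qed.

Lemma run_add_sign x sg r r' : occ (r (SIGN x)) [:: Some sg] -> run (add_sign x) r r' ->
  r' = upd (upd (upd r T 0) P (r (SIGN x)).+1) (if sg then POS x else NEG x)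
          (r (if sg then POS x else NEG x)).+1.
Proof.
move=> Hs /run_seq[m1 /run_copy E1]; have {}E1 := E1 isT isT isT.
have P1 : m1 P = r (SIGN x) by rewrite E1; lookups.
case/run_alt=> /run_seq[m2 /run_match[H2 E2] [_ ->]]; rewrite P1 in H2 E2.
- have [->] := occ1_inj Hs H2; rewrite /= E2 E1 addn1.
  apply: functional_extensionality => v; rewrite /upd.
  by repeat (case: eqP => [?|?] //; subst => //).
- have [->] := occ1_inj Hs H2; rewrite /= E2 E1 addn1.
  apply: functional_extensionality => v; rewrite /upd.
  by repeat (case: eqP => [?|?] //; subst => //).
Qed.

Lemma add_sign_run x sg r : bounded K r -> low_carry 1 r -> r (SIGN x) <= size w ->
  occ (r (SIGN x)) [:: Some sg] ->
  exists r', run (add_sign x) r r'.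
Proof.
move=> r_lt low le_p Hs.
have R1 := @copy_run _ _ w K T (SIGN x) P r isT isT isT (r_lt _).
set m := upd (upd _ _ _) _ _ in R1.
have Pm : m P = r (SIGN x) by rewrite /m; lookups.
have R2 := @match_run Sigma w K w_lt [:: Some sg] m; rewrite Pm in R2.
have {}R2 := R2 Hs le_p; set m2 := upd _ _ _ in R2.
exists (upd m2 (if sg then POS x else NEG x) (m2 (if sg then POS x else NEG x)).+1).
exists m => //; have [l1 l2] := low x; rewrite !addn1 in l1 l2.
case: sg Hs @m2 R2 => Hs m2 R2; [right|left]; exists m2 => //; split=> //.
Qed.

Lemma run_read_bit x sg bs r r' : stored (r (BIT x)) bs -> occ (r (SIGN x)) [:: Some sg] ->
  run (read_bit x) r r' ->
  [/\ stored (r' (BIT x)) (behead bs),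
    carry r' x = (carry r x - signed sg (head false bs))%R,
    r' (POS x) <= (r (POS x)).+1, r' (NEG x) <= (r (NEG x)).+1 &
    forall v, ~~ is_bit_aux x v -> r' v = r v].
Proof.
move=> Hb Hs /run_seq[m1 /run_copy E1]; have {}E1 := E1 isT isT isT.
have P1 : m1 P = r (BIT x) by rewrite E1; lookups.
have F1 v : v != P -> v != T -> m1 v = r v by move=> *; rewrite E1; lookups.
have aux v : ~~ is_bit_aux x v -> [/\ v != P, v != T, v != POS x, v != NEG x & v != BIT x].
  by rewrite /is_bit_aux !inE !negb_or => /and5P[].
case/run_alt=> [/run_match[H2 ->]|/run_alt[]].
- rewrite P1 in H2; case: bs Hb => [|b bs] Hb; last first.
    by have [Hb1 _] := stored_cons Hb; have := occ1_inj Hb1 H2.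
  split=> /=; try by rewrite updN // F1.
  + by rewrite /carry !updN // !F1 // /signed; case: (sg); rewrite ?oppr0 subr0.
  + by move=> v /aux[*]; rewrite updN // F1.
- move=> /run_seq[m2 /run_match[H2 E2] /run_copy E3]; have -> := E3 isT isT isT.
  rewrite P1 in H2 E2; case: bs Hb => [|b bs] Hb; first by have := occ1_inj (stored_nil Hb) H2.
  have [Hb1 Hb2] := stored_cons Hb; have [Eb] := occ1_inj Hb1 H2; rewrite Eb.
  have F2 v : v != P -> v != T -> v != BIT x -> upd (upd m2 (BIT x) (m2 P)) T 0 v = r v.
    by move=> *; rewrite !updN // E2 updN // F1.
  split=> /=; try by rewrite F2.
  + by lookups; rewrite E2 updx addn1.
  + by rewrite /carry !F2 // /signed; case: (sg); rewrite ?oppr0 subr0 //.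
  + by move=> v /aux[*]; rewrite F2.
- move=> /run_seq[m2 /run_match[H2 E2] /run_seq[m3 /run_copy E3 H4]].
  have {}E3 := E3 isT isT isT.
  rewrite P1 in H2 E2; case: bs Hb => [|b bs] Hb; first by have := occ1_inj (stored_nil Hb) H2.
  have [Hb1 Hb2] := stored_cons Hb; have [Eb] := occ1_inj Hb1 H2; rewrite Eb.
  have F3 v : v != P -> v != T -> v != BIT x -> m3 v = r v.
    by move=> *; rewrite E3 !updN // E2 updN // F1.
  have Hs3 : occ (m3 (SIGN x)) [:: Some sg] by rewrite F3.
  have -> := run_add_sign Hs3 H4; split=> /=.
  + by rewrite updN; [rewrite !updN // E3; lookups; rewrite E2 updx addn1 | case: (sg)].
  + rewrite /carry /signed; case: (sg) => /=.
      by rewrite updx updN // updN // updN // !F3 //; lia.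
    by rewrite updx updN // updN // updN // !F3 //; lia.
  + by case: (sg); rewrite ?updx ?updN // F3.
  + by case: (sg); rewrite ?updx ?updN // F3.
  + by move=> v /aux[*]; case: (sg); rewrite !updN // F3.
Qed.

Lemma read_bit_run x sg bs r : bounded K r -> low_carry 1 r -> stored (r (BIT x)) bs ->
  r (SIGN x) <= size w -> occ (r (SIGN x)) [:: Some sg] -> exists r', run (read_bit x) r r'.
Proof.
move=> r_lt low Hb le_s Hs.
have R1 := @copy_run _ _ w K T (BIT x) P r isT isT isT (r_lt _).
set m := upd (upd _ _ _) _ _ in R1.
have Pm : m P = r (BIT x) by rewrite /m; lookups.
have m_lt := run_bounded R1 r_lt.
have le_p : m P <= size w by rewrite Pm; case/andP: Hb.
case: bs Hb => [|b bs] Hb.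
  have := @match_run Sigma w K w_lt [:: None] m; rewrite Pm in le_p *.
  move=> /(_ (stored_nil Hb) le_p) R2.
  by eexists; exists m => //; left; apply: R2.
have [Hb1 Hb2] := stored_cons Hb.
have := @match_run Sigma w K w_lt [:: Some b] m; rewrite Pm in le_p *.
move=> /(_ Hb1 le_p); set m2 := upd _ _ _ => R2.
have m2_lt := run_bounded R2 m_lt.
have R3 := @copy_run _ _ w K T P (BIT x) m2 isT isT isT (m2_lt _).
set m3 := upd (upd _ _ _) _ _ in R3; have m3_lt := run_bounded R3 m2_lt.
case: b Hb Hb1 @m2 R2 m2_lt @m3 R3 m3_lt => Hb Hb1 m2 R2 m2_lt m3 R3 m3_lt; last first.
  by exists m3, m => //; right; left; exists m2.
have [|||r' R4] := @add_sign_run x sg m3 m3_lt.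
- by move=> y; rewrite /m3 /m2 /m; lookups.
- by rewrite /m3 /m2 /m; lookups.
- by rewrite /m3 /m2 /m; lookups.
by exists r', m => //; right; right; exists m2 => //; exists m3.
Qed.

Lemma run_bit x sg bs r r' : stored (r (BIT x)) bs -> occ (r (SIGN x)) [:: Some sg] ->
  run (bit_program x) r r' ->
  [/\ stored (r' (BIT x)) (behead bs),
    (carry r x - signed sg (head false bs) = 2 * carry r' x)%R &
    forall v, ~~ is_bit_aux x v -> r' v = r v].
Proof.
move=> Hb Hs /run_seq[m1 /(run_read_bit Hb Hs)[Hb1 Hc1 _ _ F1]].
move=> /run_cons[m2 /run_cancel H2 /run_cons[m3 /run_halve H3 /run_cons[m4 /run_halve H4 ->]]].
have [//|k [le1 le2] E2] := H2.
have [even1 E3] := H3 isT; have [even2 ->] := H4 isT; rewrite E3.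
split.
- by lookups; rewrite E2; lookups.
- rewrite -Hc1 /carry; lookups; rewrite E2; lookups.
  have P2 : m2 (POS x) = m1 (POS x) - k by rewrite E2; lookups.
  have N3 : m3 (NEG x) = m1 (NEG x) - k by rewrite E3 E2; lookups.
  have := even_halfK even1; have := even_halfK even2; rewrite N3 P2.
  by move: le1 le2; clear; lia.
- move=> v Hv; have := Hv; rewrite /is_bit_aux !inE !negb_or => /and5P[*].
  by lookups; rewrite E2; lookups; rewrite F1.
Qed.

(** Reading the bit adds at most 1 to a counter, which is then at most [k.*2], and at most [k] after
    halving. *)
Lemma bit_run x sg bs (c : int) k r : bounded K r -> low_carry 1 r -> stored (r (BIT x)) bs ->
  r (SIGN x) <= size w -> occ (r (SIGN x)) [:: Some sg] ->
  (carry r x - signed sg (head false bs) = 2 * c)%R ->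
  r (POS x) < k.*2 -> r (NEG x) < k.*2 ->
  exists r', [/\ run (bit_program x) r r', r' (POS x) <= k & r' (NEG x) <= k].
Proof.
move=> r_lt low Hb le_s Hs Ec le_pk le_nk.
have [m1 R1] := read_bit_run r_lt low Hb le_s Hs; have m1_lt := run_bounded R1 r_lt.
have [Hb1 Hc1 le1 le2 F1] := run_read_bit Hb Hs R1; rewrite Ec in Hc1.
(* Cancelling the minimum leaves one counter at 0; the other one is then even, as the difference of
   the two is. *)
pose j := minn (m1 (POS x)) (m1 (NEG x)).
pose m2 := upd (upd m1 (POS x) (m1 (POS x) - j)) (NEG x) (m1 (NEG x) - j).
have R2 : run (cancel_pair letter (POS x) (NEG x)) m1 m2.
  by apply/run_cancel => //; exists j; rewrite ?geq_minl ?geq_minr.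
have m2_lt := run_bounded R2 m1_lt.
have [P2 N2] : m2 (POS x) = m1 (POS x) - j /\ m2 (NEG x) = m1 (NEG x) - j.
  by rewrite /m2; lookups.
have [ev1 ev2] : ~~ odd (m2 (POS x)) /\ ~~ odd (m2 (NEG x)).
  rewrite P2 N2 /j; move: Hc1; rewrite /carry; clear; case: leqP; lia.
have R3 := @halve_run _ _ w K T (POS x) m2 isT (m2_lt _) ev1.
set m3 := upd (upd _ _ _) _ _ in R3; have m3_lt := run_bounded R3 m2_lt.
have N3 : m3 (NEG x) = m2 (NEG x) by rewrite /m3; lookups.
have R4 := @halve_run _ _ w K T (NEG x) m3 isT (m3_lt _); rewrite N3 in R4.
exists (upd (upd m3 (NEG x) (m2 (NEG x))./2) T 0); split.
- exists m1 => //; exists m2 => //; exists m3 => //.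
  by exists (upd (upd m3 (NEG x) (m2 (NEG x))./2) T 0) => //; apply: R4.
- lookups; rewrite /m3; lookups; rewrite P2.
  by move: le1 le_pk; clear; lia.
- by lookups; rewrite N2; move: le2 le_nk; clear; lia.
Qed.

(** The union of the [is_bit_aux x] over all terminals: [P], [T], the carries and the bit
    pointers. *)
Definition is_bit_reg (v : var) :=
  match v with inl i => (i == 0 :> nat) || (i == 10 :> nat) | inr (i, _) => (i < 2) || (i == 4 :> nat) end.

Lemma bit_reg_aux v x : ~~ is_bit_reg v -> ~~ is_bit_aux x v.
Proof. by apply: contra; rewrite /is_bit_aux !inE => /or4P[/eqP->|/eqP->|/eqP->|/orP[/eqP->|/eqP->]]. Qed.

Lemma bit_aux_other x y : x != y ->
  [/\ ~~ is_bit_aux y (POS x), ~~ is_bit_aux y (NEG x) & ~~ is_bit_aux y (BIT x)].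
Proof. by move=> xy; rewrite /is_bit_aux !inE !(inj_eq inr_inj) !xpair_eqE /= (negPf xy). Qed.

Record bit_steps xs sg bs r r' : Prop := BitSteps {
  bt_ptr : forall x, x \in xs -> stored (r' (BIT x)) (behead (bs x));
  bt_carry : forall x, x \in xs ->
    (carry r x - signed (sg x) (head false (bs x)) = 2 * carry r' x)%R;
  bt_other : forall x, x \notin xs ->
    [/\ r' (POS x) = r (POS x), r' (NEG x) = r (NEG x) & r' (BIT x) = r (BIT x)];
  bt_frame : forall v, ~~ is_bit_reg v -> r' v = r v
}.

Lemma run_bits xs sg bs r r' : uniq xs -> (forall x, x \in xs -> stored (r (BIT x)) (bs x)) ->
  (forall x, occ (r (SIGN x)) [:: Some (sg x)]) ->
  run (seqs [seq bit_program x | x <- xs]) r r' -> bit_steps xs sg bs r r'.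
Proof.
elim: xs r => [|x xs IH] r; first by move=> _ _ _ ->.
move=> /andP[x_xs uxs] Hb Hs /run_cons[m /(run_bit (Hb x (mem_head _ _)) (Hs x))[Hb1 Hc1 F1] Hr].
have other y : y != x -> [/\ m (POS y) = r (POS y), m (NEG y) = r (NEG y) & m (BIT y) = r (BIT y)].
  by move=> /bit_aux_other[*]; rewrite !F1.
have [||Hb2 Hc2 Ho2 F2] := IH m uxs _ _ Hr.
- move=> y y_xs; have [|_ _ ->] := other y; first by apply: contraNneq x_xs => <-.
  by apply: Hb; rewrite inE y_xs orbT.
- by move=> y; rewrite F1 // bit_reg_aux.
have [Op On Ob] := Ho2 x x_xs; split.
- move=> y; rewrite inE; case: (y =P x) => [-> _|_] /=; [by rewrite Ob | exact: Hb2].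
- move=> y; rewrite inE; case: (y =P x) => [-> _|/eqP yx] /=; first by rewrite Hc1 /carry Op On.
  by move=> /Hc2 <-; have [Ep En _] := other y yx; rewrite /carry Ep En.
- move=> y; rewrite inE negb_or => /andP[yx y_xs].
  by have [-> -> ->] := Ho2 y y_xs; apply: other.
- by move=> v Hv; rewrite F2 // F1 // bit_reg_aux.
Qed.

Lemma bits_run xs sg bs (c : Sigma -> int) k r : uniq xs -> bounded K r -> k.+1 < K ->
  low_carry 1 r -> (forall x, x \in xs -> stored (r (BIT x)) (bs x)) ->
  (forall x, r (SIGN x) <= size w) -> (forall x, occ (r (SIGN x)) [:: Some (sg x)]) ->
  (forall x, x \in xs -> carry r x - signed (sg x) (head false (bs x)) = 2 * c x)%R ->
  (forall x, x \in xs -> r (POS x) < k.*2 /\ r (NEG x) < k.*2) ->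
  exists2 r', run (seqs [seq bit_program x | x <- xs]) r r' &
    forall x, x \in xs -> r' (POS x) <= k /\ r' (NEG x) <= k.
Proof.
move=> + + k_lt; elim: xs r => [|x xs IH] r; first by move=> *; exists r.
move=> /andP[x_xs uxs] r_lt low Hb le_s Hs Hc le_k.
have x_in := mem_head x xs; have [lp ln] := le_k x x_in.
have [m [Hm Pm Nm]] := bit_run r_lt low (Hb x x_in) (le_s x) (Hs x) (Hc x x_in) lp ln.
have [_ _ F1] := run_bit (Hb x x_in) (Hs x) Hm.
have other y : y != x -> [/\ m (POS y) = r (POS y), m (NEG y) = r (NEG y) & m (BIT y) = r (BIT y)].
  by move=> /bit_aux_other[*]; rewrite !F1.
have old y : y \in xs -> y != x by apply: contraTneq => ->.
have sub y : y \in xs -> y \in x :: xs by rewrite inE orbC => ->.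
have Sm y : m (SIGN y) = r (SIGN y) by rewrite F1 // bit_reg_aux.
have [||||||r' Hr' Hk] := IH m uxs (run_bounded Hm r_lt).
- move=> y; have [->|yx] := eqVneq y x; first by rewrite !addn1; split; apply: leq_trans k_lt.
  by have [-> -> _] := other y yx; apply: low.
- by move=> y y_xs; have [_ _ ->] := other y (old y y_xs); apply/Hb/sub.
- by move=> y; rewrite Sm.
- by move=> y; rewrite Sm.
- by move=> y y_xs; rewrite /carry; have [-> -> _] := other y (old y y_xs); apply/Hc/sub.
- by move=> y y_xs; have [-> -> _] := other y (old y y_xs); apply/le_k/sub.
exists r'; first by exists m.
move=> y; rewrite inE; case: (y =P x) => [-> _|_] /=; last exact: Hk.
have [||_ _ /(_ x x_xs)[-> -> _] _] := @run_bits xs sg bs m r' uxs _ _ Hr'; last by [].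
- by move=> y' y_xs; have [_ _ ->] := other y' (old y' y_xs); apply/Hb/sub.
- by move=> y'; rewrite Sm.
Qed.

Lemma run_end xs (bs : Sigma -> seq bool) r r' :
  (forall x, x \in xs -> stored (r (BIT x)) (bs x)) ->
  run (seqs [seq end_one x | x <- xs]) r r' ->
  forall x, x \in xs -> bs x = [::] /\ carry r x = 0%R.
Proof.
(* Cancelling changes the counters but not their difference, so carries and pointers are compared
   with those of a fixed valuation [r0] throughout the induction. *)
suff H r0 : (forall x, x \in xs -> stored (r0 (BIT x)) (bs x) /\ r (BIT x) = r0 (BIT x)) ->
    (forall x, carry r x = carry r0 x) -> run (seqs [seq end_one x | x <- xs]) r r' ->
    forall x, x \in xs -> bs x = [::] /\ carry r0 x = 0%R.
  by move=> Hb; apply: H => // x /Hb.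
elim: xs r => // x xs IH r Hb Hc /run_cons[m]; rewrite {1}/end_one => /run_cons[m1 /run_copy E1].
have {}E1 := E1 isT isT isT.
move=> /run_cons[m2 /run_match[H2 E2] /run_cons[m3 /run_cancel H3]].
have [//|k [le1 le2] E3] := H3; move=> /run_cons[_ [Ep ->] /run_cons[_ [En ->] ->]] Hr.
have P1 : m1 P = r (BIT x) by rewrite E1; lookups.
have F m' : m' = m2 -> (forall y, carry m' y = carry r y) /\ forall y, m' (BIT y) = r (BIT y).
  by move=> ->; split=> y; rewrite /carry E2 E1; lookups.
have [Hcm Hbm] := F _ erefl.
have Hc3 y : carry m3 y = carry r y.
  rewrite -Hcm /carry E3; have [->|yx] := eqVneq y x; last by rewrite !updN.
  by lookups; move: le1 le2; clear; lia.
have Hb3 y : m3 (BIT y) = r (BIT y) by rewrite E3; lookups; rewrite Hbm.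
move=> y; rewrite inE; case: (y =P x) => [-> _|_] /=; last first.
  apply: (IH m3) => // z; last by rewrite Hc3.
  by move=> zxs; rewrite Hb3; apply: Hb; rewrite inE zxs orbT.
have [Hx Ex] := Hb x (mem_head _ _); split; last first.
  by rewrite -Hc -Hc3 /carry Ep En.
rewrite P1 Ex in H2; case E: (bs x) Hx => [|b l] //.
by move=> /stored_cons[H1 _]; have := occ1_inj H1 H2.
Qed.

Lemma end_run xs r : bounded K r ->
  (forall x, x \in xs -> stored (r (BIT x)) [::] /\ carry r x = 0%R) ->
  exists r', run (seqs [seq end_one x | x <- xs]) r r'.
Proof.
elim: xs r => [|x xs IH] r r_lt H; first by exists r.
have [Hb Hc] := H x (mem_head _ _).
have R1 := @copy_run _ _ w K T (BIT x) P r isT isT isT (r_lt _).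
set m1 := upd (upd _ _ _) _ _ in R1; have m1_lt := run_bounded R1 r_lt.
have P1 : m1 P = r (BIT x) by rewrite /m1; lookups.
have := @match_run Sigma w K w_lt [:: None] m1; rewrite P1.
have /andP[Hb1 Hb2] := Hb; move=> /(_ Hb1 Hb2); set m2 := upd m1 _ _ => R2.
have Ec : m2 (NEG x) = m2 (POS x) by rewrite /m2 /m1; lookups; move: Hc; rewrite /carry; clear; lia.
pose m3 := upd (upd m2 (POS x) (m2 (POS x) - m2 (POS x))) (NEG x) (m2 (NEG x) - m2 (POS x)).
have R3 : run (cancel_pair letter (POS x) (NEG x)) m2 m3.
  by apply/run_cancel => //; exists (m2 (POS x)); first by rewrite Ec; split.
have R : run (end_one x) r m3.
  exists m1; first exact: R1; exists m2; first exact: R2; exists m3; first exact: R3.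
  exists m3; first by split=> //; rewrite /m3 subnn; lookups.
  by exists m3 => //; split=> //; rewrite /m3 Ec subnn; lookups.
have [|r' Hr'] := IH m3 (run_bounded R r_lt); last by exists r', m3.
move=> y yxs; have [|H1 H2] := H y; first by rewrite inE yxs orbT.
have B3 : m3 (BIT y) = r (BIT y) by rewrite /m3 /m2 /m1; lookups.
rewrite B3; split=> //; have [->|yx] := eqVneq y x.
  by rewrite /carry /m3 Ec subnn; lookups.
rewrite -H2 /carry /m3 /m2 /m1 !updN //.
Qed.
Section Cycles.
Variables (n : nat) (es : seq (edge Sigma n)) (dd vv : nat).
Hypotheses (occ_es : occ dd (enc_edges es)) (vv_eq : vv = dd + size (enc_edges es)).
Hypothesis dd_le : dd <= size w.
Variables (b : Sigma -> 'I_n) (sg : Sigma -> bool).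

Record level_state (bs : Sigma -> seq bool) r : Prop := LevelState {
  inv_env : env n dd vv r;
  inv_base : forall x, r (BASE x) = b x;
  inv_sign : forall x, occ (r (SIGN x)) [:: Some (sg x)] /\ r (SIGN x) <= size w;
  inv_bits : forall x, stored (r (BIT x)) (bs x)
}.

Implicit Types Z : seq (edge Sigma n).

Lemma carry_walks Z r r' x : walks Z r r' -> carry r' x = (carry r x + eff Z x)%R.
Proof. by case=> p m _; rewrite /carry p m eff_counts; clear; lia. Qed.

Lemma walks_inv bs Z r r' : level_state bs r -> walks Z r r' -> level_state bs r'.
Proof.
move=> [He Hb Hs Hp] Hw; split=> [|x|x|x]; first exact: env_walks He Hw.
- by rewrite (w_frame Hw).
- by rewrite (w_frame Hw).
- by rewrite (w_frame Hw).
Qed.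

Lemma bits_inv bs r r' : level_state bs r -> bit_steps (enum Sigma) sg bs r r' ->
  level_state (fun x => behead (bs x)) r'.
Proof.
move=> [[En Ed Ev] Hb Hs Hp] [Hp' _ _ F]; split=> [|x|x|x].
- by split; rewrite F.
- by rewrite F.
- by rewrite F.
- by apply: Hp'; rewrite mem_enum.
Qed.

Lemma run_level bs r r' : level_state bs r -> run (level_program Sigma) r r' ->
  exists Zs, [/\ forall Z, Z \in Zs -> is_cycle es b Z, level_state (fun x => behead (bs x)) r' &
    forall x, (carry r x + eff (flatten Zs) x - signed (sg x) (head false (bs x)) =
               2 * carry r' x)%R].
Proof.
move=> Hr /run_seq[m H1 H2].
have [Zs HZs Hw] := run_cycles w_lt occ_es vv_eq (inv_env Hr) (inv_base Hr) H1.
have Hm := walks_inv Hr Hw.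
have := @run_bits (enum Sigma) sg bs m r' (enum_uniq _) _ _ H2.
move=> Hbt; have {}Hbt : bit_steps (enum Sigma) sg bs m r'.
  by apply: Hbt => [x _|x]; [apply: (inv_bits Hm) | case: (inv_sign Hm x)].
exists Zs; split=> //; first exact: (bits_inv Hm).
by move=> x; rewrite -(carry_walks x Hw) (bt_carry Hbt) ?mem_enum.
Qed.

Lemma signed_natval s l : signed s (natval l) =
  (signed s (head false l) + 2 * signed s (natval (behead l)))%R.
Proof. by case: l => [|c l]; rewrite /signed /=; case: s => //; lia. Qed.

Lemma run_levels bs r r' : level_state bs r ->
  run (PSeq (Star (level_program Sigma)) (end_program Sigma)) r r' ->
  exists2 Zs, forall Z, Z \in Zs -> is_cycle es b Z &
    forall x, signed (sg x) (natval (bs x)) = (carry r x + eff (flatten Zs) x)%R.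
Proof.
move=> Hr /run_seq[m /run_iter H]; elim: H bs Hr => [{}r|{}r m' {}m Hl _ IH] bs Hr He.
  exists [::] => // x.
  have [|->] := run_end (fun x _ => inv_bits Hr x) He (x := x); first by rewrite mem_enum.
  by rewrite /eff big_nil => ->; rewrite /signed; case: (sg x).
have [Zs [HZs Hm' Ec]] := run_level Hr Hl.
have [Zs' HZs' E] := IH _ Hm' He.
(* Horner's rule: whatever the higher levels use counts twice. The list becomes exponentially long,
   but it occurs only in the proof. *)
exists (Zs ++ Zs' ++ Zs').
  by move=> Z; rewrite !mem_cat orbb => /orP[/HZs|/HZs'].
move=> x; rewrite !flatten_cat !eff_cat signed_natval E; have := Ec x; clear; lia.
Qed.

Variables (C : Sigma -> seq (edge Sigma n)) (F Cb : nat).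
Hypothesis C_es : forall x, {subset C x <= es}.
Hypothesis C_cycle : forall x, gwalk (Some (b x)) (C x) (Some (b x)).
Hypothesis C_size : \sum_x size (C x) <= F.
Hypotheses (lt_F : F < Cb) (Cb_K : 2 * Cb + 2 < K).

(* At each level, [C x] is used iff the current digit of [lam x] is 1. *)
Lemma levels_run t bs lam r : level_state bs r -> bounded K r ->
  (forall x, size (bs x) <= t) -> (forall x, lam x < 2 ^ t) ->
  (forall x, r (POS x) <= Cb /\ r (NEG x) <= Cb) ->
  (forall x, signed (sg x) (natval (bs x)) =
     (carry r x + \sum_y (lam y)%:Z * eff (C y) x)%R) ->
  exists r', run (PSeq (Star (level_program Sigma)) (end_program Sigma)) r r'.
Proof.
elim: t bs lam r => [|t IH] bs lam r Hr r_lt Hs Hl le_c E.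
  have [|r' Hr'] := @end_run (enum Sigma) r r_lt; last by exists r', r; first exact: StarRefl.
  move=> x _; have := inv_bits Hr x; have := Hs x; have := E x; case: (bs x) => // + _.
  rewrite big1 => [|y _]; last by have := Hl y; case: (lam y) => // _; rewrite mul0r.
  by rewrite addr0 => <-; rewrite /signed; case: (sg x).
pose C' x := if odd (lam x) then C x else [::].
have C'_size : size (flatten (map C' (enum Sigma))) <= F.
  apply: leq_trans C_size; rewrite size_flatten sumnE /shape 2!big_map big_enum /=.
  by apply: leq_sum => x _; rewrite /C'; case: ifP.
have [|||m1 R1 Hw] := cycles_run w_lt occ_es vv_eq dd_le (C := C') (xs := enum Sigma)
    (inv_env Hr) r_lt _ (inv_base Hr).
- by move=> x; have := le_c x; move: C'_size lt_F Cb_K; clear; lia.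
- by move=> x; rewrite /C'; case: ifP.
- by move=> x; rewrite /C'; case: ifP => // _; apply: eqxx.
have m1_lt := run_bounded R1 r_lt; have Hm1 := walks_inv Hr Hw.
have eC' x : eff (flatten (map C' (enum Sigma))) x = (\sum_y (odd (lam y))%:Z * eff (C y) x)%R.
  rewrite eff_flatten big_map big_enum /=; apply: eq_bigr => y _; rewrite /C'.
  by case: odd; rewrite ?mul1r // mul0r /eff big_nil.
(* The next carry is forced by the equation that must hold for the remaining digits of [v] and of
   [lam]. *)
pose c x := (signed (sg x) (natval (behead (bs x))) - \sum_y ((lam y)./2)%:Z * eff (C y) x)%R.
(* As [F < Cb], this is below [2 * Cb], so halving restores the bound [Cb] for the next level. *)
have le_m1 x : m1 (POS x) <= Cb + F /\ m1 (NEG x) <= Cb + F.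
  rewrite (w_plus Hw) (w_minus Hw); have [l1 l2] := le_c x.
  by split; apply: leq_add => //; apply: leq_trans C'_size; rewrite ?npos_le ?nneg_le.
have Ec x : (carry m1 x - signed (sg x) (head false (bs x)) = 2 * c x)%R.
  rewrite (carry_walks x Hw) eC' /c.
  have := E x; rewrite signed_natval.
  have -> : (\sum_y (lam y)%:Z * eff (C y) x = \sum_y (odd (lam y))%:Z * eff (C y) x +
       2 * \sum_y ((lam y)./2)%:Z * eff (C y) x)%R.
    rewrite mulr_sumr -big_split /=; apply: eq_bigr => y _.
    by rewrite -{1}[lam y]odd_double_half -muln2; lia.
  by clear; lia.
have [|||||||m2 R2 le_m2] := @bits_run (enum Sigma) sg bs c Cb m1 (enum_uniq _) m1_lt.
- by move: Cb_K; clear; lia.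
- by move=> x; have := le_m1 x; move: lt_F Cb_K; clear; lia.
- by move=> x _; apply: (inv_bits Hm1).
- by move=> x; case: (inv_sign Hm1 x).
- by move=> x; case: (inv_sign Hm1 x).
- by move=> x _; apply: Ec.
- by move=> x _; have := le_m1 x; move: lt_F; clear; lia.
have Hbt := @run_bits (enum Sigma) sg bs m1 m2 (enum_uniq _) (fun x _ => inv_bits Hm1 x)
  (fun x => (inv_sign Hm1 x).1) R2.
have Hm2 := bits_inv Hm1 Hbt.
have [|||||r' [m3 R3 R4]] := IH _ (fun x => (lam x)./2) m2 Hm2.
- exact: run_bounded R2 m1_lt.
- by move=> x; rewrite size_behead; have := Hs x; clear; lia.
- by move=> x; have := Hl x; rewrite expnS; clear; lia.
- by move=> x; apply: le_m2; rewrite mem_enum.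
- move=> x; have := bt_carry Hbt (x := x); rewrite mem_enum Ec => /(_ isT).
  rewrite /c; clear; lia.
exists r', m3 => //; apply: StarStep R3; exists m1 => //; exact: R2.
Qed.

End Cycles.
End Levels.

(** * Parsing the input *)

Section Input.
Import GRing.Theory Num.Theory Order.TTheory.
Variable Sigma : finType.
Local Notation var := (var Sigma).
Local Notation prog := (prog var letter).
Local Notation P := (P Sigma).
Local Notation NN := (NN Sigma).
Local Notation MM := (MM Sigma).
Local Notation QI := (QI Sigma).
Local Notation DD := (DD Sigma).
Local Notation VV := (VV Sigma).
Local Notation T := (T Sigma).
Local Notation match_word := (match_word Sigma).
Implicit Types (r : var -> nat) (x y : Sigma) (xs : seq Sigma).

Definition any_bit : prog := Alt (match_word [:: Some false]) (match_word [:: Some true]).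
(* Only canonical encodings are accepted: no sign on zero, no leading zeros. *)
Definition parse_int x : prog :=
  PSeq (copy letter T P (SIGN x))
    (Alt (seqs [:: match_word [:: Some false]; copy letter T P (BIT x); match_word [:: None]])
         (seqs [:: any_bit; copy letter T P (BIT x); Star any_bit; match_word [:: Some true; None]])).
Definition parse_ints xs : prog := seqs [seq parse_int x | x <- xs].
(** [MM] is counted down, so that the test for zero afterwards enforces the announced number of
    transitions. *)
Definition skip_transitions : prog :=
  Star (PSeq (Atom (Dec MM)) (skip_transition Sigma)).
Definition parse_header : prog :=
  seqs [:: parse_unary NN; parse_unary QI; test_lt letter T QI NN; parse_unary MM].
(** One pass over the whole word rejects everything that encodes no instance. It also records the
    ends of the list of transitions and the places of the signs and digits of the vector, for the
    later passes. *)
Definition parse_input : prog :=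
  seqs [:: parse_header; copy letter T P DD; skip_transitions; Atom (Zero MM);
           copy letter T P VV; parse_ints (enum Sigma); Atom (Read P None)].

Variables (w : seq letter) (K : nat).
Hypothesis w_lt : size w < K.
Local Notation run := (run w K).
Local Notation occ := (occ w).
Local Notation stored := (stored w).

Lemma run_any_bit r r' : run any_bit r r' ->
  exists2 c, occ (r P) [:: Some c] & r' = upd r P (r P).+1.
Proof.
by case/run_alt => /run_match[H ->]; [exists false|exists true]; rewrite // addn1.
Qed.

Lemma any_bit_run c r : occ (r P) [:: Some c] -> r P <= size w ->
  run any_bit r (upd r P (r P).+1).
Proof.
move=> H le_p; have := match_run w_lt H le_p; rewrite addn1.
by case: c {H}; [right|left].
Qed.

Lemma run_any_bits r r' : run (Star any_bit) r r' ->
  exists2 cs, occ (r P) (map Some cs) & r' = upd r P (r P + size cs).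
Proof.
move/run_iter; elim=> [{}r|{}r m {}r' /run_any_bit[c Hc ->] _ [cs]].
  by exists [::]; rewrite ?occ_nil // addn0 upd_id.
rewrite updx => Hcs ->; exists (c :: cs).
  by rewrite map_cons -cat1s occ_cat Hc addn1.
by apply: functional_extensionality => v; rewrite /upd /= addnS addSn; case: eqP.
Qed.

Lemma any_bits_run cs r : occ (r P) (map Some cs) -> r P <= size w ->
  run (Star any_bit) r (upd r P (r P + size cs)).
Proof.
elim: cs r => [|c cs IH] r; first by rewrite addn0 upd_id => _ _; apply: StarRefl.
rewrite map_cons -cat1s occ_cat => /andP[Hc Hcs] le_p.
have le1 := occ_size le_p Hc; rewrite addn1 in le1 Hcs.
apply: StarStep (any_bit_run Hc le_p) _.
have := IH (upd r P (r P).+1); rewrite updx => /(_ Hcs le1).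
have -> // : upd (upd r P (r P).+1) P ((r P).+1 + size cs) = upd r P (r P + size (c :: cs)).
by apply: functional_extensionality => v; rewrite /upd /= addnS addSn; case: eqP.
Qed.

Lemma enc_int_natval sg bs : last true bs -> (0 < natval bs) || ~~ sg ->
  enc_int (signed sg (natval bs)) = Some sg :: map Some bs ++ [:: None].
Proof.
move=> lst H; rewrite /enc_int /enc_nat.
have -> : `|signed sg (natval bs)|%N = natval bs by rewrite /signed; case: sg {H} => //; rewrite abszN.
rewrite bits_natval //; congr (Some _ :: _).
by move: H; rewrite /signed; case: sg => //=; lia.
Qed.

Lemma natval_rcons_true cs : 0 < natval (rcons cs true).
Proof. by elim: cs => //= c cs; case: c => //=; lia. Qed.

Record reads_int x z r r' : Prop := ReadsInt {
  ri_occ : occ (r P) (enc_int z);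
  ri_pos : r' P = r P + size (enc_int z);
  ri_sign : r' (SIGN x) = r P;
  ri_bits : r' (BIT x) = (r P).+1;
  ri_frame : forall v, v \notin [:: P; T; SIGN x; BIT x] -> r' v = r v
}.

Lemma run_parse_int x r r' : run (parse_int x) r r' -> exists z, reads_int x z r r'.
Proof.
move=> /run_seq[m1 /run_copy E1]; have {}E1 := E1 isT isT isT.
have P1 : m1 P = r P by rewrite E1; lookups.
case/run_alt.
  move=> /run_cons[m2 /run_match[H2 E2] /run_cons[m3 /run_copy E3 /run_cons[m4 /run_match[H4 ->] ->]]].
  have {}E3 := E3 isT isT isT; rewrite P1 in H2 E2.
  have P3 : m3 P = (r P).+1 by rewrite E3; lookups; rewrite E2 updx addn1.
  rewrite P3 in H4; exists 0%R; split.
  - by rewrite -[enc_int 0]/([:: Some false] ++ [:: None]) occ_cat H2 addn1.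
  - by rewrite updx P3 addn1 addn2.
  - by rewrite E3; lookups; rewrite E2 E1; lookups.
  - by rewrite E3; lookups; rewrite E2 updx addn1.
  - move=> v; rewrite !inE !negb_or => /and4P[*].
    by rewrite E3; lookups; rewrite E2 E1; lookups.
move=> /run_cons[m2 /run_any_bit[sg H2 E2] /run_cons[m3 /run_copy E3]].
move=> /run_cons[m4 /run_any_bits[cs H4 E4] /run_cons[m5 /run_match[H5 ->] ->]].
have {}E3 := E3 isT isT isT; rewrite P1 in H2 E2.
have P3 : m3 P = (r P).+1 by rewrite E3; lookups; rewrite E2 updx.
have P4 : m4 P = (r P).+1 + size cs by rewrite E4 updx P3.
rewrite P3 in H4; rewrite P4 in H5.
have Ez : enc_int (signed sg (natval (rcons cs true))) =
    [:: Some sg] ++ map Some cs ++ [:: Some true; None].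
  by rewrite enc_int_natval ?last_rcons ?natval_rcons_true // map_rcons cat_rcons.
exists (signed sg (natval (rcons cs true))); split; rewrite ?Ez.
- by rewrite occ_cat H2 addn1 occ_cat H4 size_map.
- by rewrite updx P4 size_cat size_cat size_map /=; clear; lia.
- by rewrite E4 E3; lookups; rewrite E2 E1; lookups.
- by rewrite E4 E3; lookups; rewrite E2 updx.
- move=> v; rewrite !inE !negb_or => /and4P[*].
  by rewrite E4 E3; lookups; rewrite E2 E1; lookups.
Qed.

Lemma parse_int_run x z r : bounded K r -> r P <= size w -> occ (r P) (enc_int z) ->
  exists2 r', run (parse_int x) r r' & reads_int x z r r'.
Proof.
move=> r_lt le_p Hz.
have R1 := @copy_run _ _ w K T P (SIGN x) r isT isT isT (r_lt _).
set m1 := upd (upd _ _ _) _ _ in R1; have m1_lt := run_bounded R1 r_lt.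
have P1 : m1 P = r P by rewrite /m1; lookups.
have := Hz; rewrite -[enc_int z]/([:: Some (z < 0)%R] ++ enc_nat `|z|) occ_cat addn1 => /andP[H2 Hb].
have le1 := occ_size le_p H2; rewrite addn1 in le1.
have [z0|z_neq0] := eqVneq z 0%R.
  have R2 := @match_run Sigma w K w_lt [:: Some false] m1; rewrite P1 in R2.
  rewrite z0 in H2 Hb; have {}R2 := R2 H2 le_p; set m2 := upd _ _ _ in R2.
  have m2_lt := run_bounded R2 m1_lt.
  have P2 : m2 P = (r P).+1 by rewrite /m2 updx addn1.
  have R3 := @copy_run _ _ w K T P (BIT x) m2 isT isT isT (m2_lt _).
  set m3 := upd (upd _ _ _) _ _ in R3.
  have P3 : m3 P = (r P).+1 by rewrite /m3; lookups.
  have R4 := @match_run Sigma w K w_lt [:: None] m3; rewrite P3 in R4.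
  have {}R4 := R4 Hb le1; set m4 := upd _ _ _ in R4.
  exists m4; first by exists m1 => //; left; exists m2 => //; exists m3 => //; exists m4.
  rewrite z0 in Hz *; split=> //.
  - by rewrite /m4 updx addn1 addn2.
  - by rewrite /m4 /m3 /m2 /m1; lookups.
  - by rewrite /m4 /m3; lookups.
  - move=> v; rewrite !inE !negb_or => /and4P[*].
    by rewrite /m4 /m3 /m2 /m1; lookups.
have Ez : exists cs, bits `|z| = rcons cs true.
  have := last_bits `|z|; have := natval_bits `|z|; case/lastP: (bits _) => [|cs c].
    by move=> E; case/eqP: z_neq0; move: E => /=; lia.
  by rewrite last_rcons => _ ->; exists cs.
have {Ez}[cs Ez] := Ez.
rewrite /enc_nat Ez map_rcons cat_rcons occ_cat size_map in Hb; case/andP: Hb => H4 H5.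
have le2 := occ_size le1 H4; rewrite size_map in le2.
have R2 := @any_bit_run (z < 0)%R m1; rewrite P1 in R2.
have {}R2 := R2 H2 le_p; set m2 := upd m1 P _ in R2; have m2_lt := run_bounded R2 m1_lt.
have R3 := @copy_run _ _ w K T P (BIT x) m2 isT isT isT (m2_lt _).
set m3 := upd (upd _ _ _) _ _ in R3.
have P3 : m3 P = (r P).+1 by rewrite /m3 /m2; lookups.
have R4 := @any_bits_run cs m3; rewrite P3 in R4.
have {}R4 := R4 H4 le1; set m4 := upd _ _ _ in R4.
have P4 : m4 P = (r P).+1 + size cs by rewrite /m4 updx.
have R5 := @match_run Sigma w K w_lt [:: Some true; None] m4; rewrite P4 in R5.
have {}R5 := R5 H5 le2; set m5 := upd _ _ _ in R5.
exists m5.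
  exists m1 => //; right; exists m2 => //; exists m3 => //; exists m4 => //; by exists m5.
split=> //.
- rewrite /m5 updx /enc_int /enc_nat Ez map_rcons cat_rcons /= size_cat size_map /=; clear; lia.
- by rewrite /m5 /m4 /m3 /m2 /m1; lookups.
- by rewrite /m5 /m4 /m3 /m2; lookups.
- move=> v; rewrite !inE !negb_or => /and4P[*].
  by rewrite /m5 /m4 /m3 /m2 /m1; lookups.
Qed.

Definition is_int_reg (v : var) :=
  match v with inl i => (i == 0 :> nat) || (i == 10 :> nat) | inr (i, _) => 2 < i end.

Lemma int_regN v x : ~~ is_int_reg v -> v \notin [:: P; T; SIGN x; BIT x].
Proof. by apply: contra; rewrite !inE => /or4P[] /eqP->. Qed.

Lemma enc_ints_cons x xs (z : Sigma -> int) : flatten [seq enc_int (z y) | y <- x :: xs] =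
  enc_int (z x) ++ flatten [seq enc_int (z y) | y <- xs].
Proof. by []. Qed.

Record reads_ints xs (z : Sigma -> int) r r' : Prop := ReadsInts {
  rz_occ : occ (r P) (flatten [seq enc_int (z x) | x <- xs]);
  rz_pos : r' P = r P + size (flatten [seq enc_int (z x) | x <- xs]);
  rz_sign : forall x, x \in xs -> occ (r' (SIGN x)) (enc_int (z x));
  rz_le : r P <= size w -> forall x, x \in xs -> r' (SIGN x) <= size w;
  rz_bits : forall x, x \in xs -> r' (BIT x) = (r' (SIGN x)).+1;
  rz_other : forall x, x \notin xs -> r' (SIGN x) = r (SIGN x) /\ r' (BIT x) = r (BIT x);
  rz_frame : forall v, ~~ is_int_reg v -> r' v = r v
}.

Lemma reads_ints_cons x xs z r m r' : x \notin xs -> reads_int x (z x) r m ->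
  reads_ints xs z m r' -> reads_ints (x :: xs) z r r'.
Proof.
move=> x_xs [o1 p1 s1 b1 f1] [o2 p2 s2 l2 b2 n2 f2].
have [n2s n2b] := n2 x x_xs.
have other y : y != x -> m (SIGN y) = r (SIGN y) /\ m (BIT y) = r (BIT y).
  by move=> yx; rewrite !f1 // !inE !(inj_eq inr_inj) !xpair_eqE /= (negPf yx).
split.
- by rewrite enc_ints_cons occ_cat o1 -p1.
- by rewrite p2 p1 enc_ints_cons size_cat addnA.
- by move=> y; rewrite inE; case: eqP => [-> _|_ /s2//]; rewrite n2s s1.
- move=> le_p y; rewrite inE; case: eqP => [-> _|_] /=; first by rewrite n2s s1.
  by apply: l2; rewrite p1; apply: occ_size.
- by move=> y; rewrite inE; case: eqP => [-> _|_ /b2//]; rewrite n2s n2b s1 b1.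
- move=> y; rewrite inE negb_or => /andP[yx /n2[-> ->]]; exact: other.
- by move=> v Hv; rewrite f2 // f1 // int_regN.
Qed.

Lemma run_parse_ints xs r r' : uniq xs -> run (parse_ints xs) r r' ->
  exists z, reads_ints xs z r r'.
Proof.
elim: xs r => [|x xs IH] r.
  by move=> _ ->; exists (fun=> 0%R); split=> //; rewrite ?occ_nil ?addn0.
move=> /andP[x_xs uxs] /run_cons[m /run_parse_int[z0 H0] /(IH _ uxs)[z Hz]].
exists (fun y => if y == x then z0 else z y); apply: (reads_ints_cons (m := m)) => //.
  by rewrite eqxx.
have E : [seq enc_int (if y == x then z0 else z y) | y <- xs] = [seq enc_int (z y) | y <- xs].
  by apply/eq_in_map => y yxs; case: eqP => // yx; rewrite -yx yxs in x_xs.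
case: Hz => *; split; rewrite ?E //.
by move=> y yxs; case: eqP => [yx|_]; [rewrite -yx yxs in x_xs | auto].
Qed.

Lemma parse_ints_run xs z r : uniq xs -> bounded K r -> r P <= size w ->
  occ (r P) (flatten [seq enc_int (z x) | x <- xs]) ->
  exists2 r', run (parse_ints xs) r r' & reads_ints xs z r r'.
Proof.
elim: xs r => [|x xs IH] r.
  by move=> _ _ _ _; exists r => //; split=> //; rewrite ?occ_nil ?addn0.
move=> /andP[x_xs uxs] r_lt le_p; rewrite enc_ints_cons occ_cat => /andP[Hx Hxs].
have [m Hm Rm] := parse_int_run x r_lt le_p Hx.
have [||r' Hr' Rr'] := IH m uxs (run_bounded Hm r_lt).
- by rewrite (ri_pos Rm) (occ_size le_p Hx).
- by rewrite (ri_pos Rm).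
exists r'; first by exists m.
exact: reads_ints_cons Rm Rr'.
Qed.

Lemma run_skip_transitions n r r' : r NN = n -> run skip_transitions r r' ->
  exists Z : seq (edge Sigma n), [/\ r MM = size Z + r' MM, occ (r P) (enc_edges Z),
    r' P = r P + size (enc_edges Z) &
    forall v, ~~ is_aux v -> v != MM -> r' v = r v].
Proof.
move=> En /run_iter H; elim: H En => [{}r|{}r m {}r' Hm _ IH] En.
  by exists [::]; rewrite occ_nil addn0.
move: Hm => /run_seq[m1 [mm_gt0 E1] H1].
have F1 v : v != MM -> m1 v = r v by move=> ?; rewrite E1 updN.
have [|e He] := run_skip_one w_lt _ H1 (n := n); first by rewrite F1.
have Hf := skip_frame He.
have [|Z [EM HZ EP F]] := IH; first by rewrite Hf // F1.
have Ho : occ (r P) (enc_edge e) by rewrite -(F1 P) //; apply: (rr_occ He).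
have Hp : m P = r P + size (enc_edge e) by rewrite -(F1 P) //; apply: (rr_pos He).
exists (e :: Z); split.
- have -> : r MM = (m MM).+1 by rewrite Hf // E1 updx prednK.
  by rewrite EM.
- by rewrite [enc_edges _]/= occ_cat Ho -Hp.
- by rewrite EP Hp size_cons_edges addnA.
- by move=> v v1 v2; rewrite F // Hf // F1.
Qed.

Lemma skip_transitions_run n (Z : seq (edge Sigma n)) r : r NN = n -> bounded K r ->
  r P <= size w -> occ (r P) (enc_edges Z) -> low_carry K 1 r -> r MM = size Z ->
  exists r', [/\ run skip_transitions r r', r' MM = 0, r' P = r P + size (enc_edges Z) &
    forall v, ~~ is_aux v -> v != MM -> r' v = r v].
Proof.
elim: Z r => [|e Z IH] r En r_lt le_p.
  by move=> _ _ M0; exists r; split=> //; [apply: StarRefl | rewrite addn0].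
rewrite [enc_edges _]/= occ_cat => /andP[He HZ] low EM.
pose m1 := upd r MM (r MM).-1.
have F1 v : v != MM -> m1 v = r v by move=> ?; rewrite /m1 updN.
have R1 : run (Atom (Dec MM)) r m1 by split=> //; rewrite EM.
have m1_lt := run_bounded R1 r_lt.
have [|||||m Hm Em] := @skip_one_run Sigma w K w_lt n e m1; rewrite ?F1 //.
have Hf := skip_frame Em; have Pm : m P = r P + size (enc_edge e) by rewrite (rr_pos Em) F1.
have [||||||r' [Hr' M' P' F']] := IH m; rewrite ?Pm ?Hf //.
- exact: run_bounded Hm m1_lt.
- exact: (occ_size le_p He).
- by move=> x; rewrite !Hf // !F1.
- by rewrite /m1 updx EM.
exists r'; split=> //.
- by apply: StarStep Hr'; exists m1.
- by rewrite P' Pm size_cons_edges addnA.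
- by move=> v v1 v2; rewrite F' // Hf // F1.
Qed.

Lemma run_parse_header r r' : r P = 0 -> run parse_header r r' ->
  exists n (q0 : 'I_n) k, [/\ occ 0 (enc_unary n ++ enc_unary q0 ++ enc_unary k),
    r' P = size (enc_unary n ++ enc_unary q0 ++ enc_unary k),
    r' NN = n, r' QI = q0 & r' MM = k] /\
    forall v, v \notin [:: P; NN; QI; MM; T] -> r' v = r v.
Proof.
rewrite /parse_header => P0 /run_cons[m1 /(run_parse_unary w_lt)[//|n Hn E1] /run_cons[m2 /(run_parse_unary w_lt)[//|q Hq E2]]].
move=> /run_cons[m3 /run_test_lt E3 /run_cons[m4 /(run_parse_unary w_lt)[//|k Hk E4] ->]].
have [//|//|//|lt_q {}E3] := E3.
have Q2 : m2 QI = q by rewrite E2; lookups.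
have N2 : m2 NN = n by rewrite E2; lookups; rewrite E1; lookups.
rewrite Q2 N2 in lt_q.
have P1 : m1 P = n.+1 by rewrite E1 updx P0.
have P3 : m3 P = n.+1 + q.+1 by rewrite E3; lookups; rewrite E2 updx P1.
have size_u j : size (enc_unary j) = j.+1 by rewrite size_cat size_nseq addn1.
exists n, (Ordinal lt_q), k; split; last first.
  move=> v; rewrite !inE !negb_or => /and5P[*].
  by rewrite E4; lookups; rewrite E3; lookups; rewrite E2; lookups; rewrite E1; lookups.
split.
- by rewrite occ_cat -P0 Hn P0 add0n size_u -P1 occ_cat Hq size_u P1 -P3.
- by rewrite E4 updx P3 size_cat [size (enc_unary q ++ _)]size_cat !size_u addnA.
- by rewrite E4; lookups; rewrite E3; lookups.
- by rewrite E4; lookups; rewrite E3; lookups.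
- by rewrite E4; lookups.
Qed.

Lemma parse_header_run n (q0 : 'I_n) k r : bounded K r -> r P = 0 ->
  occ 0 (enc_unary n ++ enc_unary q0 ++ enc_unary k) ->
  exists2 r', run parse_header r r' & [/\ r' P = size (enc_unary n ++ enc_unary q0 ++ enc_unary k),
    r' NN = n, r' QI = q0, r' MM = k &
    forall v, v \notin [:: P; NN; QI; MM; T] -> r' v = r v].
Proof.
move=> r_lt P0; rewrite occ_cat => /andP[Hn]; rewrite occ_cat => /andP[Hq Hk].
have size_u j : size (enc_unary j) = j.+1 by rewrite size_cat size_nseq addn1.
have le1 := occ_size (leq0n _) Hn; have le2 := occ_size le1 Hq.
have R1 := @parse_unary_run Sigma w K w_lt NN r n isT; rewrite P0 in R1.
have {}R1 := R1 Hn (leq0n _); set m1 := upd (upd _ _ _) _ _ in R1.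
have m1_lt := run_bounded R1 r_lt.
have P1 : m1 P = 0 + size (enc_unary n) by rewrite /m1 updx size_u.
have R2 := @parse_unary_run Sigma w K w_lt QI m1 q0 isT; rewrite P1 in R2.
have {}R2 := R2 Hq le1; set m2 := upd (upd _ _ _) _ _ in R2.
have m2_lt := run_bounded R2 m1_lt.
have R3 := @test_lt_run _ _ w K T QI NN m2 isT isT isT (m2_lt _).
have Q2 : m2 QI = q0 by rewrite /m2; lookups.
have N2 : m2 NN = n by rewrite /m2 /m1; lookups.
rewrite Q2 {1}N2 in R3; have {}R3 := R3 (ltn_ord q0).
pose m3 := upd m2 T 0.
have P3 : m3 P = 0 + size (enc_unary n) + size (enc_unary q0).
  by rewrite /m3 /m2; lookups; rewrite [size (enc_unary q0)]size_u.
have R4 := @parse_unary_run Sigma w K w_lt MM m3 k isT; rewrite P3 in R4.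
have {}R4 := R4 Hk le2; set m4 := upd (upd _ _ _) _ _ in R4.
exists m4; first by exists m1 => //; exists m2 => //; exists m3 => //; exists m4.
split.
- by rewrite /m4 updx size_cat [size (enc_unary q0 ++ _)]size_cat !size_u addnA.
- by rewrite /m4 /m3; lookups.
- by rewrite /m4 /m3; lookups.
- by rewrite /m4; lookups.
- move=> v; rewrite !inE !negb_or => /and5P[*].
  by rewrite /m4 /m3 /m2 /m1; lookups.
Qed.

Record input n (q0 : 'I_n) (es : seq (edge Sigma n)) (v : {ffun Sigma -> int}) r : Prop := Input {
  in_edges : occ (r DD) (enc_edges es);
  in_end : r VV = r DD + size (enc_edges es);
  in_le : r DD <= size w;
  in_num : r NN = n;
  in_init : r QI = q0;
  in_sign : forall x, occ (r (SIGN x)) [:: Some (v x < 0)%R] /\ r (SIGN x) <= size w;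
  in_bits : forall x, stored (r (BIT x)) (bits `|v x|);
  in_zero : forall x, r (POS x) = 0 /\ r (NEG x) = 0
}.

Lemma enc_instanceE n (q0 : 'I_n) (es : seq (edge Sigma n)) (v : {ffun Sigma -> int}) :
  enc_instance q0 (map to_transition es) v =
  (enc_unary n ++ enc_unary q0 ++ enc_unary (size es)) ++ enc_edges es ++
  flatten [seq enc_int (v x) | x <- enum Sigma].
Proof. by rewrite /enc_instance size_map -map_comp -!catA. Qed.

Lemma ints_input z r r' x : r P <= size w -> reads_ints (enum Sigma) z r r' ->
  [/\ occ (r' (SIGN x)) [:: Some (z x < 0)%R], r' (SIGN x) <= size w &
    stored (r' (BIT x)) (bits `|z x|)].
Proof.
move=> le_p Hz; have xin : x \in enum Sigma by rewrite mem_enum.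
have := rz_sign Hz xin; have le_s := rz_le Hz le_p xin.
rewrite -[enc_int (z x)]/([:: Some (z x < 0)%R] ++ enc_nat `|z x|) occ_cat addn1 => /andP[H1 H2].
split=> //; rewrite (rz_bits Hz xin) /stored H2 /=.
by have := occ_size le_s H1; rewrite addn1.
Qed.

Lemma run_parse_input r r' : (forall v, r v = 0) -> run parse_input r r' ->
  exists n (q0 : 'I_n) es v, w = enc_instance q0 (map to_transition es) v /\ input q0 es v r'.
Proof.
rewrite /parse_input => r0 /run_cons[m1 /(run_parse_header (r0 P))[n [q0 [k [[H1 P1 N1 Q1 M1] F1]]]]].
move=> /run_cons[m2 /run_copy E2]; have {}E2 := E2 isT isT isT.
move=> /run_cons[m3 /(@run_skip_transitions n)[|es [M3 H3 P3 F3]]]; first by rewrite E2; lookups.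
move=> /run_cons[_ [M0 ->] /run_cons[m5 /run_copy E5]]; have {}E5 := E5 isT isT isT.
move=> /run_cons[m6 /(run_parse_ints (enum_uniq _))[z Hz] /run_cons[_ [Hend ->] ->]].
have P2 : m2 P = m1 P by rewrite E2; lookups.
have M2 : m2 MM = k by rewrite E2; lookups.
have P5 : m5 P = m3 P by rewrite E5; lookups.
have Ek : size es = k by rewrite -M2 M3 M0 addn0.
rewrite P2 P1 in H3 P3.
have Hz1 := rz_occ Hz; rewrite P5 P3 in Hz1.
have le1 := occ_size (leq0n _) H1; rewrite add0n in le1.
have le2 := occ_size le1 H3.
pose v := [ffun x => z x].
have Ev : [seq enc_int (v x) | x <- enum Sigma] = [seq enc_int (z x) | x <- enum Sigma].
  by apply: eq_map => x; rewrite ffunE.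
exists n, q0, es, v; split.
  rewrite enc_instanceE Ev Ek; set u := (X in _ = X).
  have Hu : occ 0 u by rewrite /u occ_cat H1 add0n occ_cat H3.
  have := occP _ _ _ Hu; rewrite drop0 add0n => ->.
  rewrite drop_oversize ?cats0 //.
  (* The final test finds no letter under the head, so nothing follows the instance. *)
  have := onthTE w (m6 P); rewrite Hend /= (rz_pos Hz) P5 P3 => /esym/negbT.
  by rewrite -leqNgt [size u]size_cat [size (enc_edges es ++ _)]size_cat addnA.
have F5 u : u \notin [:: P; T; DD; VV; MM; NN; QI] -> ~~ is_aux u -> m5 u = 0.
  move=> Hu aux_u; move: Hu; rewrite !inE !negb_or => /and4P[? ? ? /and4P[*]].
  rewrite E5; lookups; rewrite F3 // E2; lookups.
  by rewrite F1 ?r0 // !inE !negb_or; apply/and5P.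
have F6 u : ~~ is_int_reg u -> m6 u = m5 u by apply: (rz_frame Hz).
have D6 : m6 DD = m1 P by rewrite F6 // E5; lookups; rewrite F3 // E2; lookups.
have V6 : m6 VV = m3 P by rewrite F6 // E5; lookups.
have le5 : m5 P <= size w by rewrite P5 P3.
have Hi x := ints_input x le5 Hz.
split.
- by rewrite D6 P1.
- by rewrite V6 D6 P3 P1.
- by rewrite D6 P1.
- by rewrite F6 // E5; lookups; rewrite F3 // E2; lookups.
- by rewrite F6 // E5; lookups; rewrite F3 // E2; lookups.
- by move=> x; rewrite ffunE; case: (Hi x).
- by move=> x; rewrite ffunE; case: (Hi x).
- by move=> x; rewrite !F6 // !F5.
Qed.

Lemma parse_input_run n (q0 : 'I_n) es v r : 1 < K -> (forall u, r u = 0) ->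
  w = enc_instance q0 (map to_transition es) v ->
  exists2 r', run parse_input r r' & input q0 es v r'.
Proof.
move=> K_gt1 r0 Ew.
have r_lt : bounded K r by move=> u; rewrite r0; apply: ltnW.
have : occ 0 (enc_instance q0 (map to_transition es) v).
  by rewrite -Ew; apply: occ_refl.
rewrite enc_instanceE occ_cat => /andP[H1]; rewrite add0n occ_cat => /andP[H3 Hz].
have le1 := occ_size (leq0n _) H1; rewrite add0n in le1.
have le2 := occ_size le1 H3.
have [m1 R1 [P1 N1 Q1 M1 F1]] := parse_header_run r_lt (r0 P) H1.
have m1_lt := run_bounded R1 r_lt.
have R2 := @copy_run _ _ w K T P DD m1 isT isT isT (m1_lt _).
set m2 := upd (upd _ _ _) _ _ in R2; have m2_lt := run_bounded R2 m1_lt.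
have P2 : m2 P = m1 P by rewrite /m2; lookups.
have [||||||m3 [R3 M3 P3 F3]] := @skip_transitions_run n es m2; rewrite ?P2 ?P1 //.
  by move=> x; rewrite /m2; lookups; rewrite !F1 // !r0.
rewrite P2 P1 in P3; have m3_lt := run_bounded R3 m2_lt.
have R5 := @copy_run _ _ w K T P VV m3 isT isT isT (m3_lt _).
set m5 := upd (upd _ _ _) _ _ in R5; have m5_lt := run_bounded R5 m3_lt.
have P5 : m5 P = m3 P by rewrite /m5; lookups.
have [||m6 R6 Hz6] := @parse_ints_run (enum Sigma) v m5 (enum_uniq _) m5_lt; rewrite ?P5 ?P3 //.
have R7 : run (Atom (Read P None)) m6 m6.
  split=> //; have := onthTE w (m6 P); rewrite (rz_pos Hz6) P5 P3.
  have <- : size w = size (enc_unary n ++ enc_unary q0 ++ enc_unary (size es)) +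
      size (enc_edges es) + size (flatten [seq enc_int (v x) | x <- enum Sigma]).
    by rewrite {1}Ew enc_instanceE size_cat [size (enc_edges es ++ _)]size_cat addnA.
  by rewrite ltnn; case: onth.
exists m6.
  exists m1 => //; exists m2 => //; exists m3 => //; exists m3 => //; exists m5 => //.
  by exists m6 => //; exists m6.
have F5 u : u \notin [:: P; T; DD; VV; MM; NN; QI] -> ~~ is_aux u -> m5 u = 0.
  move=> Hu aux_u; move: Hu; rewrite !inE !negb_or => /and4P[? ? ? /and4P[*]].
  rewrite /m5; lookups; rewrite F3 // /m2; lookups.
  by rewrite F1 ?r0 // !inE !negb_or; apply/and5P.
have F6 u : ~~ is_int_reg u -> m6 u = m5 u by apply: (rz_frame Hz6).
have D6 : m6 DD = m1 P by rewrite F6 // /m5; lookups; rewrite F3 // /m2; lookups.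
have V6 : m6 VV = m3 P by rewrite F6 // /m5; lookups.
have le5 : m5 P <= size w by rewrite P5 P3.
have Hi x := ints_input x le5 Hz6.
split.
- by rewrite D6 P1.
- by rewrite V6 D6 P3 P1.
- by rewrite D6 P1.
- by rewrite F6 // /m5; lookups; rewrite F3 // /m2; lookups.
- by rewrite F6 // /m5; lookups; rewrite F3 // /m2; lookups.
- by move=> x; case: (Hi x).
- by move=> x; case: (Hi x).
- by move=> x; rewrite !F6 // !F5.
Qed.

End Input.

(** * The decision procedure *)

Section Decision.
Import GRing.Theory Num.Theory Order.TTheory.
Variable Sigma : finType.
Local Notation var := (var Sigma).
Local Notation prog := (prog var letter).
Local Notation P := (P Sigma).
Local Notation QI := (QI Sigma).
Local Notation CUR := (CUR Sigma).
Local Notation DD := (DD Sigma).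
Local Notation VV := (VV Sigma).
Local Notation T := (T Sigma).
Implicit Types (r : var -> nat) (x y : Sigma) (xs : seq Sigma).

(** A base that the walk never sets keeps the state [q0], which is visited as well. *)
Definition init_bases xs : prog := seqs [seq copy letter T CUR (BASE x) | x <- xs].
Definition membership_program : prog :=
  seqs [:: parse_input Sigma; copy letter T QI CUR; init_bases (enum Sigma);
           walk_program Sigma; final_program Sigma;
           PSeq (Star (level_program Sigma)) (end_program Sigma)].

Lemma run_init_bases w K xs r r' : run w K (init_bases xs) r r' ->
  [/\ forall v, ~~ is_base v -> v != T -> r' v = r v,
    forall x, x \in xs -> r' (BASE x) = r CUR & forall x, x \notin xs -> r' (BASE x) = r (BASE x)].
Proof.
elim: xs r => [|x xs IH] r; first by move=> ->.
move=> /run_cons[m /run_copy E /IH[F B N]]; have {}E := E isT isT isT.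
split=> [v Hb vT|y|y].
- rewrite F // E updN // updN //.
  by apply: contraNneq Hb => ->.
- rewrite inE; have [/B-> _|/N->] := boolP (y \in xs); first by rewrite E; lookups.
  by rewrite orbF => /eqP->; rewrite E; lookups.
- by rewrite inE negb_or => /andP[yx /N->]; rewrite E !updN.
Qed.

Lemma init_bases_run w K xs r : bounded K r -> exists r', run w K (init_bases xs) r r'.
Proof.
elim: xs r => [|x xs IH] r r_lt; first by exists r.
have R1 := @copy_run _ _ w K T CUR (BASE x) r isT isT isT (r_lt _).
have [r' Hr'] := IH _ (run_bounded R1 r_lt).
by exists r'; eexists; last exact: Hr'.
Qed.

Lemma signedE (z : int) : signed (z < 0)%R (natval (bits `|z|)) = z.
Proof. by rewrite natval_bits /signed; case: ltP; lia. Qed.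

Lemma run_membership w K r : size w < K -> run w K membership_program (fun=> 0) r ->
  @regular_membership Sigma w.
Proof.
move=> w_lt; rewrite /membership_program => /run_cons[m1 H1].
have [n [q0 [es [v [Ew Hin]]]]] := run_parse_input w_lt (fun=> erefl) H1.
have [occ_es vv_eq dd_le N1 Q1 sign1 bits1 zero1] := Hin.
move=> /run_cons[m2 /run_copy E2 /run_cons[m3 /run_init_bases[F3 B3 _]]].
have {}E2 := E2 isT isT isT.
have C3 : m3 CUR = q0 by rewrite F3 // E2; lookups.
have env3 : env n (m1 DD) (m1 VV) m3 by split; rewrite F3 // E2; lookups.
move=> /run_cons[m4 /(run_walk w_lt occ_es vv_eq env3 C3)[W [s [W_es HW C4 Hw BW]]]].
have env4 := env_base env3 Hw.
move=> /run_cons[m5 /(run_final w_lt occ_es vv_eq env4)[e [ees Es Et He]]].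
have {}Es : esrc e = s by apply: val_inj; rewrite /= Es C4.
have visited q : q \in s :: map esrc W -> q \in map esrc (W ++ [:: e]).
  by rewrite inE map_cat mem_cat /= inE Es orbC.
have q0_visited : q0 \in s :: map esrc W.
  by case: (W) HW => [/eqP[->]|e' W' /= /andP[/eqP[<-] _]]; rewrite ?mem_head // !inE eqxx orbT.
have base x : exists q : 'I_n, q \in map esrc (W ++ [:: e]) /\ m5 (BASE x) = q.
  rewrite (w_frame He) //; case: (BW x) => [->|[q Hq ->]]; last by exists q; split=> //; apply: visited.
  exists q0; split; first exact: visited.
  by rewrite B3 ?mem_enum // E2; lookups.
(* From here on the bases are fixed; each is the source of a transition of the guessed walk, so
   every cycle guessed later can be inserted there. *)
have [b Hb] := fin_all_exists base.
move=> /run_cons[m6 Hl _].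
have inv5 : level_state w (m1 DD) (m1 VV) b (fun x => (v x < 0)%R) (fun x => bits `|v x|) m5.
  split=> [|x|x|x].
  - exact: env_walks env4 He.
  - by case: (Hb x).
  - by rewrite (w_frame He) // (bw_frame Hw) // F3 // E2; lookups.
  - by rewrite (w_frame He) // (bw_frame Hw) // F3 // E2; lookups.
have [Zs HZs Ev] := run_levels w_lt occ_es vv_eq dd_le inv5 Hl.
exists n, q0, (map to_transition es), v; split=> //.
  by move=> d; rewrite in_fset => /mapP[e' _ ->]; apply: to_transition_regular.
apply: (@walk_language _ _ q0 es (W ++ [:: e]) Zs).
- move=> e'; rewrite !mem_cat inE -orbA => /or3P[/W_es|/eqP->|/flattenP[Z /HZs[Z_es _] /Z_es]] //.
- apply: walk_cat HW _; rewrite /= Es Et eqxx /=; exact: eqxx.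
- by move=> Z /HZs[_ [x HZ]]; exists (b x) => //; case: (Hb x).
- move=> x; rewrite -[RHS]signedE Ev !eff_cat; congr (_ + _)%R.
  rewrite (carry_walks x He); congr (_ + _)%R.
  rewrite /carry (bw_plus Hw) (bw_minus Hw) !F3 // E2; lookups.
  by case: (zero1 x) => -> ->; rewrite eff_counts !add0n.
Qed.

(** Exceeds both what the walk can put on a carry counter and the total length [#|Sigma| * n.+1] of
    the cycles of one level, as [levels_run] requires. *)
Definition carry_bound n := walk_bound Sigma n + #|Sigma| * n.+1 + 1.

Lemma membership_run w K : (forall n, n < size w -> 2 * carry_bound n + 2 < K) -> size w < K ->
  @regular_membership Sigma w -> exists r, run w K membership_program (fun=> 0) r.
Proof.
move=> K_large w_lt [n [q0 [ds [v [Ew Hreg Hlang]]]]].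
have [es Eds] : exists es, ds = map to_transition es.
  have H d : d \in ds -> exists e, d = to_transition e.
    by move=> dds; have [|Ht Ha] := Hreg d; [rewrite in_fset | apply: regular_transition].
  elim: ds H {Ew Hreg Hlang} => [|d ds IH] H; first by exists [::].
  have [e ->] := H d (mem_head _ _).
  have [|es ->] := IH; first by move=> d' d'ds; apply: H; rewrite inE d'ds orbT.
  by exists (e :: es).
rewrite {ds}Eds in Ew Hreg Hlang.
(* The number of non-terminals is written in unary, so bounds polynomial in [n] are polynomial in
   the input. *)
have lt_n : n < size w.
  by rewrite Ew enc_instanceE -catA [size _]size_cat [size (enc_unary n)]size_cat size_nseq addn1; exact: leq_addr.
have {K_large} := K_large n lt_n; set Cb := carry_bound n => Cb_K.
have K_gt1 : 1 < K by move: Cb_K; clear; lia.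
have [m1 R1 Hin] := parse_input_run w_lt K_gt1 (fun=> erefl) Ew.
have [occ_es vv_eq dd_le N1 Q1 sign1 bits1 zero1] := Hin.
have r0_lt : bounded K ((fun=> 0) : var -> nat) by move=> ?; apply: ltnW.
have m1_lt := run_bounded R1 r0_lt.
have R2 := @copy_run _ _ w K T QI CUR m1 isT isT isT (m1_lt _).
set m2 := upd (upd _ _ _) _ _ in R2; have m2_lt := run_bounded R2 m1_lt.
have [m3 R3] := init_bases_run w (enum Sigma) m2_lt; have m3_lt := run_bounded R3 m2_lt.
have [F3 _ _] := run_init_bases R3.
have C3 : m3 CUR = q0 by rewrite F3 // /m2; lookups.
have env3 : env n (m1 DD) (m1 VV) m3 by split; rewrite F3 // /m2; lookups.
have zero3 x : m3 (POS x) = 0 /\ m3 (NEG x) = 0 by rewrite !F3 // /m2; lookups.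
have [L [L_es HL Ev]] := (languageP q0 es v).1 Hlang.
have [W [b [C [lam [W_L HW W_size HC Ed]]]]] := run_decomposition HL.
(* The walk ends in [None], hence is not empty; its last transition is left to [final_program]. *)
case/lastP: W W_L HW W_size HC Ed => [//|W e] W_L HW W_size HC Ed.
rewrite -cats1 in W_L HW W_size HC Ed.
have [[s|] HW1] := walk_split HW; last by [].
rewrite /= => /andP[/eqP[Es] /eqP Et].
have W_es : {subset W <= es} by move=> e' e'W; apply/L_es/W_L; rewrite mem_cat e'W.
have ees : e \in es by apply/L_es/W_L; rewrite mem_cat mem_head orbT.
have lt_W : size W < Cb.
  by move: W_size; rewrite size_cat addn1 /Cb /carry_bound; clear; lia.
have [|m4 [R4 C4 Hw4 B4]] := walk_run w_lt occ_es vv_eq dd_le b env3 m3_lt _ W_es C3 HW1.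
  by move=> x; case: (zero3 x) => -> ->; move: lt_W Cb_K; clear; lia.
have m4_lt := run_bounded R4 m3_lt; have env4 := env_base env3 Hw4.
have c4 x : m4 (POS x) <= size W /\ m4 (NEG x) <= size W.
  rewrite (bw_plus Hw4) (bw_minus Hw4); case: (zero3 x) => -> ->.
  by rewrite !add0n npos_le nneg_le.
have [||m5 R5 Hw5] := final_run w_lt occ_es vv_eq dd_le env4 m4_lt _ ees _ Et.
- by move=> x; have := c4 x; move: lt_W Cb_K; clear; lia.
- by rewrite C4 Es.
have inv5 : level_state w (m1 DD) (m1 VV) b (fun x => (v x < 0)%R) (fun x => bits `|v x|) m5.
  split=> [|x|x|x].
  - exact: env_walks env4 Hw5.
  - rewrite (w_frame Hw5) // B4 //; have [+ _ _ _] := HC x.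
    by rewrite map_cat mem_cat /= !inE Es orbC.
  - by rewrite (w_frame Hw5) // (bw_frame Hw4) // F3 // /m2; lookups.
  - by rewrite (w_frame Hw5) // (bw_frame Hw4) // F3 // /m2; lookups.
(* Any number of levels covering the digits of [v] and of [lam] will do, as [lam x < 2 ^ lam x]; the
   length of the execution does not matter. *)
pose t := \sum_x (size (bits `|v x|) + lam x).
have le_t x : size (bits `|v x|) + lam x <= t by rewrite /t (bigD1 x) //= leq_addr.
have [||||||||r' R6] := levels_run w_lt occ_es vv_eq dd_le (C := C) (F := #|Sigma| * n.+1) (Cb := Cb)
  _ _ _ _ Cb_K inv5 (run_bounded R5 m4_lt) (t := t) (lam := lam).
- by move=> x e' e'C; apply: L_es; have [_ _ + _] := HC x; apply.
- by move=> x; have [] := HC x.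
- rewrite -sum_nat_const; apply: leq_sum => x _; by have [] := HC x.
- by rewrite /Cb /carry_bound; clear; lia.
- by move=> x; apply: leq_trans (le_t x); rewrite leq_addr.
- by move=> x; apply: leq_ltn_trans (ltn_expl _ (isT : 1 < 2)); apply: leq_trans (le_t x); rewrite leq_addl.
- have arith a d c k : a <= c -> d <= 1 -> c < k -> a + d <= k by lia.
  move=> x; rewrite (w_plus Hw5) (w_minus Hw5); have [h1 h2] := c4 x.
  by split; [apply: arith h1 _ lt_W; apply: npos_le | apply: arith h2 _ lt_W; apply: nneg_le].
- move=> x; rewrite signedE -Ev Ed eff_cat (carry_walks x Hw5); congr (_ + _ + _)%R.
  rewrite /carry (bw_plus Hw4) (bw_minus Hw4); case: (zero3 x) => -> ->.
  by rewrite eff_counts !add0n.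
exists r'; exists m1 => //; exists m2 => //; exists m3 => //; exists m4 => //; exists m5 => //.
by exists r'.
Qed.

(** For [b = n.+1], [k = #|Sigma|] and [s = size w + 2], the left side is [2 * carry_bound n + 2].
    Its largest term is at most [s ^ (2 * k) * s ^ (k.+2 * k) * s], where [s ^ 2] bounds
    [(2 * b).+1] and [s ^ k.+2] bounds [2 * k.+1 * b + 1]. This gives the exponent up to the
    constant, and [s ^ 3 >= 27] absorbs the sum of the terms and the numerical factors. *)
Lemma large_exponent b k s : 0 < b -> b + 2 <= s ->
  2 * (b + b * b + (2 * b).+1 ^ k * (2 * k.+1 * b + 1) ^ k * b + k * b + 1) + 2 <
  s ^ (k * k + 4 * k + 5).
Proof.
move=> b_gt0 le_s; have s_gt2 : 2 < s by lia.
have s_gt1 := ltnW s_gt2.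
have s_gt0 := ltnW s_gt1.
have lt_k : k < s ^ k by apply: ltn_expl.
have le_b : (2 * b).+1 <= s ^ 2 by rewrite -mulnn; nia.
have le_k : 2 * k.+1 * b + 1 <= s ^ k.+2.
  apply: leq_trans (_ : s ^ k * (2 * b).+1 <= _); first by nia.
  by rewrite -[k.+2]addn2 expnD leq_mul2l le_b orbT.
set X := s ^ (k * k + 4 * k + 2).
have h1 : b + b * b <= X.
  apply: leq_trans (_ : s ^ 2 <= _); first by rewrite -mulnn; nia.
  by rewrite leq_exp2l // leq_addl.
have h2 : (2 * b).+1 ^ k * (2 * k.+1 * b + 1) ^ k * b <= X.
  have E : k * k + 4 * k + 2 = 2 * k + k.+2 * k + 2 by lia.
  rewrite /X E; apply: leq_trans (_ : s ^ (2 * k + k.+2 * k) * s ^ 1 <= _); last first.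
    by rewrite -expnD leq_exp2l // leq_add2l.
  rewrite expnD !expnM expn1 leq_mul ?leq_mul //; last by lia.
    by case: (k) => // k'; rewrite leq_exp2r.
  by case: (k) le_k => // k' le_k; rewrite leq_exp2r.
have h3 : k * b <= X.
  apply: leq_trans (_ : s ^ k * s ^ 1 <= _).
    by rewrite leq_mul //; [apply: ltnW | rewrite expn1; lia].
  by rewrite -expnD leq_exp2l //; lia.
have X_gt0 : 0 < X by rewrite expn_gt0 s_gt0.
have -> : s ^ (k * k + 4 * k + 5) = X * s ^ 3.
  by rewrite /X -expnD; congr (_ ^ _); clear; lia.
have U_ge : 27 <= s ^ 3 by rewrite -[27]/(3 ^ 3) leq_exp2r.
have arith (V Y Z U : nat) : V <= X -> Y <= X -> Z <= X -> 27 <= U ->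
    2 * (V + Y + Z + 1) + 2 < X * U.
  by move: X_gt0; clearbody X; clear; nia.
exact: arith h1 h2 h3 U_ge.
Qed.

Lemma membership_inP : inP (@regular_membership Sigma).
Proof.
set k := #|Sigma|; set D := k * k + 4 * k + 5.
have D_gt0 : 0 < D by rewrite addn_gt0 orbT.
have [|M [p HM]] := run_inP membership_program D_gt0.
  by apply/card_gt0P; exists P.
exists M, p => w; have [b [Hv Hb]] := HM w; exists b; split=> //; rewrite Hb.
have w_lt : size w < (size w + 2) ^ D.
  apply: leq_trans (_ : (size w + 2) ^ 1 <= _); first by rewrite expn1; lia.
  by rewrite leq_exp2l // addn2.
split=> [[r]|]; first exact: run_membership.
apply: membership_run => // n lt_n.
have := @large_exponent n.+1 k (size w + 2); rewrite /carry_bound /walk_bound /relation_bound.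
rewrite card_ffun card_ord; apply; lia.
Qed.

End Decision.

Theorem theorem5p1 (Sigma : finType) : inP (@regular_membership Sigma).
Proof. exact: membership_inP. Qed.
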